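(* Let $A\subset\mathbb R$ be a union of half-open intervals, of finite total length $|A|$. For each $N\ge1$ divide $A$ uniformly into $N$ consecutive pieces of equal length, $A_i^{(N)}=\{x\in A:\ \frac{(i-1)|A|}{N}\le |A\cap(-\infty,x)|<\frac{i|A|}{N}\}$, and let $X_i^{(N)}=X_{A_i^{(N)}}$, $i=1,\dots,N$ (so that for $A=[0,1)$ one has $X_i^{(N)}=X_{[\frac{i-1}{N},\frac iN)}$). Then for every $k\ge1$ and every partition $\pi$ of $\{1,\dots,k\}$ the limit defining the stochastic measure, $$\mathrm{St}_\pi(A)=\lim_{N\to\infty}\ \sum_{(i_1,\dots,i_k)\in\{1,\dots,N\}^k_\pi}X^{(N)}_{i_1}X^{(N)}_{i_2}\cdots X^{(N)}_{i_k},$$ exists in operator norm.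
   Context: $\mathcal A$ is a finite von Neumann algebra with faithful normal tracial state $\varphi$. $\mu$ is a compactly supported freely infinitely divisible probability measure on $\mathbb R$ with variance $1$, and $\{\mu_t\}_{t\ge 0}$ is its additive free convolution semigroup ($\mu_1=\mu$). $I\mapsto X_I$ is a stationary process with freely independent increments: a map from finite half-open intervals $I=[a,b)\subset\mathbb R$ to self-adjoint elements of $\mathcal A$ (which can be extended to Borel subsets) such that the $X_I$ for disjoint $I$ are freely independent, $X_{I_1}+X_{I_2}=X_J$ when $J=I_1\sqcup I_2$, and $X_I$ has distribution $\mu_{|I|}$, where $|\cdot|$ is Lebesgue measure. $\{1,\dots,N\}^k_\pi$ is the set of $k$-tuples $(i_1,\dots,i_k)\in\{1,\dots,N\}^k$ such that $i_a=i_b$ if and only if $a,b$ lie in the same class of $\pi$. *)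

(* Defs.v *)
From HB Require Import structures.
From mathcomp Require Import all_boot all_order all_algebra.
From mathcomp Require Import sesquilinear.
From mathcomp Require Import complex.
From mathcomp Require Import all_classical all_reals all_analysis.

Set Implicit Arguments.
Unset Strict Implicit.
Unset Printing Implicit Defensive.

Import Order.TTheory GRing.Theory Num.Theory.
Import numFieldNormedType.Exports.

Local Open Scope classical_set_scope.
Local Open Scope ring_scope.
Local Open Scope complex_scope.

(* Complex Hilbert spaces; the form is linear in its first argument. *)
Record hilbert (R : realType) := Hilbert {
  hcarrier :> completeNormedModType R[i];
  hdot : {dot hcarrier for (@Num.conj R[i])};
  hdotE : forall x, hdot x x = `|x| ^+ 2
}.

Section BoundedOperators.
Context {R : realType} {H : hilbert R}.

Definition bounded_op : {pred (H -> H)} :=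
  [pred f : H -> H | `[< linear f /\ continuous f >]].

Record bop := Bop { bop_fun :> H -> H; bop_funP : bop_fun \in bounded_op }.

HB.instance Definition _ := [isSub for bop_fun].
HB.instance Definition _ := [Choice of bop by <:].

Lemma bounded_op_submod : submod_closed bounded_op.
Proof.
split.
  apply/asboolP; split; last exact: cst_continuous.
  by move=> a u v /=; rewrite scaler0 addr0.
move=> a f g /asboolP[fl fc] /asboolP[gl gc]; apply/asboolP.
have -> : a *: f + g = (fun x => a *: f x + g x) by [].
split=> [b u v|x].
  by rewrite fl gl !scalerDr !scalerA [b * a]mulrC addrACA.
by apply: cvgD; [apply: cvgZr; exact: fc | exact: gc].
Qed.

HB.instance Definition _ :=
  GRing.isSubmodClosed.Build _ _ bounded_op bounded_op_submod.
HB.instance Definition _ := [SubChoice_isSubLmodule of bop by <:].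

Lemma bounded_op_id : idfun \in bounded_op.
Proof. by apply/asboolP; split=> // x; exact: cvg_id. Qed.

Lemma bounded_op_comp (S T : bop) : S \o T \in bounded_op.
Proof.
case: S T => [f /= fP] [g /= gP].
move: fP gP => /asboolP[fl fc] /asboolP[gl gc]; apply/asboolP; split.
  by move=> a u v /=; rewrite gl fl.
by move=> x; apply: continuous_comp; [exact: gc | exact: fc].
Qed.

Definition bop_one : bop := Bop bounded_op_id.
Definition bop_mul (S T : bop) : bop := Bop (bounded_op_comp S T).

Fact bop_mulA : associative bop_mul.
Proof. by move=> S T U; exact: val_inj. Qed.
Fact bop_mul1 : left_id bop_one bop_mul.
Proof. by move=> S; exact: val_inj. Qed.
Fact bop_mulr1 : right_id bop_one bop_mul.
Proof. by move=> S; exact: val_inj. Qed.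
Fact bop_mulDl : left_distributive bop_mul +%R.
Proof. by move=> S T U; exact: val_inj. Qed.
Fact bop_mulDr : right_distributive bop_mul +%R.
Proof.
move=> S T U; apply: val_inj; apply: funext => x /=.
case: S => f /= /asboolP[fl _].
transitivity (f (1 *: T x + U x)); first by rewrite scale1r.
by rewrite fl scale1r.
Qed.

HB.instance Definition _ := GRing.Zmodule_isPzRing.Build bop
  bop_mulA bop_mul1 bop_mulr1 bop_mulDl bop_mulDr.

Definition opnorm (T : bop) : R :=
  sup [set complex.Re `|T x| | x in [set x : H | `|x| <= 1]].

(* S = T^*. *)
Definition is_adjoint (T S : bop) := forall x y : H, hdot H (T x) y = hdot H x (S y).

Definition selfadjoint (T : bop) := is_adjoint T T.

(* Loewner order.  On R[i], 0 <= z means that z is real and nonnegative. *)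
Definition op_le (S T : bop) := forall x : H, 0 <= hdot H (T x - S x) x.

Definition commutant (M : set bop) : set bop :=
  [set T | forall S, M S -> S * T = T * S].

Definition von_neumann_algebra (M : set bop) :=
  (forall T, M T -> exists2 S, M S & is_adjoint T S) /\
  commutant (commutant M) = M.

(* Every isometry of M is unitary. *)
Definition finite_algebra (M : set bop) :=
  forall U V, M U -> is_adjoint U V -> V * U = 1 -> U * V = 1.

Definition op_supremum (M D : set bop) (T : bop) :=
  [/\ M T, selfadjoint T, (forall S, D S -> op_le S T) &
    forall U, M U -> selfadjoint U -> (forall S, D S -> op_le S U) -> op_le T U].

Definition op_directed (D : set bop) :=
  D !=set0 /\
  forall S T, D S -> D T -> exists U, [/\ D U, op_le S U & op_le T U].

(* phi is only used on M; its values elsewhere are irrelevant. *)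
Definition faithful_normal_tracial_state (M : set bop) (phi : bop -> R[i]) :=
  [/\ (forall (a : R[i]) S T, M S -> M T -> phi (a *: S + T) = a * phi S + phi T),
      phi 1 = 1 /\
      (forall T S, M T -> is_adjoint T S -> 0 <= phi (S * T)),
      (forall T S, M T -> is_adjoint T S -> phi (S * T) = 0 -> T = 0),
      (forall S T, M S -> M T -> phi (S * T) = phi (T * S)) &
      forall (D : set bop) T,
        D `<=` M -> (forall S, D S -> selfadjoint S) ->
        op_directed D -> op_supremum M D T -> supremums (phi @` D) (phi T)].

Definition star_subalgebra (B : set bop) :=
  [/\ B 1,
      (forall (a : R[i]) S T, B S -> B T -> B (a *: S + T)),
      (forall S T, B S -> B T -> B (S * T)) &
      forall S T, B S -> is_adjoint S T -> B T].

End BoundedOperators.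

Arguments bop {R} H.

Record tracial_space (R : realType) := TracialSpace {
  ts_hilbert : hilbert R;
  ts_alg : set (bop ts_hilbert);
  ts_trace : bop ts_hilbert -> R[i];
  ts_vN : von_neumann_algebra ts_alg;
  ts_finite : finite_algebra ts_alg;
  ts_state : faithful_normal_tracial_state ts_alg ts_trace
}.

Notation ts_op A := (bop (ts_hilbert A)).

Section FreeProbability.
Context {R : realType}.
Implicit Types A : tracial_space R.

(* Freeness of a family of subalgebras: alternating products of centered
   elements are centered. *)
Definition free_subalgebras A (I : eqType) (B : I -> set (ts_op A)) :=
  forall s : seq (I * ts_op A), s != [::] ->
    sorted (fun p q => p.1 != q.1) s ->
    (forall p, p \in s -> B p.1 p.2 /\ ts_trace p.2 = 0) ->
    ts_trace (\prod_(p <- s) p.2) = 0.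

Definition freely_independent A (I : eqType) (X : I -> ts_op A) :=
  free_subalgebras (fun i => smallest star_subalgebra [set X i]).

Local Notation law := (probability (measurableTypeR R) R).
Implicit Types mu nu rho : law.

Definition compactly_supported mu :=
  exists2 K : set R, compact K & mu (~` K) = 0%E.

Definition has_law A (X : ts_op A) mu :=
  compactly_supported mu /\
  forall n, ts_trace (X ^+ n) = (\int[mu]_x (x ^+ n))%:C.

(* rho is the additive free convolution of mu and nu. *)
Definition is_free_conv mu nu rho :=
  exists A (X : bool -> ts_op A),
    [/\ (forall b, ts_alg (X b) /\ selfadjoint (X b)),
        freely_independent X,
        has_law (X false) mu,
        has_law (X true) nu &
        has_law (X false + X true) rho].

Inductive is_free_power nu : nat -> law -> Prop :=
| free_power1 : is_free_power nu 1 nu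
| free_powerS n rho rho' : is_free_power nu n rho ->
    is_free_conv rho nu rho' -> is_free_power nu n.+1 rho'.

Definition freely_infinitely_divisible mu :=
  forall n, (0 < n)%N -> exists nu, is_free_power nu n mu.

Definition is_free_conv_semigroup mu (mu_ : R -> law) :=
  [/\ (forall B, measurable B -> mu_ 1 B = mu B),
      (forall B, measurable B -> mu_ 0 B = \d_(0 : measurableTypeR R) B),
      (forall s t, 0 <= s -> 0 <= t -> is_free_conv (mu_ s) (mu_ t) (mu_ (s + t))) &
      forall f : R -> R, continuous f -> (exists C, forall x, `|f x| <= C) ->
        {within `[0, +oo[, continuous (fun t => \int[mu_ t]_x f x)}].

Definition disjoint_intervals n (a b : 'I_n -> R) :=
  (forall i, a i < b i) /\ trivIset setT (fun i => `[a i, b i[%classic).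

(* The process is I = [a, b[ |-> X a b; only the values at a < b matter. *)
Record stationary_free_increments A (mu_ : R -> law) (X : R -> R -> ts_op A) :
    Prop := {
  sfi_selfadjoint : forall a b, a < b -> ts_alg (X a b) /\ selfadjoint (X a b);
  sfi_free : forall n (a b : 'I_n -> R), disjoint_intervals a b ->
    freely_independent (fun i => X (a i) (b i));
  sfi_additive : forall a b c, a < b -> b < c -> X a b + X b c = X a c;
  sfi_law : forall a b, a < b -> has_law (X a b) (mu_ (b - a))
}.

Local Notation leb := (@lebesgue_measure R).

(* x is the value at the set E of the extension of X to Borel sets of finite
   measure: the continuous extension, from finite disjoint unions of intervals
   with the distance |E + F|, to the 2-norm of the trace. *)
Definition is_process_value A (X : R -> R -> ts_op A) (E : set R) (x : ts_op A) :=
  [/\ ts_alg x, selfadjoint x &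
    forall e : R, 0 < e -> exists2 d : R, 0 < d &
      forall n (a b : 'I_n -> R), disjoint_intervals a b ->
        (leb (E `+` \bigcup_i `[a i, b i[%classic) < d%:E)%E ->
        ts_trace ((x - \sum_i X (a i) (b i)) ^+ 2) < e%:C].

Definition process_at A (X : R -> R -> ts_op A) (E : set R) : ts_op A :=
  xget 0 (is_process_value X E).

Definition half_open_union (E : set R) :=
  exists F : set (R * R), E = \bigcup_(p in F) `[p.1, p.2[%classic.

(* The piece number i.+1 of the uniform division of E into N pieces. *)
Definition piece (E : set R) (N i : nat) : set R :=
  let len := fine (leb E) in
  [set x | E x /\ i%:R * len / N%:R <= fine (leb (E `&` `]-oo, x[%classic)) < i.+1%:R * len / N%:R].

Definition in_class k N (pi : {set {set 'I_k}}) (i : {ffun 'I_k -> 'I_N}) :=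
  [forall a, forall b, (i a == i b) == (b \in finset.pblock pi a)].

Definition stochastic_sum A (X : R -> R -> ts_op A) (E : set R) k
    (pi : {set {set 'I_k}}) (N : nat) : ts_op A :=
  \sum_(i : {ffun 'I_k -> 'I_N} | in_class pi i)
    \prod_(j < k) process_at X (piece E N (i j)).

End FreeProbability.

(* Main.v *)
From HB Require Import structures.
Require Import Defs.
From mathcomp Require Import all_boot all_order all_algebra.
From mathcomp Require Import sesquilinear complex ring lra zify.
From mathcomp Require Import all_classical all_reals all_analysis.

Set Implicit Arguments.
Unset Strict Implicit.
Unset Printing Implicit Defensive.

Import Order.TTheory GRing.Theory Num.Theory.
Import numFieldNormedType.Exports.

Local Open Scope classical_set_scope.
Local Open Scope ring_scope.

(** For a relation e on the positions let Q_e(N) be the sum over the index tuples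
    with i_a = i_b whenever e a b.  The partition sums are alternating sums of
    such Q_e(N) (Moebius inversion), so it suffices that N |-> Q_e(N) is Cauchy
    in operator norm.

    Approximate the pieces of a common refinement of two divisions by disjoint
    cells of a common tiny length h.  Both Q_e(N) are then strong limits of the
    sums over tuples t of cells with f(t_a) = f(t_b) whenever e a b, where f maps a
    cell to its piece.  Compared with f = id, such a sum changes in norm by
    O(sqrt delta), where delta bounds the mass of the fibers of f, uniformly in
    the number of cells.

    This estimate holds for any free family of elements x_c with bounded norms
    and with means and second moments O(h).  The norm is recovered from the moments
    of the trace; freeness computes them by letting x_c act on words of letters
    (c, n), the normalised centered powers of x_c, as a scalar plus a creation, an
    annihilation and a part acting on the top letter.  The Schur test bounds the
    sum over all tuples.  If a coincidence demanded by e is not already forced by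
    the creation and annihilation pattern, the row and column sums gain a factor
    delta.

    The increments have means m t and variances v t, by additivity and the
    weak continuity at 0, so finite sums of increments depend continuously in the
    2-norm on the union of the intervals; normality of the trace turns fast
    2-norm convergence of a bounded sequence into strong convergence. *)

(** * Hilbert spaces and bounded operators *)

(** The estimate must survive cells of length [h] tending to 0 while their number grows like
    [1 / h]. In the Schur test one position contributes its column sum times its row sum. A creation
    costs [b] times the number of cells in columns but only [b] in rows, because the resulting word
    names the index; an annihilation does the reverse. With [b^2 = B h] every such product is free
    of [h], which dictates the normalisation of the letters.

    The words of letters are centered but not orthonormal, so the Euclidean norm of the matrices is
    not the norm of the algebra. Only the entry at the empty word is meaningful: it is the trace.
    Exponential growth of moments is enough to recover the norm, but the adjoint needs a matrix of
    its own.

    Values of the process on general sets are only 2-norm limits, and the 2-norm says nothing about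
    products or operator norms. Strong convergence of bounded sequences does: it passes through
    products, and the operator norm is lower semicontinuous for it. Resolvents [(1 + S)^-1], given
    by Neumann series, take the place of spectral projections. The comparison of the divisions into
    [N] and [N m] pieces has error [O(N^(-1/2))], uniformly in [m]. *)

Section ComplexParts.
Context {R : realType}.
Implicit Types z w : R[i].

Lemma ReD z w : complex.Re (z + w) = complex.Re z + complex.Re w.
Proof. by case: z w => ? ? []. Qed.

Lemma ReN z : complex.Re (- z) = - complex.Re z.
Proof. by case: z. Qed.

Lemma ReZ (a : R) z : complex.Re (a%:C%C * z) = a * complex.Re z.
Proof. by case: z => ? ? /=; rewrite mul0r subr0. Qed.

Lemma Re_conj z : complex.Re z^* = complex.Re z.
Proof. by case: z. Qed.

Lemma complex_Re_Im z :
  z = Complex (complex.Re z) (complex.Re (Complex 0 (-1) * z)).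
Proof. by case: z => ? ? /=; rewrite mul0r sub0r mulN1r opprK. Qed.

End ComplexParts.

Section HilbertSpace.
Context {R : realType} (H : hilbert R).
Implicit Types (x y z : H) (a b : R).

Definition nrm x : R := complex.Re `|x|.
Definition rdot x y : R := complex.Re (hdot H x y).

Lemma nrmE x : `|x| = (nrm x)%:C%C.
Proof. by rewrite /nrm RRe_real // ger0_real. Qed.

Lemma nrm_ge0 x : 0 <= nrm x.
Proof. by rewrite -ler0c -nrmE. Qed.

Lemma nrm0 : nrm 0 = 0.
Proof. by rewrite /nrm normr0. Qed.

Lemma nrm_eq0 x : nrm x = 0 -> x = 0.
Proof. by move=> h; apply: normr0_eq0; rewrite nrmE h. Qed.

Lemma nrmD x y : nrm (x + y) <= nrm x + nrm y.
Proof. by rewrite -lecR rmorphD /= -!nrmE ler_normD. Qed.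

Lemma nrmN x : nrm (- x) = nrm x.
Proof. by rewrite /nrm normrN. Qed.

Lemma nrmZ a x : nrm (a%:C%C *: x) = `|a| * nrm x.
Proof.
apply: complexI; rewrite rmorphM /= -!nrmE normrZ; congr (_ * _).
by rewrite normc_def /= expr0n addr0 sqrtr_sqr.
Qed.

Lemma nrmB x y : nrm (x - y) = nrm (y - x).
Proof. by rewrite -nrmN opprB. Qed.

Lemma rdotDl x y z : rdot (x + y) z = rdot x z + rdot y z.
Proof.
rewrite /rdot linearDl; exact: ReD.
Qed.

Lemma rdotC x y : rdot x y = rdot y x.
Proof.
rewrite /rdot hermC expr0 mul1r; exact: Re_conj.
Qed.

Lemma rdotDr x y z : rdot x (y + z) = rdot x y + rdot x z.
Proof. by rewrite rdotC rdotDl !(rdotC x). Qed.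

Lemma rdotNl x y : rdot (- x) y = - rdot x y.
Proof. rewrite /rdot linearNl; exact: ReN. Qed.

Lemma rdotNr x y : rdot x (- y) = - rdot x y.
Proof. by rewrite rdotC rdotNl rdotC. Qed.

Lemma rdotZl a x y : rdot (a%:C%C *: x) y = a * rdot x y.
Proof.
rewrite /rdot linearZl_LR; exact: ReZ.
Qed.

Lemma rdotZr a x y : rdot x (a%:C%C *: y) = a * rdot x y.
Proof. by rewrite rdotC rdotZl rdotC. Qed.

Lemma rdotBl x y z : rdot (x - y) z = rdot x z - rdot y z.
Proof. by rewrite rdotDl rdotNl. Qed.

Lemma rdotBr x y z : rdot x (y - z) = rdot x y - rdot x z.
Proof. by rewrite rdotDr rdotNr. Qed.

Lemma rdotxx x : rdot x x = nrm x ^+ 2.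
Proof. by apply: complexI; rewrite /rdot hdotE nrmE -rmorphXn. Qed.

Lemma nrmBsq x y : nrm (x - y) ^+ 2 = nrm x ^+ 2 - 2 * rdot x y + nrm y ^+ 2.
Proof.
rewrite -!rdotxx !rdotBl !rdotBr (rdotC y x).
by ring.
Qed.

Lemma rdot_le x y : rdot x y <= nrm x * nrm y.
Proof.
have [x0|xn0] := eqVneq (nrm x) 0.
  by rewrite (nrm_eq0 x0) nrm0 mul0r /rdot linear0l.
have [y0|yn0] := eqVneq (nrm y) 0.
  by rewrite (nrm_eq0 y0) nrm0 mulr0 /rdot linear0r.
have xp : 0 < nrm x by rewrite lt_neqAle eq_sym xn0 nrm_ge0.
have yp : 0 < nrm y by rewrite lt_neqAle eq_sym yn0 nrm_ge0.
have := sqr_ge0 (nrm ((nrm y)%:C%C *: x - (nrm x)%:C%C *: y)).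
rewrite nrmBsq !nrmZ rdotZl rdotZr !ger0_norm ?nrm_ge0//.
rewrite (_ : _ + _ = 2 * (nrm x * nrm y) * (nrm x * nrm y - rdot x y)); last by ring.
by rewrite pmulr_rge0 ?subr_ge0// mulr_gt0// mulr_gt0.
Qed.

Lemma rdot_abs x y : `|rdot x y| <= nrm x * nrm y.
Proof.
rewrite ler_norml rdot_le andbT lerNl -rdotNl.
by rewrite -(nrmN x) rdot_le.
Qed.

Lemma rdot_inj x y : (forall z, rdot x z = rdot y z) -> x = y.
Proof.
move=> h; apply/eqP; rewrite -subr_eq0; apply/eqP; apply: nrm_eq0.
by apply/eqP; rewrite -sqrf_eq0 -rdotxx rdotBl h subrr.
Qed.

(** Multiplying the first argument by [-i] turns the imaginary part of the form into a real part, so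
    adjointness can be tested on [rdot] alone. *)
Lemma hdotRI x y : hdot H x y = Complex (rdot x y) (rdot (Complex 0 (-1) *: x) y).
Proof.
rewrite /rdot linearZl_LR; exact: complex_Re_Im.
Qed.

Definition tends (u : nat -> H) x :=
  forall e : R, 0 < e -> exists N, forall n, (N <= n)%N -> nrm (u n - x) < e.

Lemma complete_tends (u : nat -> H) :
  (forall e : R, 0 < e -> exists N, forall n m, (N <= n)%N -> (N <= m)%N ->
    nrm (u n - u m) < e) -> exists x, tends u x.
Proof.
move=> uC.
have /cvg_ex[x ux] : cvg (u @ \oo).
  apply/cauchy_cvgP; apply/cauchy_ballP => e e0.
  have eR : e = (complex.Re e)%:C%C by rewrite RRe_real// gtr0_real.
  have [|N NP] := uC (complex.Re e); first by rewrite -ltcR -eR.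
  near_simpl.
  exists ([set n | (N <= n)%N], [set n | (N <= n)%N]).
    by split; exact: nbhs_infty_ge.
  by case=> n m /= [Nn Nm]; rewrite -ball_normE /= nrmE eR ltcR NP.
exists x => e e0.
have /cvgrPdist_lt/(_ e%:C%C) := ux.
rewrite ltcR => /(_ e0) [N _ NP]; exists N => n Nn.
by have := NP n Nn; rewrite /= nrmE ltcR nrmB.
Qed.

Lemma tends_uniq u x y : tends u x -> tends u y -> x = y.
Proof.
move=> ux uy; apply/eqP; rewrite -subr_eq0; apply/eqP; apply: nrm_eq0.
apply/eqP; rewrite eq_le nrm_ge0 andbT; apply/ler_addgt0Pl => e e0.
have e20 : 0 < e / 2 by rewrite divr_gt0.
have [N NP] := ux _ e20; have [M MP] := uy _ e20.
rewrite addr0 -(subrKA (u (maxn N M))); apply: (le_trans (nrmD _ _)).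
rewrite nrmB [leRHS]splitr lerD// ltW//; first by rewrite NP// leq_maxl.
by rewrite MP// leq_maxr.
Qed.

Lemma tends_le u x (C : R) : tends u x -> (forall n, nrm (u n) <= C) -> nrm x <= C.
Proof.
move=> ux uC; apply/ler_addgt0Pl => e e0; have [N NP] := ux _ e0.
rewrite -[x](subKr (u N)); apply: (le_trans (nrmD _ _)).
by rewrite addrC nrmN lerD// ltW// NP.
Qed.

Lemma tendsD u v x y : tends u x -> tends v y -> tends (fun n => u n + v n) (x + y).
Proof.
move=> ux uy e e0; have e20 : 0 < e / 2 by rewrite divr_gt0.
have [N NP] := ux _ e20; have [M MP] := uy _ e20.
exists (maxn N M) => n; rewrite geq_max => /andP[Nn Mn].
rewrite opprD addrACA; apply: (le_lt_trans (nrmD _ _)).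
by rewrite [ltRHS]splitr ltrD// ?NP ?MP.
Qed.

Lemma tends_cst x : tends (fun=> x) x.
Proof. by move=> e e0; exists 0%N => n _; rewrite subrr nrm0. Qed.

Lemma tends_rdot u v x y : tends u x -> tends v y ->
  forall e : R, 0 < e -> exists N, forall n, (N <= n)%N -> `|rdot (u n) (v n) - rdot x y| < e.
Proof.
move=> ux vy e e0.
pose C := nrm x + nrm y + 2; have C0 : 0 < C by rewrite /C; have := nrm_ge0 x; have := nrm_ge0 y; lra.
pose d := Num.min 1 (e / C).
have d0 : 0 < d by rewrite lt_min ltr01 divr_gt0.
have [N NP] := ux _ d0; have [M MP] := vy _ d0.
exists (maxn N M) => n; rewrite geq_max => /andP[Nn Mn].
have -> : rdot (u n) (v n) - rdot x y = rdot (u n - x) (v n) + rdot x (v n - y).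
  by rewrite rdotBl rdotBr; ring.
have h1 := NP _ Nn; have h2 := MP _ Mn.
have h3 : nrm (v n) <= nrm y + 1.
  rewrite -[v n](subrK y); apply: (le_trans (nrmD _ _)).
  rewrite addrC lerD2l (le_trans (ltW h2))//.
  by rewrite /d ge_min lexx.
apply: (le_lt_trans (ler_normD _ _)).
apply: (le_lt_trans (lerD (rdot_abs _ _) (rdot_abs _ _))).
have dC : d * C <= e by rewrite -ler_pdivlMr// /d ge_min lexx orbT.
apply: lt_le_trans dC; rewrite /C.
have := nrm_ge0 x; have := nrm_ge0 y; have := nrm_ge0 (v n).
have := nrm_ge0 (u n - x); have := nrm_ge0 (v n - y).
by nra.
Qed.

End HilbertSpace.

Section BoundedOps.
Context {R : realType} {H : hilbert R}.
Implicit Types (S T U : bop H) (x y z : H).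

Lemma bop_linear T : linear T.
Proof. by case: T => f /= /asboolP[]. Qed.

Lemma bop0r T : T 0 = 0.
Proof.
have := bop_linear T 1 0 0; rewrite !scale1r addr0 => h.
by apply: (addrI (T 0)); rewrite -h addr0.
Qed.

Lemma bopDr T x y : T (x + y) = T x + T y.
Proof. by have := bop_linear T 1 x y; rewrite !scale1r. Qed.

Lemma bopZr T (a : R[i]) x : T (a *: x) = a *: T x.
Proof. by have := bop_linear T a x 0; rewrite bop0r !addr0. Qed.

Lemma bopNr T x : T (- x) = - T x.
Proof. by rewrite -scaleN1r bopZr scaleN1r. Qed.

Lemma bopBr T x y : T (x - y) = T x - T y.
Proof. by rewrite bopDr bopNr. Qed.

Lemma bop_ext S T : (forall x, S x = T x) -> S = T.
Proof. by move=> h; apply: val_inj; apply: funext. Qed.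

Lemma bop_scaleAl (a : R[i]) S T : (a *: S) * T = a *: (S * T).
Proof. exact: bop_ext. Qed.

Lemma bop_scaleAr (a : R[i]) S T : S * (a *: T) = a *: (S * T).
Proof. by apply: bop_ext => x; exact: (bopZr S a (T x)). Qed.

Lemma bop_bound T : exists2 C : R, 0 <= C & forall x, nrm (T x) <= C * nrm x.
Proof.
have Tl := bop_linear T.
have Tc : continuous T by case: T {Tl} => f /= /asboolP[].
pose f := HB.pack_for {linear H -> H} (T : H -> H) (GRing.isLinear.Build _ _ _ _ _ Tl).
have /linear_bounded_continuous/linear_boundedP : continuous f by [].
move=> /pinfty_ex_gt0[r r0 rP].
have rE : r = (complex.Re r)%:C%C by rewrite RRe_real// gtr0_real.
exists (complex.Re r); first by rewrite -ler0c -rE ltW.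
by move=> x; have := rP x; rewrite /= !nrmE rE -rmorphM /= lecR.
Qed.

Lemma bop_intro (f : H -> H) (C : R) : linear f -> 0 <= C ->
  (forall x, nrm (f x) <= C * nrm x) -> exists T : bop H, forall x, T x = f x.
Proof.
move=> fl C0 fC.
pose g := HB.pack_for {linear H -> H} f (GRing.isLinear.Build _ _ _ _ _ fl).
have fc : continuous g.
  apply/linear_bounded_continuous/linear_boundedP.
  exists (C%:C%C); split; first by rewrite ger0_real// ler0c.
  move=> r Cr x; apply: (@le_trans _ _ (C%:C%C * `|x|)).
    by rewrite !nrmE -rmorphM /= lecR.
  by rewrite ler_wpM2r// ltW.
have fb : f \in bounded_op by apply/asboolP.
by exists (Bop fb).
Qed.

Lemma nrm_opnorm T x : nrm (T x) <= opnorm T * nrm x.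
Proof.
have [C C0 TC] := bop_bound T.
have ub y : nrm y <= 1 -> nrm (T y) <= opnorm T.
  move=> y1; apply: ub_le_sup; last by exists y => //=; rewrite nrmE -[1]/(1%:C%C) lecR.
  exists C => _ [z /= z1 <-]; apply: (le_trans (TC z)).
  by rewrite ler_piMr// -lecR -nrmE.
have [x0|xn0] := eqVneq (nrm x) 0.
  by rewrite (nrm_eq0 x0) bop0r !nrm0 mulr0.
have xp : 0 < nrm x by rewrite lt_neqAle eq_sym xn0 nrm_ge0.
have := ub (((nrm x)^-1)%:C%C *: x).
rewrite bopZr !nrmZ ger0_norm ?invr_ge0 ?nrm_ge0// mulVf// => /(_ (lexx _)).
by rewrite mulrC ler_pdivrMr.
Qed.

Lemma opnorm_ge0 T : 0 <= opnorm T.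
Proof.
have [C C0 TC] := bop_bound T.
apply: ub_le_sup; last by exists 0; rewrite /= ?normr0 ?ler01// bop0r normr0.
exists C => _ [z /= z1 <-]; apply: (le_trans (TC z)).
by rewrite ler_piMr// -lecR -nrmE.
Qed.

Lemma opnorm_le T (C : R) : 0 <= C ->
  (forall x, nrm (T x) <= C * nrm x) -> opnorm T <= C.
Proof.
move=> C0 TC; apply: ge_sup.
  by exists (nrm (T 0)); exists 0; rewrite //= normr0 ler01.
move=> _ [z /= z1 <-]; apply: (le_trans (TC z)).
by rewrite ler_piMr// -lecR -nrmE.
Qed.

Lemma opnormD S T : opnorm (S + T) <= opnorm S + opnorm T.
Proof.
apply: opnorm_le => [|x]; first by rewrite addr_ge0 ?opnorm_ge0.
by rewrite mulrDl (le_trans (nrmD _ _))// lerD ?nrm_opnorm.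
Qed.

Lemma opnormN T : opnorm (- T) = opnorm T.
Proof. by rewrite /opnorm; congr sup; apply: eq_imagel => x _ /=; rewrite normrN. Qed.

Lemma opnorm0 : opnorm (0 : bop H) = 0.
Proof.
apply/eqP; rewrite eq_le opnorm_ge0 andbT; apply: opnorm_le => // x.
by rewrite mul0r -[X in nrm X]/(0 : H) nrm0.
Qed.

Lemma bop_lim (u : nat -> bop H) (C : R) : 0 <= C ->
  (forall n x, nrm (u n x) <= C * nrm x) ->
  (forall x, exists y, tends (fun n => u n x) y) ->
  exists2 T : bop H, (forall x, tends (fun n => u n x) (T x)) &
     (forall x, nrm (T x) <= C * nrm x).
Proof.
move=> C0 uC /choice[f fP].
have fC x : nrm (f x) <= C * nrm x by apply: (tends_le (fP x)).
have fl : linear f.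
  move=> a x y; apply: (tends_uniq (fP _)).
  have h : (fun n => u n (a *: x + y)) = (fun n => u n (a *: x) + u n y).
    by apply: funext => n; rewrite bopDr.
  rewrite h; apply: tendsD; last exact: fP.
  move=> e e0; have [a' a'P] : exists a', `|a| = a'%:C%C.
    by exists (complex.Re `|a|); rewrite RRe_real// ger0_real.
  have a'0 : 0 <= a' by rewrite -ler0c -a'P.
  have e1 : 0 < e / (a' + 1) by rewrite divr_gt0// ltr_wpDl.
  have [N NP] := fP x _ e1; exists N => n Nn.
  rewrite bopZr -scalerBr.
  apply: (@le_lt_trans _ _ (a' * nrm (u n x - f x))).
    by rewrite -lecR rmorphM /= -a'P -!nrmE normrZ.
  apply: (@le_lt_trans _ _ (a' * (e / (a' + 1)))).
    by rewrite ler_wpM2l// ltW// NP.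
  rewrite mulrA ltr_pdivrMr ?ltr_wpDl//; by rewrite mulrDr mulr1 [ltRHS]addrC mulrC ltr_pwDl.
have [T TP] := bop_intro fl C0 fC.
by exists T => x; rewrite TP.
Qed.

Lemma tends_bop T u x : tends u x -> tends (fun n => T (u n)) (T x).
Proof.
move=> ux e e0; have [C C0 TC] := bop_bound T.
have e1 : 0 < e / (C + 1) by rewrite divr_gt0// ltr_wpDl.
have [N NP] := ux _ e1; exists N => n Nn.
rewrite -bopBr; apply: (le_lt_trans (TC _)).
apply: (@le_lt_trans _ _ (C * (e / (C + 1)))); first by rewrite ler_wpM2l// ltW// NP.
by rewrite mulrA ltr_pdivrMr ?ltr_wpDl// mulrDr mulr1 [ltRHS]addrC mulrC ltr_pwDl.
Qed.

Lemma tends_bop_mul (u v : nat -> bop H) S T (C : R) : 0 <= C ->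
  (forall n x, nrm (u n x) <= C * nrm x) ->
  (forall x, tends (fun n => u n x) (S x)) ->
  (forall x, tends (fun n => v n x) (T x)) ->
  forall x, tends (fun n => (u n * v n) x) ((S * T) x).
Proof.
move=> C0 uC uS vT x.
have h : (fun n => (u n * v n) x) = (fun n => u n (v n x - T x) + u n (T x)).
  by apply: funext => n; rewrite -bopDr subrK.
rewrite h -[(S * T) x]add0r; apply: tendsD; last exact: uS.
move=> e e0; have e1 : 0 < e / (C + 1) by rewrite divr_gt0// ltr_wpDl.
have [N NP] := vT x _ e1; exists N => n Nn.
rewrite subr0; apply: (le_lt_trans (uC _ _)).
apply: (@le_lt_trans _ _ (C * (e / (C + 1)))); first by rewrite ler_wpM2l// ltW// NP.
by rewrite mulrA ltr_pdivrMr ?ltr_wpDl// mulrDr mulr1 [ltRHS]addrC mulrC ltr_pwDl.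
Qed.

Lemma is_adjointP S T :
  is_adjoint S T <-> forall x y, rdot (S x) y = rdot x (T y).
Proof.
split=> [h x y|h x y]; first by rewrite /rdot h.
by rewrite !hdotRI -bopZr !h.
Qed.

Lemma is_adjointC S T : is_adjoint S T -> is_adjoint T S.
Proof. by move=> /is_adjointP h; apply/is_adjointP => x y; rewrite rdotC -h rdotC. Qed.

Lemma is_adjointD S T S' T' :
  is_adjoint S S' -> is_adjoint T T' -> is_adjoint (S + T) (S' + T').
Proof.
move=> /is_adjointP h /is_adjointP k; apply/is_adjointP => x y.
by rewrite rdotDl rdotDr h k.
Qed.

Lemma is_adjointN S S' : is_adjoint S S' -> is_adjoint (- S) (- S').
Proof.
move=> /is_adjointP h; apply/is_adjointP => x y.
by rewrite rdotNl rdotNr h.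
Qed.

Lemma is_adjointB S T S' T' :
  is_adjoint S S' -> is_adjoint T T' -> is_adjoint (S - T) (S' - T').
Proof. by move=> h k; apply: is_adjointD => //; apply: is_adjointN. Qed.

Lemma is_adjointM S T S' T' :
  is_adjoint S S' -> is_adjoint T T' -> is_adjoint (S * T) (T' * S').
Proof.
move=> /is_adjointP h /is_adjointP k; apply/is_adjointP => x y.
by rewrite h k.
Qed.

Lemma is_adjointZ (a : R) S S' :
  is_adjoint S S' -> is_adjoint (a%:C%C *: S) (a%:C%C *: S').
Proof.
move=> /is_adjointP h; apply/is_adjointP => x y.
by rewrite rdotZl rdotZr h.
Qed.

Lemma is_adjoint0 : is_adjoint (0 : bop H) 0.
Proof. by apply/is_adjointP => x y; rewrite /rdot linear0l linear0r. Qed.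

Lemma is_adjoint1 : is_adjoint (1 : bop H) 1.
Proof. exact/is_adjointP. Qed.

Lemma is_adjoint_sum I (r : seq I) (P : pred I) (F G : I -> bop H) :
  (forall i, P i -> is_adjoint (F i) (G i)) ->
  is_adjoint (\sum_(i <- r | P i) F i) (\sum_(i <- r | P i) G i).
Proof.
move=> h; elim/big_rec2: _ => [|i S T Pi ST]; first exact: is_adjoint0.
by apply: is_adjointD => //; apply: h.
Qed.

Lemma selfadjointD S T : selfadjoint S -> selfadjoint T -> selfadjoint (S + T).
Proof. exact: is_adjointD. Qed.

Lemma selfadjointB S T : selfadjoint S -> selfadjoint T -> selfadjoint (S - T).
Proof. exact: is_adjointB. Qed.

Lemma selfadjointZ (a : R) S : selfadjoint S -> selfadjoint (a%:C%C *: S).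
Proof. exact: is_adjointZ. Qed.

Lemma selfadjoint1 : selfadjoint (1 : bop H).
Proof. exact: is_adjoint1. Qed.

Lemma selfadjoint0 : selfadjoint (0 : bop H).
Proof. exact: is_adjoint0. Qed.

Lemma selfadjointX T n : selfadjoint T -> selfadjoint (T ^+ n).
Proof.
move=> h; elim: n => [|n IH]; first exact: is_adjoint1.
by rewrite /selfadjoint {1}exprS exprSr; apply: is_adjointM.
Qed.

Lemma selfadjoint_lim (u : nat -> bop H) T :
  (forall n, selfadjoint (u n)) -> (forall x, tends (fun n => u n x) (T x)) ->
  selfadjoint T.
Proof.
move=> us uT; apply/is_adjointP => x y.
apply/eqP; rewrite eq_le; apply/andP; split; apply/ler_addgt0Pl => e e0.
  have [N NP] := tends_rdot (uT x) (tends_cst y) (divr_gt0 e0 (ltr0n R 2)).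
  have [M MP] := tends_rdot (tends_cst x) (uT y) (divr_gt0 e0 (ltr0n R 2)).
  have := NP (maxn N M) (leq_maxl _ _); have := MP (maxn N M) (leq_maxr _ _).
  by have /is_adjointP -> := us (maxn N M); rewrite !ltr_norml; lra.
have [N NP] := tends_rdot (uT x) (tends_cst y) (divr_gt0 e0 (ltr0n R 2)).
have [M MP] := tends_rdot (tends_cst x) (uT y) (divr_gt0 e0 (ltr0n R 2)).
have := NP (maxn N M) (leq_maxl _ _); have := MP (maxn N M) (leq_maxr _ _).
by have /is_adjointP -> := us (maxn N M); rewrite !ltr_norml; lra.
Qed.

Lemma op_leP S T : selfadjoint S -> selfadjoint T ->
  op_le S T <-> forall x, rdot (S x) x <= rdot (T x) x.
Proof.
move=> /is_adjointP hS /is_adjointP hT; split=> h x.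
  have := h x; rewrite lecE => /andP[_].
  by rewrite -/(rdot _ _) rdotBl subr_ge0.
rewrite lecE -/(rdot _ _) rdotBl /= subr_ge0 h andbT.
have hc : hdot H (T x - S x) x = (hdot H (T x - S x) x)^*.
  have h2 u v : hdot H u v = (hdot H v u)^* by rewrite hermC expr0 mul1r.
  rewrite [LHS]h2; congr (_ ^*); symmetry.
  have : is_adjoint (T - S) (T - S).
    by apply: is_adjointB; apply/is_adjointP.
  by move=> /(_ x x).
have : complex.Im (hdot H (T x - S x) x) = - complex.Im (hdot H (T x - S x) x).
  by rewrite {1}hc; case: (hdot H (T x - S x) x).
by move=> e; apply/eqP; lra.
Qed.

End BoundedOps.

Section RealSequences.
Context {R : realType}.

Lemma expr_small (r e : R) : 0 <= r < 1 -> 0 < e ->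
  exists N, forall n, (N <= n)%N -> r ^+ n < e.
Proof.
move=> /andP[r0 r1] e0.
have /cvgrPdist_lt/(_ e e0)[N _ NP] : (fun n => r ^+ n) @ \oo --> (0 : R).
  by apply: cvg_expr; rewrite ger0_norm.
exists N => n Nn; have := NP n Nn.
by rewrite /= sub0r normrN ger0_norm// exprn_ge0.
Qed.

Lemma monotone_cauchy (u : nat -> R) (C : R) : {homo u : n m / (n <= m)%N >-> n <= m} ->
  (forall n, u n <= C) ->
  forall e, 0 < e -> exists N, forall n m, (N <= n <= m)%N -> u m - u n < e.
Proof.
move=> um uC e e0.
have hs : has_sup (range u) by split; [exists (u 0%N), 0%N|exists C => _ [n _ <-]].
have [_ [N _ <-] NP] := sup_adherent e0 hs.
exists N => n m /andP[Nn nm].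
have h1 : u m <= sup (range u) by apply: sup_upper_bound => //; exists m.
have h2 := um _ _ Nn; lra.
Qed.

Lemma le_eps (x y : R) : (forall e : R, 0 < e -> x <= y + e) -> x <= y.
Proof. by move=> h; apply/ler_addgt0Pr => e /h. Qed.

End RealSequences.

(** * Positive operators: monotone limits, resolvents and powers *)

Section PositiveOperators.
Context {R : realType} {H : hilbert R}.
Implicit Types (S T U : bop H) (x y z : H).

Lemma selfadjointE T x y : selfadjoint T -> rdot (T x) y = rdot x (T y).
Proof. by move=> /is_adjointP. Qed.

Lemma selfadjoint_sq T x : selfadjoint T -> rdot ((T ^+ 2) x) x = nrm (T x) ^+ 2.
Proof. by move=> hT; rewrite expr2 -rdotxx -(selfadjointE _ _ hT). Qed.

(** Positivity of [T] is tested at [x - T x / c], and the upper bound at [T x] absorbs the quadratic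
    term. In operator form: [T^2 <= c T]. *)
Lemma positive_sq_le T (c : R) : selfadjoint T -> 0 < c ->
  (forall x, 0 <= rdot (T x) x <= c * nrm x ^+ 2) ->
  forall x, nrm (T x) ^+ 2 <= c * rdot (T x) x.
Proof.
move=> hT c0 Tc x.
have /andP[+ _] := Tc (x - (c^-1)%:C%C *: T x).
have /andP[_ h2] := Tc (T x).
rewrite bopBr bopZr !rdotBl !rdotBr !rdotZl !rdotZr.
rewrite [rdot (T (T x)) x](selfadjointE _ _ hT) rdotxx.
have ci : 0 < c^-1 by rewrite invr_gt0.
have h3 : c^-1 * (c^-1 * rdot (T (T x)) (T x)) <= c^-1 * nrm (T x) ^+ 2.
  by rewrite ler_wpM2l ?(ltW ci)// mulrC ler_pdivrMr// mulrC.
move=> h1; have h4 : c^-1 * nrm (T x) ^+ 2 <= rdot (T x) x by lra.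
by move: h4; rewrite mulrC ler_pdivrMr// mulrC.
Qed.

(** A difference [u m - u n] with [n <= m] lies between 0 and 1, so [positive_sq_le] bounds the
    squared norm of [(u m - u n) x] by an increment of the bounded monotone sequence
    [rdot (u n x) x]. *)
Lemma monotone_strong_limit (u : nat -> bop H) :
  (forall n, selfadjoint (u n)) ->
  (forall n x, rdot (u n x) x <= rdot (u n.+1 x) x) ->
  (forall n x, 0 <= rdot (u n x) x <= nrm x ^+ 2) ->
  exists2 T : bop H, (forall x, tends (fun n => u n x) (T x)) &
   [/\ selfadjoint T, (forall x, nrm (T x) <= nrm x),
      (forall n x, rdot (u n x) x <= rdot (T x) x) &
      (forall x, rdot (T x) x <= nrm x ^+ 2)].
Proof.
move=> us um u1.
have mono x : {homo (fun n => rdot (u n x) x) : n m / (n <= m)%N >-> n <= m}.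
  by apply: (@homo_leq R (fun n => rdot (u n x) x) (fun a b : R => a <= b)) => [//|y z t|n];
    [exact: le_trans|exact: um].
have diff n m x : (n <= m)%N -> nrm (u m x - u n x) ^+ 2 <= rdot (u m x) x - rdot (u n x) x.
  move=> nm; have sd : selfadjoint (u m - u n) by exact: selfadjointB.
  have := @positive_sq_le (u m - u n) 1 sd ltr01 _ x.
  rewrite mul1r -rdotBl; apply=> y; rewrite mul1r rdotBl subr_ge0 (mono y)//=.
  by have /andP[h1 _] := u1 n y; have /andP[_ h2] := u1 m y; lra.
have bnd n x : nrm (u n x) <= 1 * nrm x.
  rewrite mul1r -(@ler_pXn2r _ 2)// ?nnegrE ?nrm_ge0//.
  have := @positive_sq_le (u n) 1 (us n) ltr01.
  move=> /(_ _ x) h; apply: le_trans (h _) _; first by move=> y; rewrite mul1r.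
  by rewrite mul1r; have /andP[] := u1 n x.
have [|T uT TC] := bop_lim ler01 bnd.
  move=> x; apply: complete_tends => e e0.
  have [|N NP] := monotone_cauchy (mono x) (fun n => (elimT andP (u1 n x)).2) (e := e ^+ 2).
    by rewrite exprn_gt0.
  have key n m : (N <= n)%N -> (n <= m)%N -> nrm (u n x - u m x) < e.
    move=> Nn nm; rewrite -(@ltr_pXn2r _ 2)// ?nnegrE ?nrm_ge0 ?(ltW e0)//.
    by rewrite nrmB; apply: le_lt_trans (diff _ _ _ nm) (NP _ _ _); rewrite Nn.
  exists N => n m Nn Nm; case: (leqP n m) => [|/ltnW] nm; first exact: key.
  by rewrite nrmB key.
exists T => //; split => //.
- exact: selfadjoint_lim uT.
- by move=> x; have := TC x; rewrite mul1r.
- move=> n x; apply: le_eps => e e0.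
  have [N NP] := tends_rdot (uT x) (tends_cst x) e0.
  have := NP (maxn N n) (leq_maxl _ _); have := mono x _ _ (leq_maxr N n).
  by rewrite ltr_norml; lra.
- move=> x; apply: (le_trans (rdot_le _ _)); rewrite expr2 ler_wpM2r ?nrm_ge0//.
  by have := TC x; rewrite mul1r.
Qed.

(* Neumann series for (1 + S)^-1 = (1 + c)^-1 (1 - (c - S) / (1 + c))^-1. *)
Lemma resolvent_limit S (c : R) : selfadjoint S -> 0 < c ->
  (forall x, 0 <= rdot (S x) x <= c * nrm x ^+ 2) ->
  let B := ((1 + c)^-1)%:C%C *: (c%:C%C *: (1 : bop H) - S) in
  let G := fix G n := if n is m.+1 then ((1 + c)^-1)%:C%C *: (1 : bop H) + B * G m else 0 in
  exists2 T : bop H, (forall x, tends (fun n => G n x) (T x)) &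
   [/\ selfadjoint T, (forall x, nrm (T x) <= nrm x) & forall x, T x + S (T x) = x].
Proof.
move=> hS c0 Sc B G.
have sD : selfadjoint (c%:C%C *: (1 : bop H) - S).
  by apply: selfadjointB => //; apply: selfadjointZ; exact: selfadjoint1.
have Dp y : 0 <= rdot ((c%:C%C *: (1 : bop H) - S) y) y <= c * nrm y ^+ 2.
  have -> : (c%:C%C *: (1 : bop H) - S) y = c%:C%C *: y - S y by [].
  rewrite rdotBl rdotZl rdotxx; have /andP[h1 h2] := Sc y; lra.
have r1 : 0 < (1 + c)^-1 by rewrite invr_gt0; lra.
(* Since [0 <= c - S <= c], the operator [c - S] has norm at most [c], and [B] contracts by the
   factor [r < 1]. *)
pose r := c / (1 + c).
have rP : 0 <= r < 1 by rewrite /r divr_ge0 ?ltr_pdivrMr; lra.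
have Bb y : nrm (B y) <= r * nrm y.
  have -> : B y = ((1 + c)^-1)%:C%C *: (c%:C%C *: (1 : bop H) - S) y by [].
  rewrite nrmZ gtr0_norm// /r [c / _]mulrC -mulrA ler_wpM2l ?(ltW r1)//.
  rewrite -(@ler_pXn2r _ 2)// ?nnegrE ?nrm_ge0//; last by rewrite mulr_ge0 ?nrm_ge0 ?(ltW c0).
  apply: (le_trans (positive_sq_le sD c0 Dp y)).
  by rewrite exprMn expr2 -mulrA ler_wpM2l ?(ltW c0)//; have /andP[] := Dp y.
have GS n y : G n.+1 y = ((1 + c)^-1)%:C%C *: y + B (G n y) by [].
have G1 n y : nrm (G n y) <= 1 * nrm y.
  rewrite mul1r; elim: n y => [|n IH] y; first by rewrite -[X in nrm X]/(0 : H) nrm0 nrm_ge0.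
  rewrite GS; apply: (le_trans (nrmD _ _)).
  rewrite nrmZ gtr0_norm//; apply: (@le_trans _ _ ((1 + c)^-1 * nrm y + r * nrm y)).
    by rewrite lerD2l (le_trans (Bb _))// ler_wpM2l//; have /andP[] := rP.
  rewrite -mulrDl (_ : _ + r = 1) ?mul1r// /r; field; lra.
have Gd n p y : nrm (G n y - G (n + p)%N y) <= r ^+ n * nrm y.
  elim: n => [|n IH].
    rewrite add0n expr0 -[G 0%N y]/(0 : H) sub0r nrmN; exact: G1.
  rewrite addSn !GS opprD addrACA subrr add0r -bopBr.
  apply: (le_trans (Bb _)); rewrite exprS -mulrA ler_wpM2l//; by have /andP[] := rP.
have [|T GT TC] := bop_lim ler01 G1.
  move=> x; apply: complete_tends => e e0.
  have e1 : 0 < e / (nrm x + 1) by rewrite divr_gt0// ltr_wpDl ?nrm_ge0.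
  have [N NP] := expr_small rP e1.
  have key n m : (N <= n)%N -> (n <= m)%N -> nrm (G n x - G m x) < e.
    move=> Nn nm; rewrite -(subnKC nm); apply: (le_lt_trans (Gd _ _ _)).
    apply: (@le_lt_trans _ _ (e / (nrm x + 1) * nrm x)).
      by rewrite ler_wpM2r ?nrm_ge0// ltW// NP.
    by rewrite mulrAC ltr_pdivrMr ?ltr_wpDl ?nrm_ge0// ltr_pM2l//; lra.
  exists N => n m Nn Nm; case: (leqP n m) => [|/ltnW] nm; first exact: key.
  by rewrite nrmB key.
have TE x : T x = ((1 + c)^-1)%:C%C *: x + B (T x).
  apply: (@tends_uniq _ _ (fun n => G n.+1 x)).
    by move=> e e0; have [N NP] := GT x e e0; exists N => n Nn; apply: NP; exact: leqW.
  by apply: tendsD; [exact: tends_cst|exact: tends_bop].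
have TI x : T x + S (T x) = x.
  have h1 : (1 + c)%:C%C *: T x = x + (c%:C%C *: T x - S (T x)).
    rewrite {1}TE scalerDr.
    have -> : B (T x) = ((1 + c)^-1)%:C%C *: (c%:C%C *: T x - S (T x)) by [].
    rewrite !scalerA -!rmorphM /= divff ?scale1r//; lra.
  apply: (addrI (c%:C%C *: T x)).
  have h2 : T x + c%:C%C *: T x = x + (c%:C%C *: T x - S (T x)).
    by rewrite -h1 rmorphD scalerDl scale1r.
  by rewrite addrA [c%:C%C *: T x + _]addrC h2 -addrA subrK addrC.
exists T => //; split => //; last by move=> x; have := TC x; rewrite mul1r.
apply/is_adjointP => x y.
rewrite -{2}[x]TI -{1}[y]TI rdotDl rdotDr; congr (_ + _).
by rewrite (selfadjointE _ _ hS).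
Qed.

(** Positivity of [1 + S] at [u - w], combined with [S <= T] at [u], reverses the order. Stating it
    for solutions [w] and [u] at one vector avoids naming inverse operators. *)
Lemma resolvent_antitone S T x u w :
  selfadjoint S -> (forall y, 0 <= rdot (S y) y) ->
  (forall y, rdot (S y) y <= rdot (T y) y) ->
  w + S w = x -> u + T u = x -> rdot u x <= rdot w x.
Proof.
move=> hS S0 ST wx ux.
have h0 : 0 <= rdot (u - w) (u - w) by rewrite rdotxx sqr_ge0.
have := S0 (u - w); rewrite bopBr !rdotBl !rdotBr.
move: h0; rewrite !rdotBl !rdotBr.
have e1 : rdot u x = rdot u u + rdot (T u) u by rewrite -{1}ux rdotDr (rdotC u (T u)).
have e2 : rdot w x = rdot w w + rdot (S w) w by rewrite -{1}wx rdotDr (rdotC w (S w)).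
have e3 : rdot u x = rdot u w + rdot (S u) w.
  by rewrite -{1}wx rdotDr (selfadjointE _ _ hS).
have e4 : rdot (S w) u = rdot (S u) w by rewrite (selfadjointE _ _ hS) rdotC.
have e5 := ST u; rewrite e4 (rdotC w u).
lra.
Qed.

(** By Cauchy-Schwarz the norms [a k] of [T^k y] are log-convex, so the first ratio [a 1 / a 0] is
    at most each later one. This lets a bound on a high power control [T] itself. *)
Lemma power_log_convex T y m : selfadjoint T ->
  nrm (T y) ^+ m.+1 <= nrm ((T ^+ m.+1) y) * nrm y ^+ m.
Proof.
move=> hT; pose a k := nrm ((T ^+ k) y).
have a0 k : 0 <= a k by exact: nrm_ge0.
have sq k : a k.+1 ^+ 2 <= a k * a k.+2.
  rewrite /a -rdotxx {1}exprS -[(T * _) y]/(T ((T ^+ k) y)) (selfadjointE _ _ hT).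
  have -> : T ((T ^+ k.+1) y) = (T ^+ k.+2) y by rewrite [in RHS]exprS.
  exact: rdot_le.
have ratio k : a 1%N * a k <= a 0%N * a k.+1.
  elim: k => [|k IH]; first by rewrite mulrC.
  have [ak0|akn0] := eqVneq (a k) 0.
    have h : a k.+1 ^+ 2 <= 0 by rewrite (le_trans (sq k))// ak0 mul0r.
    have -> : a k.+1 = 0 by apply/eqP; rewrite -sqrf_eq0 eq_le h sqr_ge0.
    by rewrite mulr0 mulr_ge0.
  have akp : 0 < a k by rewrite lt_neqAle eq_sym akn0 a0.
  rewrite -(ler_pM2l akp) (le_trans (y := a 0%N * a k.+1 ^+ 2))//.
    by rewrite expr2 mulrA mulrA ler_wpM2r// mulrC.
  by rewrite [leRHS]mulrCA ler_wpM2l.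
rewrite -[T y]/((T ^+ 1) y) -[nrm y]/(a 0%N) -/(a 1%N) -/(a m.+1).
elim: m => [|m IH]; first by rewrite !expr1 expr0 mulr1.
rewrite exprS; apply: (@le_trans _ _ (a 1%N * (a m.+1 * a 0%N ^+ m))).
  by rewrite ler_wpM2l.
by rewrite [in leRHS]exprS [leRHS]mulrA mulrA ler_wpM2r ?exprn_ge0// [leRHS]mulrC ratio.
Qed.

End PositiveOperators.

(** * Tracial von Neumann algebras *)

Section TracialSpace.
Context {R : realType} (A : tracial_space R).
Local Notation M := (@ts_alg R A).
Local Notation H := (ts_hilbert A).
Implicit Types (S T U : ts_op A).

Lemma algP T : M T <-> commutant (commutant M) T.
Proof. by have [_ ->] := ts_vN A. Qed.

Lemma alg1 : M 1.
Proof. by apply/algP => S _; rewrite mulr1 mul1r. Qed.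

Lemma algD S T : M S -> M T -> M (S + T).
Proof.
move=> /algP hS /algP hT; apply/algP => U hU.
by rewrite mulrDr mulrDl hS ?hT.
Qed.

Lemma algZ (a : R[i]) S : M S -> M (a *: S).
Proof.
move=> /algP hS; apply/algP => U hU.
by rewrite bop_scaleAl bop_scaleAr hS.
Qed.

Lemma alg0 : M 0.
Proof. by apply/algP => U hU; rewrite mulr0 mul0r. Qed.

Lemma algN S : M S -> M (- S).
Proof. by rewrite -scaleN1r; exact: algZ. Qed.

Lemma algB S T : M S -> M T -> M (S - T).
Proof. by move=> hS hT; apply: algD => //; apply: algN. Qed.

Lemma algM S T : M S -> M T -> M (S * T).
Proof.
move=> /algP hS /algP hT; apply/algP => U hU.
by rewrite mulrA hS // -mulrA hT // mulrA.
Qed.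

Lemma algX S n : M S -> M (S ^+ n).
Proof. by move=> hS; elim: n => [|n IH]; [exact: alg1|rewrite exprS; exact: algM]. Qed.

Lemma alg_sum I (r : seq I) (P : pred I) (F : I -> ts_op A) :
  (forall i, P i -> M (F i)) -> M (\sum_(i <- r | P i) F i).
Proof. by move=> h; apply: big_ind => //; [exact: alg0|exact: algD]. Qed.

Lemma alg_prod I (r : seq I) (P : pred I) (F : I -> ts_op A) :
  (forall i, P i -> M (F i)) -> M (\prod_(i <- r | P i) F i).
Proof. by move=> h; apply: big_ind => //; [exact: alg1|exact: algM]. Qed.

(** Commuting with a fixed bounded operator survives strong limits, and the algebra equals its
    bicommutant. *)
Lemma alg_lim (u : nat -> ts_op A) T : (forall n, M (u n)) ->
  (forall x, tends (fun n => u n x) (T x)) -> M T.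
Proof.
move=> uM uT; apply/algP => S hS; apply: bop_ext => x.
apply: (tends_uniq (u := fun n => u n (S x))); last exact: uT.
rewrite (_ : (fun n => _) = (fun n => S (u n x))); first by apply: tends_bop; exact: uT.
apply: funext => n; have /algP/(_ S hS) := uM n.
by move=> /(congr1 (fun T : ts_op A => T x)).
Qed.

Local Notation phi := (@ts_trace R A).
Definition tr T : R := complex.Re (phi T).

Lemma phi_linear (a : R[i]) S T : M S -> M T -> phi (a *: S + T) = a * phi S + phi T.
Proof. by have [+ _ _ _ _] := ts_state A; apply. Qed.

Lemma phi1 : phi 1 = 1.
Proof. by have [_ [-> _] _ _ _] := ts_state A. Qed.

Lemma phi0 : phi 0 = 0.
Proof.
have := phi_linear 1 alg0 alg0; rewrite scale1r mul1r addr0 => h.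
by apply: (addrI (phi 0)); rewrite -h addr0.
Qed.

Lemma phiD S T : M S -> M T -> phi (S + T) = phi S + phi T.
Proof. by move=> hS hT; rewrite -[S]scale1r phi_linear // mul1r scale1r. Qed.

Lemma phiZ (a : R[i]) S : M S -> phi (a *: S) = a * phi S.
Proof. by move=> hS; rewrite -[a *: S]addr0 phi_linear ?phi0 ?addr0 //; exact: alg0. Qed.

Lemma phiN S : M S -> phi (- S) = - phi S.
Proof. by move=> hS; rewrite -scaleN1r phiZ // mulN1r. Qed.

Lemma phiB S T : M S -> M T -> phi (S - T) = phi S - phi T.
Proof. by move=> hS hT; rewrite phiD ?phiN //; exact: algN. Qed.

Lemma phi_sum I (r : seq I) (P : pred I) (F : I -> ts_op A) :
  (forall i, P i -> M (F i)) ->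
  phi (\sum_(i <- r | P i) F i) = \sum_(i <- r | P i) phi (F i).
Proof.
move=> h; suff [] : M (\sum_(i <- r | P i) F i) /\
  phi (\sum_(i <- r | P i) F i) = \sum_(i <- r | P i) phi (F i) by [].
elim/big_rec2: _ => [|i x y Pi [yM yE]]; first by split; [exact: alg0|exact: phi0].
by split; [apply: algD => //; exact: h|rewrite phiD ?yE //; exact: h].
Qed.

Lemma phi_pos S T : M T -> is_adjoint T S -> 0 <= phi (S * T).
Proof. by have [_ [_ +] _ _ _] := ts_state A; apply. Qed.

Lemma phi_faithful T : M T -> selfadjoint T -> phi (T * T) = 0 -> T = 0.
Proof. by have [_ _ + _ _] := ts_state A => h hT sT; apply: h. Qed.

Lemma phi_trace S T : M S -> M T -> phi (S * T) = phi (T * S).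
Proof. by have [_ _ _ + _] := ts_state A; apply. Qed.

Lemma op_le_refl S : op_le S S.
Proof. by move=> x; rewrite subrr linear0l. Qed.

(* Normality applied to the directed pair {S, T}. *)
Lemma phi_le S T : M S -> M T -> selfadjoint S -> selfadjoint T ->
  (forall x, rdot (S x) x <= rdot (T x) x) -> phi S <= phi T.
Proof.
move=> hS hT sS sT /(op_leP sS sT) ST.
have [_ _ _ _ norm] := ts_state A.
have [] := norm [set U | U = S \/ U = T] T.
- by move=> U [->|->].
- by move=> U [->|->].
- split; first by exists S; left.
  by move=> U V [->|->] [->|->]; exists T; split => //; try (by right); exact: op_le_refl.
- split => //; first by move=> U [->|->] //; exact: op_le_refl.
  by move=> U _ _; apply; right.
- by move=> ub _; apply: ub; exists S => //; left.
Qed.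

(** The order on complex numbers relates only numbers with equal imaginary parts, so comparing [S]
    with a real scalar operator already forces [phi S] to be real. *)
Lemma phi_real S : M S -> selfadjoint S -> phi S = (tr S)%:C%C.
Proof.
move=> hS sS; have [C C0 SC] := bop_bound S.
have sC : selfadjoint (C%:C%C *: (1 : ts_op A)) by apply: selfadjointZ; exact: selfadjoint1.
have MC : M (C%:C%C *: (1 : ts_op A)) by apply: algZ; exact: alg1.
have : phi S <= phi (C%:C%C *: (1 : ts_op A)).
  apply: phi_le => // x; rewrite rdotZl rdotxx.
  by apply: (le_trans (rdot_le _ _)); rewrite expr2 mulrA ler_wpM2r ?nrm_ge0 // SC.
rewrite phiZ ?phi1 ?mulr1; last exact: alg1.
rewrite lecE => /andP[/eqP h _]; rewrite /tr.
by move: h => /=; case: (phi S) => a b /= <-.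
Qed.

Lemma tr_le S T : M S -> M T -> selfadjoint S -> selfadjoint T ->
  (forall x, rdot (S x) x <= rdot (T x) x) -> tr S <= tr T.
Proof.
move=> hS hT sS sT h; rewrite -lecR -!phi_real //; exact: phi_le.
Qed.

Lemma trD S T : M S -> M T -> tr (S + T) = tr S + tr T.
Proof. by move=> hS hT; rewrite /tr phiD // ReD. Qed.

Lemma trN S : M S -> tr (- S) = - tr S.
Proof. by move=> hS; rewrite /tr phiN // ReN. Qed.

Lemma trB S T : M S -> M T -> tr (S - T) = tr S - tr T.
Proof. by move=> hS hT; rewrite /tr phiB // ReD ReN. Qed.

Lemma trZ (a : R) S : M S -> tr (a%:C%C *: S) = a * tr S.
Proof. by move=> hS; rewrite /tr phiZ // ReZ. Qed.

Lemma tr0 : tr 0 = 0.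
Proof. by rewrite /tr phi0. Qed.

Lemma tr1 : tr 1 = 1.
Proof. by rewrite /tr phi1. Qed.

Lemma tr_sq_ge0 S : M S -> selfadjoint S -> 0 <= tr (S ^+ 2).
Proof.
move=> hS sS; rewrite -lecR -phi_real; last exact: selfadjointX.
  by rewrite expr2; exact: phi_pos.
exact: algX.
Qed.

(** The range of an increasing sequence is directed and its strong limit is its least upper bound,
    so normality makes [phi T] the supremum of the [phi (u n)]. *)
Lemma tr_sup (u : nat -> ts_op A) T (C : R) : (forall n, M (u n)) -> M T ->
  (forall n, selfadjoint (u n)) -> selfadjoint T ->
  (forall n x, rdot (u n x) x <= rdot (u n.+1 x) x) ->
  (forall x, tends (fun n => u n x) (T x)) ->
  (forall n x, rdot (u n x) x <= rdot (T x) x) ->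
  (forall n, tr (u n) <= C) -> tr T <= C.
Proof.
move=> uM hT us sT um uT uleT uC.
have [_ _ _ _ norm] := ts_state A.
have mono x : {homo (fun n => rdot (u n x) x) : n m / (n <= m)%N >-> n <= m}.
  by apply: (@homo_leq R (fun n => rdot (u n x) x) (fun a b : R => a <= b)) => [//|y z t|n];
    [exact: le_trans|exact: um].
rewrite -lecR -phi_real //.
have [] := norm (range u) T.
- by move=> _ [n _ <-].
- by move=> _ [n _ <-].
- split; first by exists (u 0%N), 0%N.
  move=> _ _ [n _ <-] [m _ <-]; exists (u (maxn n m)); split; first by exists (maxn n m).
    by apply/op_leP => // x; apply: mono; exact: leq_maxl.
  by apply/op_leP => // x; apply: mono; exact: leq_maxr.
- split => //; first by move=> _ [n _ <-]; apply/op_leP.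
  move=> U hU sU h; apply/op_leP => // x; apply: le_eps => e e0.
  have [N NP] := tends_rdot (uT x) (tends_cst x) e0.
  have := NP N (leqnn _); rewrite ltr_norml.
  have /op_leP := h (u N) (ex_intro2 _ _ N I erefl).
  by move=> /(_ (us N) sU)/(_ x); lra.
- move=> _; apply => _ [_ [n _ <-] <-].
  by rewrite phi_real // lecR.
Qed.

Lemma alg_resolvent S : M S -> selfadjoint S -> (forall x, 0 <= rdot (S x) x) ->
  exists2 T : ts_op A, M T & [/\ selfadjoint T, (forall x, nrm (T x) <= nrm x) &
     forall x, T x + S (T x) = x].
Proof.
move=> hS sS S0; have [C C0 SC] := bop_bound S.
have C1 : 0 < C + 1 by lra.
have [|T GT TP] := resolvent_limit sS C1.
  move=> x; rewrite S0 /=; apply: (le_trans (rdot_le _ _)).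
  rewrite expr2 mulrA ler_wpM2r ?nrm_ge0 //; apply: (le_trans (SC x)).
  by rewrite ler_wpM2r ?nrm_ge0 // lerDl ler01.
exists T => //; apply: alg_lim GT; elim=> [|n IH]; first exact: alg0.
apply: algD; first by apply: algZ; exact: alg1.
apply: algM => //; apply: algZ; apply: algB => //.
by apply: algZ; exact: alg1.
Qed.

(* Any operator f(S_(m,n)) = S (1 + S)^-1 is a contraction, so the increasing
   suprema R_m = sup_n f(S_(m,n)) exist even when S_(m,n) is unbounded in n;
   faithfulness forces their decreasing limit to vanish. *)
Lemma tail_dominator (S : nat -> nat -> ts_op A) (eps : nat -> R) :
  (forall m n, M (S m n)) -> (forall m n, selfadjoint (S m n)) ->
  (forall m n x, 0 <= rdot (S m n x) x) ->
  (forall m n x, rdot (S m n x) x <= rdot (S m n.+1 x) x) ->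
  (forall m n x, rdot (S m.+1 n x) x <= rdot (S m n x) x) ->
  (forall m n, tr (S m n) <= eps m) ->
  (forall e : R, 0 < e -> exists m, eps m < e) ->
  exists Q : nat -> ts_op A,
    [/\ (forall m, M (Q m) /\ selfadjoint (Q m)), (forall m, tr (Q m) <= eps m),
     (forall x (e : R), 0 < e -> exists N, forall m, (N <= m)%N -> rdot (Q m x) x < e) &
     (forall m n w x, w + S m n w = x -> rdot (x - w) x <= rdot (Q m x) x)].
Proof.
move=> SM Ss S0 Sn Sm Seps eps0.
have /choice[G GP] : forall p : nat * nat, exists T : ts_op A, [/\ M T, selfadjoint T,
    (forall x, nrm (T x) <= nrm x) & forall x, T x + S p.1 p.2 (T x) = x].
  by move=> p; have [T h1 [h2 h3 h4]] := alg_resolvent (SM p.1 p.2) (Ss _ _) (S0 _ _); exists T.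
pose F m n := 1 - G (m, n).
have FM m n : M (F m n) by apply: algB; [exact: alg1|have [] := GP (m, n)].
have Fs m n : selfadjoint (F m n).
  by apply: selfadjointB; [exact: selfadjoint1|have [] := GP (m, n)].
have FE m n x : F m n x = x - G (m, n) x by [].
have GE m n x : G (m, n) x + S m n (G (m, n) x) = x by have [] := GP (m, n).
have F01 m n x : 0 <= rdot (F m n x) x <= nrm x ^+ 2.
  rewrite FE rdotBl rdotxx; set w := G (m, n) x.
  have h := GE m n x; rewrite -/w in h.
  have h1 : rdot w x = nrm w ^+ 2 + rdot (S m n w) w.
    by rewrite -h rdotDr rdotxx [rdot w (S _ _ w)]rdotC.
  have h2 : nrm x ^+ 2 = rdot w x + rdot (S m n w) w + nrm (S m n w) ^+ 2.
    by rewrite -[in LHS]h -rdotxx !rdotDl !rdotDr h1 !rdotxx [rdot w (S _ _ w)]rdotC; ring.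
  have := S0 m n w; have := sqr_ge0 (nrm w); have := sqr_ge0 (nrm (S m n w)).
  by rewrite h2 h1; lra.
have Fn m n x : rdot (F m n x) x <= rdot (F m n.+1 x) x.
  rewrite !FE !rdotBl lerD2l lerN2.
  exact: (resolvent_antitone (Ss m n) (S0 m n) (Sn m n) (GE m n x) (GE m n.+1 x)).
have Fm m n x : rdot (F m.+1 n x) x <= rdot (F m n x) x.
  rewrite !FE !rdotBl lerD2l lerN2.
  exact: (resolvent_antitone (Ss m.+1 n) (S0 m.+1 n) (Sm m n) (GE m.+1 n x) (GE m n x)).
have FS m n x : rdot (F m n x) x <= rdot (S m n x) x.
  rewrite FE rdotBl; set w := G (m, n) x.
  have h := GE m n x; rewrite -/w in h.
  have e1 : rdot (S m n x) x = rdot (S m n w) w + 2 * nrm (S m n w) ^+ 2 +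
      rdot (S m n (S m n w)) (S m n w).
    rewrite -[in LHS]h bopDr !rdotDl !rdotDr rdotxx.
    by rewrite [rdot (S m n (S m n w)) w](selfadjointE _ _ (Ss m n)) rdotxx; ring.
  have e2 : rdot x x - rdot w x = rdot (S m n w) w + nrm (S m n w) ^+ 2.
    by rewrite -[in LHS]h !rdotDl !rdotDr !rdotxx; ring.
  rewrite e1 e2; have := S0 m n (S m n w); have := sqr_ge0 (nrm (S m n w)); lra.
have /choice[Q QP] : forall m, exists T : ts_op A,
    (forall x, tends (fun n => F m n x) (T x)) /\
    [/\ selfadjoint T, (forall x, nrm (T x) <= nrm x),
      (forall n x, rdot (F m n x) x <= rdot (T x) x) &
      (forall x, rdot (T x) x <= nrm x ^+ 2)].
  by move=> m; have [T h1 h2] := monotone_strong_limit (Fs m) (Fn m) (F01 m); exists T.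
have QM m : M (Q m) by have [h _] := QP m; exact: alg_lim h.
have Qs m : selfadjoint (Q m) by have [_ []] := QP m.
have QF m n x : rdot (F m n x) x <= rdot (Q m x) x by have [_ []] := QP m.
have Qeps m : tr (Q m) <= eps m.
  apply: (tr_sup (FM m)) => //; [by have [] := QP m|].
  by move=> n; apply: le_trans (Seps m n); exact: tr_le.
have Qdec m x : rdot (Q m.+1 x) x <= rdot (Q m x) x.
  apply: le_eps => e e0; have [h _] := QP m.+1.
  have [N NP] := tends_rdot (h x) (tends_cst x) e0.
  have := NP N (leqnn _); rewrite ltr_norml.
  by have := Fm m N x; have := QF m N x; lra.
have Q0 m x : 0 <= rdot (Q m x) x.
  by apply: le_trans (QF m 0%N x); have /andP[] := F01 m 0%N x.
have Q1 m x : rdot (Q m x) x <= nrm x ^+ 2 by have [_ []] := QP m.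
have QE m x : (1 - Q m) x = x - Q m x by [].
have [|||P PT [Ps _ P1 P2]] := @monotone_strong_limit _ _ (fun m => 1 - Q m).
- by move=> m; apply: selfadjointB; [exact: selfadjoint1|].
- by move=> m x; rewrite !QE !rdotBl lerD2l lerN2.
- move=> m x; rewrite QE rdotBl rdotxx.
  by have := Q0 m x; have := Q1 m x; lra.
have PM : M P by apply: alg_lim PT => m; apply: algB => //; exact: alg1.
pose W := 1 - P.
have WM : M W by apply: algB => //; exact: alg1.
have Ws : selfadjoint W by apply: selfadjointB => //; exact: selfadjoint1.
have WE x : W x = x - P x by [].
have WQ m x : rdot (W x) x <= rdot (Q m x) x.
  have := P1 m x; rewrite QE WE !rdotBl; lra.
have W0 x : 0 <= rdot (W x) x by rewrite WE rdotBl subr_ge0 rdotxx.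
have trW : tr W <= 0.
  apply: le_eps => e e0; have [m me] := eps0 e e0.
  rewrite add0r; apply: le_trans (ltW me); apply: le_trans (Qeps m).
  exact: tr_le.
(* [W] is the limit of the [Q m]. From [0 <= W <= 1] follows [W^2 <= W], so [W^2] has trace at most
   [tr W <= 0], and faithfulness applies. *)
have W00 : W = 0.
  apply: phi_faithful => //; rewrite -expr2 phi_real; [|exact: algX|exact: selfadjointX].
  suff -> : tr (W ^+ 2) = 0 by [].
  apply/eqP; rewrite eq_le tr_sq_ge0 // andbT; apply: le_trans trW.
  apply: tr_le => //; [exact: algX|exact: selfadjointX|].
  move=> x; rewrite selfadjoint_sq //.
  rewrite -[leRHS]mul1r; apply: (positive_sq_le Ws ltr01) => y.
  rewrite W0 mul1r /=; exact: le_trans (WQ 0%N y) (Q1 0%N y).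
exists Q; split => //.
- move=> x e e0; have [N NP] := tends_rdot (PT x) (tends_cst x) e0.
  exists N => m Nm; have := NP m Nm; rewrite QE rdotBl.
  have : W x = 0 by rewrite W00.
  rewrite WE => /eqP; rewrite subr_eq0 => /eqP <-.
  by rewrite ltr_norml; lra.
(* [1 + S m n] is injective because [S m n] is positive, so every solution [w] is the resolvent
   value. *)
- move=> m n w x h; suff -> : w = G (m, n) x by exact: QF.
  pose d := w - G (m, n) x.
  have dE : d + S m n d = 0.
    by rewrite bopBr addrACA -opprD h GE subrr.
  apply/eqP; rewrite -subr_eq0; apply/eqP; apply: nrm_eq0; apply/eqP.
  rewrite -sqrf_eq0 eq_le sqr_ge0 andbT -rdotxx -/d.
  have : rdot (d + S m n d) d = 0 by rewrite dE /rdot linear0l.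
  by rewrite rdotDl; have := S0 m n d; lra.
Qed.

End TracialSpace.

(** * Operator norms and strong limits from the trace *)

Section NormFromMoments.
Context {R : realType} (A : tracial_space R).
Local Notation M := (@ts_alg R A).
Local Notation H := (ts_hilbert A).
Implicit Types (S T U : ts_op A).

(** This is [a g(m) + a^2 g(m+1) + ...] with [d] terms. The case [a = 1] is a plain tail sum; the
    weights [2^j] of [a = 2] arise from iterating [|y + z|^2 <= 2 |y|^2 + 2 |z|^2]. *)
Fixpoint weighted_sum (a : R) (g : nat -> ts_op A) d m : ts_op A :=
  if d is d'.+1 then a%:C%C *: (g m + weighted_sum a g d' m.+1) else 0.

(** Here [x - w] is [D^2 (1 + D^2)^-1 x]. Since [D^2 <= k], one has
    [D^2 <= (1 + k) D^2 (1 + D^2)^-1]: for bounded [D] a bound on the contraction gives one on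
    [D^2]. *)
Lemma resolvent_sq_bound (D : ts_op A) (k : R) (w x : H) : selfadjoint D ->
  (forall y, nrm (D y) ^+ 2 <= k * nrm y ^+ 2) -> w + (D ^+ 2) w = x ->
  nrm (D x) ^+ 2 <= (1 + k) * rdot (x - w) x.
Proof.
move=> sD Dk h; pose v := D (D w).
have vE : (D ^+ 2) w = v by rewrite expr2.
rewrite vE in h; have xw : x - w = v by rewrite -h addrC addKr.
rewrite xw -h bopDr !rdotDr -rdotxx rdotDl !rdotDr.
have a1 : rdot v w = nrm (D w) ^+ 2 by rewrite (selfadjointE _ _ sD) rdotxx.
have a2 : rdot (D v) (D w) = nrm v ^+ 2 by rewrite (selfadjointE _ _ sD) rdotxx.
rewrite a1 [rdot (D w) (D v)]rdotC a2 !rdotxx.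
have := Dk v; have := Dk (D w); rewrite -/v.
lra.
Qed.

Lemma rdot_weighted_sum (a : R) g d m (x y : H) : rdot (weighted_sum a g d.+1 m x) y =
  a * (rdot (g m x) y + rdot (weighted_sum a g d m.+1 x) y).
Proof. by rewrite rdotZl rdotDl. Qed.

(** The condition linking [eps m] to [eps m.+1] mirrors the recursion for the traces of the weighted
    sums, which therefore stay below [eps m] whatever their length. Then [tail_dominator]
    applies. *)
Lemma weighted_dominator (a : R) (g : nat -> ts_op A) (eps : nat -> R) :
  1 <= a -> (forall l, M (g l)) -> (forall l, selfadjoint (g l)) ->
  (forall l x, 0 <= rdot (g l x) x) ->
  (forall m, 0 <= eps m) -> (forall m, a * (tr (g m) + eps m.+1) <= eps m) ->
  (forall e : R, 0 < e -> exists m, eps m < e) ->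
  exists Q : nat -> ts_op A,
    [/\ (forall m, M (Q m) /\ selfadjoint (Q m)), (forall m, tr (Q m) <= eps m),
     (forall x (e : R), 0 < e -> exists N, forall m, (N <= m)%N -> rdot (Q m x) x < e) &
     (forall m d w x, w + weighted_sum a g d m w = x -> rdot (x - w) x <= rdot (Q m x) x)].
Proof.
move=> a1 gM gs g0 e0 erec eps0.
have wM d m : M (weighted_sum a g d m).
  elim: d m => [|d IH] m /=; first exact: alg0.
  by apply: algZ; apply: algD.
have ws d m : selfadjoint (weighted_sum a g d m).
  elim: d m => [|d IH] m /=; first exact: selfadjoint0.
  by apply: selfadjointZ; apply: selfadjointD.
have w0 d m x : 0 <= rdot (weighted_sum a g d m x) x.
  elim: d m => [|d IH] m; first by rewrite /= /rdot linear0l.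
  by rewrite rdot_weighted_sum mulr_ge0 ?addr_ge0 ?(le_trans ler01 a1).
have wd d m x : rdot (weighted_sum a g d m x) x <= rdot (weighted_sum a g d.+1 m x) x.
  elim: d m => [|d IH] m; first by rewrite {1}/weighted_sum {1}/rdot linear0l w0.
  by rewrite [leLHS]rdot_weighted_sum [leRHS]rdot_weighted_sum ler_wpM2l ?lerD2l ?(le_trans ler01 a1).
have wt d m : tr (weighted_sum a g d m) <= eps m.
  elim: d m => [|d IH] m; first by rewrite /= tr0.
  rewrite /= trZ ?trD //; last exact: algD.
  by apply: le_trans (erec m); rewrite ler_wpM2l ?lerD2l ?(le_trans ler01 a1).
have [|||||||Q [Q1 Q2 Q3 Q4]] := @tail_dominator _ A
  (fun m n => weighted_sum a g (n - m) m) eps => //.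
- move=> m n x; case: (leqP m n) => mn; first by rewrite subSn // wd.
  have -> : (n - m = 0)%N by apply/eqP; rewrite subn_eq0 ltnW.
  by have -> : (n.+1 - m = 0)%N by apply/eqP; rewrite subn_eq0.
- move=> m n x; rewrite subnS; case: (n - m)%N => [|d] /=.
    by rewrite {1}/rdot linear0l /rdot linear0l.
  rewrite rdot_weighted_sum; have := g0 m x; have := w0 d m.+1 x.
  set p := rdot _ _; set q := rdot _ _; nra.
exists Q; split => // m d w x h.
apply: (Q4 m (m + d)%N); by rewrite addKn.
Qed.

(** For the rescaled [X] the traces of powers decay geometrically, so the part of its spectrum above
    1 is invisible to the trace and must vanish. The vectors [w m = (1 + X^(2m))^-1 x] cut that part
    off: summable traces give [w m -> x], while [X^m (w m)] stays below [x] in norm, and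
    log-convexity brings this bound down to [X]. *)
Lemma opnorm_from_moments T S (B : R) : M T -> M S -> is_adjoint T S -> 0 <= B ->
  (forall p, tr ((S * T) ^+ p) <= (B ^+ 2) ^+ p) -> opnorm T <= B.
Proof.
move=> MT MS TS B0 mom; apply: opnorm_le => // x.
apply: le_eps => e e0.
have [x0|xn0] := eqVneq (nrm x) 0.
  by rewrite (nrm_eq0 x0) bop0r nrm0 mulr0 add0r ltW.
have xp : 0 < nrm x by rewrite lt_neqAle eq_sym xn0 nrm_ge0.
(* Any [B' > B] makes the normalised moments geometric; this excess makes the bound at [x] off by
   exactly [e]. *)
pose B' := B + e / nrm x.
have B'B : B < B' by rewrite ltrDl divr_gt0.
have B'0 : 0 < B' by exact: le_lt_trans B'B.
rewrite (_ : B * nrm x + e = B' * nrm x); last first.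
  by rewrite /B' mulrDl divfK.
pose X := ((B' ^- 2)%:C%C *: (S * T)) : ts_op A.
have B2 : 0 < B' ^- 2 by rewrite invr_gt0 exprn_gt0.
have Xs : selfadjoint X.
  by apply: selfadjointZ; apply: is_adjointM => //; exact: is_adjointC.
have XM : M X by apply: algZ; exact: algM.
have XE n : X ^+ n = ((B' ^- 2) ^+ n)%:C%C *: (S * T) ^+ n.
  rewrite /X; set k := B' ^- 2.
  elim: n => [|n IH]; first by rewrite !expr0 scale1r.
  by rewrite !exprS {}IH bop_scaleAl bop_scaleAr scalerA -rmorphM.
pose q := (B / B') ^+ 2.
have q0 : 0 <= q by rewrite sqr_ge0.
have q1 : q < 1 by rewrite /q expr_lt1 // ?divr_ge0 ?(ltW B'0) // ltr_pdivrMr // mul1r.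
pose s := q ^+ 2.
have s0 : 0 <= s by rewrite sqr_ge0.
have s1 : s < 1 by rewrite /s expr_lt1.
have s2 : 0 < 1 - s by rewrite subr_gt0.
have trX n : tr (X ^+ n) <= q ^+ n.
  rewrite XE trZ; last by apply: algX; exact: algM.
  have -> : q ^+ n = (B' ^- 2) ^+ n * (B ^+ 2) ^+ n.
    by rewrite -exprMn; congr (_ ^+ _); rewrite /q exprMn exprVn mulrC.
  by rewrite ler_wpM2l ?mom // exprn_ge0 // ltW.
have [|||||||Q [_ _ Q3 Q4]] := @weighted_dominator 1 (fun l => X ^+ (2 * l))
   (fun m => s ^+ m / (1 - s)).
- exact: lexx.
- by move=> l; exact: algX.
- by move=> l; exact: selfadjointX.
- move=> l y; rewrite mulnC exprM selfadjoint_sq ?sqr_ge0 //; exact: selfadjointX.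
- by move=> m /=; apply: divr_ge0; [exact: exprn_ge0|exact: ltW].
- move=> m; rewrite mul1r; apply: (@le_trans _ _ (s ^+ m + s ^+ m.+1 / (1 - s))).
    by rewrite lerD2r /s -exprM trX.
  by rewrite le_eqVlt exprS; apply/orP; left; apply/eqP; field; rewrite gt_eqF.
- move=> d d0; have [||N NP] := @expr_small _ s (d * (1 - s)).
  + by rewrite s0.
  + by rewrite mulr_gt0.
  by exists N; rewrite ltr_pdivrMr ?NP.
have /choice[w wP] : forall m, exists w, w + (X ^+ (2 * m)) w = x.
  move=> m; have [|||T' _ [_ _ h]] := @alg_resolvent _ A (X ^+ (2 * m)).
  - exact: algX.
  - exact: selfadjointX.
  - by move=> y; rewrite mulnC exprM selfadjoint_sq ?sqr_ge0 //; exact: selfadjointX.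
  - by exists (T' x).
have X2 m : rdot ((X ^+ (2 * m)) (w m)) (w m) = nrm ((X ^+ m) (w m)) ^+ 2.
  by rewrite mulnC exprM selfadjoint_sq //; exact: selfadjointX.
have h1 m : rdot (w m) x = nrm (w m) ^+ 2 + nrm ((X ^+ m) (w m)) ^+ 2.
  by rewrite -[in LHS](wP m) rdotDr rdotxx -X2 [rdot (w m) ((X ^+ _) _)]rdotC.
have wx m : nrm (w m) <= nrm x.
  have [w0|wn0] := eqVneq (nrm (w m)) 0; first by rewrite w0 nrm_ge0.
  have wp : 0 < nrm (w m) by rewrite lt_neqAle eq_sym wn0 nrm_ge0.
  rewrite -(ler_pM2l wp) (le_trans _ (rdot_le _ _)) // h1 expr2 lerDl sqr_ge0 //.
have Xwx m : nrm ((X ^+ m) (w m)) <= nrm x.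
  rewrite -(@ler_pXn2r _ 2) // ?nnegrE ?nrm_ge0 //.
  apply: (@le_trans _ _ (rdot (w m) x)); first by rewrite h1 lerDr sqr_ge0.
  by apply: (le_trans (rdot_le _ _)); rewrite expr2 ler_wpM2r ?nrm_ge0.
have tw : tends w x.
  move=> d d0; have d2 : 0 < d ^+ 2 by rewrite exprn_gt0.
  have [N NP] := Q3 x _ d2; exists N => m Nm.
  rewrite -(@ltr_pXn2r _ 2) // ?nnegrE ?nrm_ge0 ?(ltW d0) //.
  apply: le_lt_trans (NP m Nm); rewrite nrmB.
  apply: le_trans (Q4 m 1%N (w m) x _); last first.
    rewrite /= scale1r addr0; exact: wP.
  have e1 : rdot (x - w m) (x - w m) + rdot (x - w m) (w m) = rdot (x - w m) x.
    by rewrite -rdotDr subrK.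
  rewrite -rdotxx -e1 lerDl.
  rewrite (_ : x - w m = (X ^+ (2 * m)) (w m)); last by rewrite -[in LHS](wP m) addrC addKr.
  by rewrite X2 sqr_ge0.
have Xx : nrm (X x) <= nrm x.
  apply: (@tends_le _ _ (fun n => X (w n.+1))).
    move=> d d0; have [N NP] := tends_bop X tw d0.
    by exists N => n Nn; apply: NP; exact: leqW.
  (* With [|w| <= |x|] and [|X^(n+1) w| <= |x|], log-convexity gives [|X w|^(n+1) <= |x|^(n+1)]. *)
  move=> n; have := power_log_convex (w n.+1) n Xs.
  move=> h; have : nrm (X (w n.+1)) ^+ n.+1 <= nrm x ^+ n.+1.
    apply: (le_trans h); rewrite [leRHS]exprS ler_pM ?nrm_ge0 ?exprn_ge0 ?nrm_ge0 //.
    by rewrite lerXn2r ?nnegrE ?nrm_ge0.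
  by rewrite ler_pXn2r // ?nnegrE ?nrm_ge0.
rewrite -(@ler_pXn2r _ 2) // ?nnegrE ?nrm_ge0 ?mulr_ge0 ?nrm_ge0 ?(ltW B'0) //.
have /is_adjointP hTS := is_adjointC TS.
rewrite -rdotxx -hTS.
have -> : S (T x) = (B' ^+ 2)%:C%C *: X x.
  rewrite -[X x]/((B' ^- 2)%:C%C *: S (T x)) scalerA -rmorphM /= divff ?scale1r //.
  by rewrite expf_neq0 // gt_eqF.
rewrite rdotZl exprMn ler_wpM2l ?sqr_ge0 //.
by apply: (le_trans (rdot_le _ _)); rewrite expr2 ler_wpM2r ?nrm_ge0.
Qed.

(** The squared differences are small in trace, and [weighted_dominator] turns this into operators
    [Q m] tending to 0 at every vector. The weights [2^j] against the rate [8^-j] leave [4^-j],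
    which gives the majorant [4 * 4^-m]. *)
Lemma fast_cauchy_limit (u : nat -> ts_op A) (C : R) :
  (forall n, M (u n)) -> (forall n, selfadjoint (u n)) -> 0 <= C ->
  (forall n x, nrm (u n x) <= C * nrm x) ->
  (forall n, tr ((u n.+1 - u n) ^+ 2) <= 8^-1 ^+ n) ->
  exists2 T : ts_op A, (forall x, tends (fun n => u n x) (T x)) &
    [/\ M T, selfadjoint T &
    forall e : R, 0 < e -> exists N, forall n, (N <= n)%N -> tr ((T - u n) ^+ 2) < e].
Proof.
move=> uM us C0 uC ut.
pose dl l := u l.+1 - u l.
have dM l : M (dl l) by exact: algB.
have ds l : selfadjoint (dl l) by exact: selfadjointB.
have q0 : 0 <= (4^-1 : R) < 1 by lra.
have [|||||||Q [QMs Qt Q3 Q4]] := @weighted_dominator 2 (fun l => dl l ^+ 2)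
   (fun m => 4 * 4^-1 ^+ m).
- by rewrite ler1n.
- by move=> l; exact: algX.
- by move=> l; exact: selfadjointX.
- by move=> l x; rewrite selfadjoint_sq ?sqr_ge0.
- by move=> m; rewrite mulr_ge0 // exprn_ge0.
- move=> m; have := ut m; rewrite -/(dl m).
  have h8 : (0 : R) <= 8^-1 by rewrite invr_ge0.
  have h84 : (8^-1 : R) <= 4^-1 by rewrite lef_pV2 ?posrE ?ler_nat.
  have : (8^-1 : R) ^+ m <= 4^-1 ^+ m by rewrite lerXn2r ?nnegrE // (le_trans h8).
  rewrite /= [4^-1 ^+ m.+1]exprS; set p := tr _; set a := _ ^+ m; set b := _ ^+ m; lra.
- move=> d d0; have [|N NP] := @expr_small _ (4^-1) (d / 4) q0; first by rewrite divr_gt0.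
  by exists N; have := NP N (leqnn _); set a := _ ^+ _; lra.
have dom d m x : nrm (u (m + d)%N x - u m x) ^+ 2 <=
    rdot (weighted_sum 2 (fun l => dl l ^+ 2) d m x) x.
  elim: d m => [|d IH] m; first by rewrite addn0 subrr nrm0 expr0n /= /rdot linear0l.
  rewrite rdot_weighted_sum selfadjoint_sq //.
  have := IH m.+1; rewrite addSnnS.
  have -> : u (m + d.+1)%N x - u m x = (u (m + d.+1)%N x - u m.+1 x) - - (dl m x).
    by rewrite opprK -[dl m x]/(u m.+1 x - u m x) addrA subrK.
  set y := _ - u m.+1 x; set z := dl m x.
  rewrite nrmBsq nrmN rdotNr => h.
  have := sqr_ge0 (nrm (y - z)); rewrite nrmBsq.
  set p := rdot (weighted_sum _ _ _ _ _) _; move: h; rewrite -/p; lra.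
pose c := 1 + (2 * C) ^+ 2.
have Mdiff n m : M (u n - u m) by exact: algB.
have sdiff n m : selfadjoint (u n - u m) by exact: selfadjointB.
(* [Q m] dominates only contractions. So [D^2] is compared with the weighted sum through their
   resolvents, where the order is reversed, and [resolvent_sq_bound] leads back to [D^2];
   boundedness of the sequence enters through [c]. *)
have key d m x : nrm (u (m + d)%N x - u m x) ^+ 2 <= c * rdot (Q m x) x.
  pose D := u (m + d)%N - u m.
  have MD : M D by exact: Mdiff.
  have sD : selfadjoint D by exact: sdiff.
  have [|||G _ [_ G1 GE]] := @alg_resolvent _ A (D ^+ 2).
  - exact: algX.
  - exact: selfadjointX.
  - by move=> y; rewrite selfadjoint_sq // sqr_ge0.
  have [|||G' _ [_ _ GE']] := @alg_resolvent _ A (weighted_sum 2 (fun l => dl l ^+ 2) d m).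
  - elim: d m {D MD sD G G1 GE} => [|d IH] m /=; first exact: alg0.
    by apply: algZ; apply: algD => //; exact: algX.
  - elim: d m {D MD sD G G1 GE} => [|d IH] m /=; first exact: selfadjoint0.
    by apply: selfadjointZ; apply: selfadjointD => //; exact: selfadjointX.
  - by move=> y; apply: le_trans (dom d m y); exact: sqr_ge0.
  have Qd := Q4 m d (G' x) x (GE' x).
  have ant : rdot (G' x) x <= rdot (G x) x.
    apply: (resolvent_antitone (S := D ^+ 2) _ _ _ (GE x) (GE' x)).
    - exact: selfadjointX.
    - by move=> y; rewrite selfadjoint_sq // sqr_ge0.
    - by move=> y; rewrite selfadjoint_sq //; exact: dom.
  have Dn y : nrm (D y) ^+ 2 <= (2 * C) ^+ 2 * nrm y ^+ 2.
    rewrite -exprMn lerXn2r ?nnegrE ?nrm_ge0 ?mulr_ge0 ?nrm_ge0 //.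
    rewrite -[D y]/(u (m + d)%N y - u m y); apply: (le_trans (nrmD _ _)).
    rewrite nrmN; have := uC (m + d)%N y; have := uC m y; lra.
  have e1 := resolvent_sq_bound sD Dn (GE x).
  apply: (le_trans e1); rewrite ler_wpM2l ?/c ?addr_ge0 ?sqr_ge0 //.
  by apply: le_trans Qd; rewrite !rdotBl lerD2l lerN2.
have c0 : 0 < c by rewrite ltr_pwDl ?sqr_ge0.
have [|T uT TC] := bop_lim C0 uC.
  move=> x; apply: complete_tends => e e0.
  have e1 : 0 < (e / 2) ^+ 2 / c by rewrite divr_gt0 ?exprn_gt0 ?divr_gt0.
  have [N NP] := Q3 x _ e1.
  have near n : (N <= n)%N -> nrm (u n x - u N x) < e / 2.
    move=> Nn; rewrite -(subnKC Nn) -(@ltr_pXn2r _ 2) // ?nnegrE ?nrm_ge0 ?divr_ge0 ?(ltW e0) //.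
    apply: (le_lt_trans (key _ _ _)).
    by have := NP N (leqnn _); rewrite ltr_pdivlMr // mulrC.
  exists N => n m Nn Nm; rewrite -(subrKA (u N x)); apply: (le_lt_trans (nrmD _ _)).
  by rewrite [nrm (u N x - _)]nrmB [ltRHS]splitr ltrD ?near.
have MT : M T by exact: alg_lim uT.
have sT : selfadjoint T by exact: selfadjoint_lim uT.
exists T => //; split => // e e0.
have e1 : 0 < e / (c * 4) by rewrite divr_gt0 ?mulr_gt0.
have [N NP] := expr_small q0 e1.
exists N => n Nn.
have [QM Qs] := QMs n.
apply: (@le_lt_trans _ _ (tr (c%:C%C *: Q n))).
  apply: tr_le.
  - by apply: algX; exact: algB.
  - exact: algZ.
  - by apply: selfadjointX; exact: selfadjointB.
  - exact: selfadjointZ.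
  move=> x; rewrite rdotZl selfadjoint_sq; last exact: selfadjointB.
  rewrite -[(T - u n) x]/(T x - u n x).
  have cQ0 : 0 <= c * rdot (Q n x) x by apply: le_trans (key 0%N n x); exact: sqr_ge0.
  rewrite -(sqr_sqrtr cQ0) lerXn2r ?nnegrE ?nrm_ge0 ?sqrtr_ge0 //.
  apply: (@tends_le _ _ (fun d => u (n + d)%N x - u n x)).
    apply: tendsD; last exact: tends_cst.
    move=> d d0; have [K KP] := uT x d d0; exists K => k Kk; apply: KP.
    exact: leq_trans Kk (leq_addl _ _).
  move=> d; rewrite -(@ler_pXn2r _ 2) // ?nnegrE ?nrm_ge0 ?sqrtr_ge0 //.
  by rewrite sqr_sqrtr // key.
rewrite trZ //; apply: (@le_lt_trans _ _ (c * (4 * 4^-1 ^+ n))).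
  by rewrite ler_wpM2l ?(ltW c0).
by rewrite mulrA mulrC -ltr_pdivlMr ?mulr_gt0 // NP.
Qed.

End NormFromMoments.

(** * Sums of transfer matrices over words *)

Section FiniteFunctionGlue.
Context {V : nmodType} (I : finType).

Definition fglue k (p : 'I_k.+1) (ct : I * {ffun 'I_k -> I}) : {ffun 'I_k.+1 -> I} :=
  [ffun i => if unlift p i is Some j then ct.2 j else ct.1].

Lemma fglueE k (p : 'I_k.+1) c t : fglue p (c, t) p = c.
Proof. by rewrite ffunE unlift_none. Qed.

Lemma fglue_lift k (p : 'I_k.+1) c t j : fglue p (c, t) (lift p j) = t j.
Proof. by rewrite ffunE liftK. Qed.

Lemma big_fglue k (p : 'I_k.+1) (F : {ffun 'I_k.+1 -> I} -> V) :
  \sum_t F t = \sum_c \sum_t F (fglue p (c, t)).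
Proof.
rewrite pair_big /= (reindex (fglue p)) /=; first by apply: eq_bigr => -[].
exists (fun t : {ffun 'I_k.+1 -> I} => (t p, [ffun i => t (lift p i)])) => [[c t] _|t _] /=.
  by rewrite fglueE; congr (_, _); apply/ffunP => i; rewrite ffunE fglue_lift.
apply/ffunP => i; case: (unliftP p i) => [j|] ->; rewrite ?fglueE //.
by rewrite fglue_lift ffunE.
Qed.

End FiniteFunctionGlue.

Definition respects k (I J : finType) (e : rel 'I_k) (f : I -> J) (t : {ffun 'I_k -> I}) :=
  [forall a, forall b, e a b ==> (f (t a) == f (t b))].

Lemma respectsP k (I J : finType) (e : rel 'I_k) (f : I -> J) (t : {ffun 'I_k -> I}) :
  reflect (forall a b, e a b -> f (t a) = f (t b)) (respects e f t).
Proof.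
apply: (iffP forallP) => [h a b ab|h a].
  by have /forallP/(_ b)/implyP/(_ ab)/eqP := h a.
by apply/forallP => b; apply/implyP => /h ->.
Qed.

Section WordSums.
Context {R : realType} (I J : finType) (n : nat).
Implicit Types (A B : 'M[R]_n) (v : 'cV[R]_n).

Definition colsum A j := \sum_i `|A i j|.
Definition rowsum A i := \sum_j `|A i j|.

Lemma colsum_ge0 A j : 0 <= colsum A j.
Proof. exact: sumr_ge0. Qed.

Lemma rowsum_ge0 A i : 0 <= rowsum A i.
Proof. exact: sumr_ge0. Qed.

Lemma colsumM A B j : colsum (A *m B) j <= \sum_l colsum A l * `|B l j|.
Proof.
rewrite /colsum; apply: (@le_trans _ _ (\sum_i \sum_l `|A i l| * `|B l j|)).
  apply: ler_sum => i _; rewrite mxE; apply: (le_trans (ler_norm_sum _ _ _)).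
  by apply: ler_sum => l _; rewrite normrM.
by rewrite exchange_big /=; apply: ler_sum => l _; rewrite mulr_suml.
Qed.

Lemma rowsumM A B i : rowsum (A *m B) i <= \sum_l `|A i l| * rowsum B l.
Proof.
rewrite /rowsum; apply: (@le_trans _ _ (\sum_j \sum_l `|A i l| * `|B l j|)).
  apply: ler_sum => j _; rewrite mxE; apply: (le_trans (ler_norm_sum _ _ _)).
  by apply: ler_sum => l _; rewrite normrM.
by rewrite exchange_big /=; apply: ler_sum => l _; rewrite mulr_sumr.
Qed.

(** The leftmost index is summed with the others fixed. If [e] ties it to a later position it runs
    over one fiber of [f] only, otherwise over everything; hence [al r] profits exactly from ties to
    the right. *)
Lemma word_colsum k (y : 'I_k -> I -> 'M[R]_n) (f : I -> J) (e : rel 'I_k) (al : 'I_k -> R) :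
  (forall r, 0 <= al r) ->
  (forall (r : 'I_k) j, ~~ [exists s : 'I_k, (r < s)%N && e r s] ->
     \sum_c colsum (y r c) j <= al r) ->
  (forall r u j, \sum_(c | f c == u) colsum (y r c) j <= al r) ->
  forall j, \sum_(t | respects e f t) colsum (\prod_(r < k) y r (t r)) j <= \prod_r al r.
Proof.
elim: k y e al => [|k IH] y e al al0 free fib j.
  rewrite big_ord0; apply: (@le_trans _ _ (\sum_(t : {ffun 'I_0 -> I}) 1)).
    rewrite [leLHS]big_mkcond /=; apply: ler_sum => t _; rewrite big_ord0.
    case: ifP => // _; rewrite /colsum (bigD1 j) //= big1 ?addr0 => [|i ij].
      by rewrite mxE eqxx normr1.
    by rewrite mxE (negbTE ij) normr0.
  by rewrite sumr_const card_ffun card_ord expn0.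
rewrite big_ord_recl big_mkcond (big_fglue ord0) exchange_big /=.
pose e' := [rel a b | e (lift ord0 a) (lift ord0 b)].
pose y' r := y (lift ord0 r).
apply: (@le_trans _ _ (\sum_(t | respects e' f t) al ord0 *
    colsum (\prod_(r < k) y' r (t r)) j)); last first.
  rewrite -mulr_sumr ler_wpM2l //; apply: IH => // [r j' h|r u j'].
    apply: free; apply: contra h => /existsP[s /andP[rs ers]].
    case: (unliftP ord0 s) rs ers => [s'|] -> // rs ers.
    by apply/existsP; exists s'; rewrite /= ers andbT.
  exact: fib.
rewrite [leRHS]big_mkcond /=; apply: ler_sum => t _.
have prodE c : \prod_(r < k.+1) y r (fglue ord0 (c, t) r) =
    y ord0 c *m \prod_(r < k) y' r (t r).
  rewrite big_ord_recl fglueE; congr (_ *m _); apply: eq_bigr => r _.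
  by rewrite fglue_lift.
have tail c : respects e f (fglue ord0 (c, t)) -> respects e' f t.
  move=> /respectsP h; apply/respectsP => a b /h; by rewrite !fglue_lift.
case: ifP => [tt|tf]; last first.
  by rewrite big1 // => c _; case: ifP => // /tail; rewrite tf.
set Bm := \prod_(r < k) _ in prodE *.
have main (P : pred I) : (forall l, \sum_(c | P c) colsum (y ord0 c) l <= al ord0) ->
    \sum_(c | P c) colsum (y ord0 c *m Bm) j <= al ord0 * colsum Bm j.
  move=> hP; apply: (@le_trans _ _ (\sum_(c | P c) \sum_l colsum (y ord0 c) l * `|Bm l j|)).
    by apply: ler_sum => c _; exact: colsumM.
  rewrite exchange_big /= {2}/colsum mulr_sumr; apply: ler_sum => l _.
  by rewrite -mulr_suml ler_wpM2r.
case: (boolP [exists s : 'I_k.+1, (0 < s)%N && e ord0 s]) => [/existsP[s /andP[s0 es]]|nex].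
  case: (unliftP ord0 s) s0 es => [s'|] -> // _ es.
  apply: le_trans (main (fun c => f c == f (t s')) (fib _ _)).
  rewrite [leRHS]big_mkcond /=; apply: ler_sum => c _.
  rewrite prodE; case: ifP => [/respectsP/(_ _ _ es)|_].
    by rewrite fglueE fglue_lift => ->; rewrite eqxx.
  by case: ifP => // _; exact: colsum_ge0.
apply: le_trans (main predT (fun l => free ord0 l nex)).
by apply: ler_sum => c _; rewrite prodE; case: ifP => // _; exact: colsum_ge0.
Qed.

(** Mirror image of [word_colsum]: the rightmost index is summed with the others fixed, so [be r]
    profits from ties to the left. *)
Lemma word_rowsum k (y : 'I_k -> I -> 'M[R]_n) (f : I -> J) (e : rel 'I_k) (be : 'I_k -> R) :
  (forall r, 0 <= be r) ->
  (forall (r : 'I_k) j, ~~ [exists s : 'I_k, (s < r)%N && e s r] ->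
     \sum_c rowsum (y r c) j <= be r) ->
  (forall r u j, \sum_(c | f c == u) rowsum (y r c) j <= be r) ->
  forall j, \sum_(t | respects e f t) rowsum (\prod_(r < k) y r (t r)) j <= \prod_r be r.
Proof.
elim: k y e be => [|k IH] y e be be0 free fib j.
  rewrite big_ord0; apply: (@le_trans _ _ (\sum_(t : {ffun 'I_0 -> I}) 1)).
    rewrite [leLHS]big_mkcond /=; apply: ler_sum => t _; rewrite big_ord0.
    case: ifP => // _; rewrite /rowsum (bigD1 j) //= big1 ?addr0 => [|i ij].
      by rewrite mxE eqxx normr1.
    by rewrite mxE eq_sym (negbTE ij) normr0.
  by rewrite sumr_const card_ffun card_ord expn0.
have liftE (i : 'I_k) : widen_ord (leqnSn k) i = lift ord_max i.
  by apply: val_inj; rewrite /= /bump leqNgt ltn_ord.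
have lifts (a b : 'I_k) : (lift ord_max a < lift ord_max b)%N = (a < b)%N.
  by rewrite !lift_max.
rewrite big_ord_recr big_mkcond (big_fglue ord_max) exchange_big /=.
pose e' := [rel a b | e (lift ord_max a) (lift ord_max b)].
pose y' r := y (lift ord_max r).
rewrite mulrC; under [X in _ * X]eq_bigr do rewrite liftE.
apply: (@le_trans _ _ (\sum_(t | respects e' f t) be ord_max *
    rowsum (\prod_(r < k) y' r (t r)) j)); last first.
  rewrite -mulr_sumr ler_wpM2l //; apply: IH => // [r j' h|r u j'].
    apply: free; apply: contra h => /existsP[s /andP[rs ers]].
    case: (unliftP ord_max s) rs ers => [s'|] -> rs ers.
      by apply/existsP; exists s'; rewrite /= ers andbT -lifts.
    by move: rs; rewrite lift_max /= ltnNge ltnW.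
  exact: fib.
rewrite [leRHS]big_mkcond /=; apply: ler_sum => t _.
have prodE c : \prod_(r < k.+1) y r (fglue ord_max (c, t) r) =
    \prod_(r < k) y' r (t r) *m y ord_max c.
  rewrite big_ord_recr fglueE; congr (_ *m _); apply: eq_bigr => r _.
  by rewrite liftE fglue_lift.
have tail c : respects e f (fglue ord_max (c, t)) -> respects e' f t.
  move=> /respectsP h; apply/respectsP => a b /h; by rewrite !fglue_lift.
case: ifP => [tt|tf]; last first.
  by rewrite big1 // => c _; case: ifP => // /tail; rewrite tf.
set Bm := \prod_(r < k) _ in prodE *.
have main (P : pred I) : (forall l, \sum_(c | P c) rowsum (y ord_max c) l <= be ord_max) ->
    \sum_(c | P c) rowsum (Bm *m y ord_max c) j <= be ord_max * rowsum Bm j.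
  move=> hP; apply: (@le_trans _ _ (\sum_(c | P c) \sum_l `|Bm j l| * rowsum (y ord_max c) l)).
    by apply: ler_sum => c _; exact: rowsumM.
  rewrite exchange_big /= {2}/rowsum mulr_sumr; apply: ler_sum => l _.
  by rewrite -mulr_sumr mulrC ler_wpM2r.
case: (boolP [exists s : 'I_k.+1, (s < (ord_max : 'I_k.+1))%N && e s ord_max]) =>
    [/existsP[s /andP[s0 es]]|nex].
  case: (unliftP ord_max s) s0 es => [s'|] -> s0 es; last by rewrite ltnn in s0.
  apply: le_trans (main (fun c => f c == f (t s')) (fib _ _)).
  rewrite [leRHS]big_mkcond /=; apply: ler_sum => c _.
  rewrite prodE; case: ifP => [/respectsP/(_ _ _ es)|_].
    by rewrite fglueE fglue_lift => <-; rewrite eqxx.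
  by case: ifP => // _; exact: rowsum_ge0.
apply: le_trans (main predT (fun l => free ord_max l nex)).
by apply: ler_sum => c _; rewrite prodE; case: ifP => // _; exact: rowsum_ge0.
Qed.

(** Expanding the nonnegative sum of [|x j| (m v j - sg (x j) s)^2] proves it without square roots
    of the weights. *)
Lemma weighted_cauchy_schwarz (K : finType) (x v : K -> R) :
  (\sum_j x j * v j) ^+ 2 <= (\sum_j `|x j|) * (\sum_j `|x j| * v j ^+ 2).
Proof.
set m := \sum_j `|x j|; set s := \sum_j _; set q := \sum_j _.
have m0 : 0 <= m by exact: sumr_ge0.
have [m00|mn0] := eqVneq m 0.
  have x0 j : x j = 0.
    apply/eqP; rewrite -normr_eq0 eq_le normr_ge0 andbT -m00 /m (bigD1 j) //= lerDl.
    exact: sumr_ge0.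
  by rewrite /s big1 ?expr0n ?mulr_ge0 ?sumr_ge0 // => j _; rewrite ?x0 ?mul0r // normr0 mul0r.
have mp : 0 < m by rewrite lt_neqAle eq_sym mn0.
have : 0 <= \sum_j `|x j| * (m * v j - Num.sg (x j) * s) ^+ 2.
  by apply: sumr_ge0 => j _; rewrite mulr_ge0 ?sqr_ge0.
have h : \sum_j `|x j| * (m * v j - Num.sg (x j) * s) ^+ 2 <= m ^+ 2 * q - m * s ^+ 2.
  apply: (@le_trans _ _ (\sum_j (m ^+ 2 * (`|x j| * v j ^+ 2) -
      2 * m * s * (x j * v j) + s ^+ 2 * `|x j|))).
    apply: ler_sum => j _.
    have e1 : `|x j| * Num.sg (x j) = x j by rewrite mulrC -numEsg.
    have e2 : `|x j| * Num.sg (x j) ^+ 2 <= `|x j|.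
      by rewrite sqr_sg; case: (x j != 0); rewrite ?mulr1 ?mulr0.
    have -> : `|x j| * (m * v j - Num.sg (x j) * s) ^+ 2 = m ^+ 2 * (`|x j| * v j ^+ 2) -
       2 * m * s * (`|x j| * Num.sg (x j) * v j) + s ^+ 2 * (`|x j| * Num.sg (x j) ^+ 2).
      by ring.
    by rewrite e1 lerD2l ler_wpM2l ?sqr_ge0.
  rewrite big_split /= sumrB -!mulr_sumr -/q -/s -/m.
  by rewrite le_eqVlt; apply/orP; left; apply/eqP; ring.
move=> /le_trans/(_ h).
have -> : m ^+ 2 * q - m * s ^+ 2 = m * (m * q - s ^+ 2) by ring.
by rewrite pmulr_rge0 // subr_ge0.
Qed.

Definition sqn v := \sum_i v i 0 ^+ 2.

(** The number [b] bounds the square of the Euclidean operator norm, which postpones all square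
    roots to the final estimates. *)
Definition op_bounded A (b : R) := forall v, sqn (A *m v) <= b * sqn v.

Lemma sqn_ge0 v : 0 <= sqn v.
Proof. by apply: sumr_ge0 => i _; exact: sqr_ge0. Qed.

Lemma schur_test A (al be : R) : 0 <= al -> 0 <= be ->
  (forall j, colsum A j <= al) -> (forall i, rowsum A i <= be) -> op_bounded A (al * be).
Proof.
move=> al0 be0 ha hb v.
apply: (@le_trans _ _ (\sum_i be * \sum_j `|A i j| * v j 0 ^+ 2)).
  apply: ler_sum => i _; rewrite mxE.
  apply: (le_trans (weighted_cauchy_schwarz _ _)).
  by rewrite ler_wpM2r ?hb // sumr_ge0 // => j _; rewrite mulr_ge0 ?sqr_ge0.
rewrite -mulr_sumr exchange_big /= (mulrC al) -mulrA ler_wpM2l //.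
rewrite /sqn mulr_sumr; apply: ler_sum => j _.
by rewrite -mulr_suml ler_wpM2r ?sqr_ge0 ?ha.
Qed.

Lemma op_bounded_sum (K : finType) (F : K -> 'M[R]_n) (b : R) :
  (forall l, op_bounded (F l) b) -> op_bounded (\sum_l F l) (#|K|%:R ^+ 2 * b).
Proof.
move=> hF v; rewrite mulmx_suml.
apply: (@le_trans _ _ (\sum_i #|K|%:R * \sum_l (F l *m v) i 0 ^+ 2)).
  apply: ler_sum => i _; rewrite summxE.
  have := weighted_cauchy_schwarz (fun=> 1) (fun l : K => (F l *m v) i 0).
  rewrite (eq_bigr (fun l => (F l *m v) i 0)) => [|l _]; last by rewrite mul1r.
  rewrite [X in _ <= X * _](eq_bigr (fun=> 1)) => [|l _]; last by rewrite normr1.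
  rewrite [X in _ <= _ * X](eq_bigr (fun l => (F l *m v) i 0 ^+ 2)) => [|l _].
    by rewrite sumr_const.
  by rewrite normr1 mul1r.
rewrite -mulr_sumr exchange_big /= expr2 -!mulrA ler_wpM2l //.
apply: (@le_trans _ _ (\sum_(l : K) b * sqn v)).
  by apply: ler_sum => l _; exact: hF.
by rewrite sumr_const mulr_natl.
Qed.

Lemma op_boundedB A B (b : R) : op_bounded A b -> op_bounded B b -> op_bounded (A - B) (4 * b).
Proof.
move=> hA hB v; rewrite mulmxBl.
apply: (@le_trans _ _ (\sum_i (2 * (A *m v) i 0 ^+ 2 + 2 * (B *m v) i 0 ^+ 2))).
  apply: ler_sum => i _; rewrite !mxE; set p := \sum_j _; set q := \sum_j _.
  by have := sqr_ge0 (p + q); nra.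
rewrite big_split /= -!mulr_sumr.
have := hA v; have := hB v; rewrite /sqn; set x := \sum_i _; set y := \sum_i _.
set z := \sum_i _; lra.
Qed.

Lemma op_bounded_le A (b b' : R) : b <= b' -> op_bounded A b -> op_bounded A b'.
Proof. by move=> bb hA v; apply: (le_trans (hA v)); rewrite ler_wpM2r ?sqn_ge0. Qed.

Lemma op_bounded0 (b : R) : 0 <= b -> op_bounded 0 b.
Proof.
move=> b0 v; rewrite mul0mx /sqn big1; first by rewrite mulr_ge0 ?sqn_ge0.
by move=> i _; rewrite mxE expr0n.
Qed.

Lemma op_boundedM A B (a b : R) : 0 <= a -> op_bounded A a -> op_bounded B b ->
  op_bounded (A *m B) (a * b).
Proof.
move=> a0 hA hB v; rewrite -mulmxA; apply: (le_trans (hA _)).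
by rewrite -mulrA ler_wpM2l.
Qed.

Lemma op_boundedX A (b : R) p : 0 <= b -> op_bounded A b -> op_bounded (A ^+ p) (b ^+ p).
Proof.
move=> b0 hA; elim: p => [|p IH]; first by move=> v; rewrite !expr0 mul1mx mul1r.
by rewrite !exprS; exact: op_boundedM.
Qed.

Lemma prod_entry_path k (y : 'I_k -> 'M[R]_n) i j : (\prod_(r < k) y r) i j != 0 ->
  exists p : nat -> 'I_n, [/\ p 0%N = i, p k = j & forall r : 'I_k, y r (p r) (p r.+1) != 0].
Proof.
elim: k y i j => [|k IH] y i j.
  rewrite big_ord0 mxE; have [->|] := eqVneq i j; last by rewrite eqxx.
  by move=> _; exists (fun=> j); split => // -[].
rewrite big_ord_recr /= mxE => h.
have [l hl] : exists l, (\prod_(r < k) y (widen_ord (leqnSn k) r)) i l * y ord_max l j != 0.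
  apply/existsP; apply: contraNT h; rewrite negb_exists => /forallP h.
  by apply/eqP; apply: big1 => l _; have := h l; rewrite negbK => /eqP.
move: hl; rewrite mulf_eq0 negb_or => /andP[/IH[p [p0 pk pP]] hl].
exists (fun r => if (r <= k)%N then p r else j); split => //=; first by rewrite ltnn.
move=> r; case: (ltngtP r k) (ltn_ord r) => [rk _|rk|rk _]; last 2 first.
- by rewrite ltnS leqNgt rk.
- by rewrite rk (_ : r = ord_max) ?pk //; exact: val_inj.
by have := pP (Ordinal rk); rewrite /= (_ : widen_ord _ _ = r) //; exact: val_inj.
Qed.

End WordSums.

(* The letters (push, pop): (false, false) is the scalar part, (true, false)
   creates a letter on top of the stack, (false, true) annihilates it, and
   (true, true) acts on the top letter without changing its index. *)
Definition letter : finType := (bool * bool)%type.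

(** * Stack paths and the coincidences they force *)

Section StackPaths.
Context (I : finType).
Implicit Types (th : letter) (c : I) (s : seq I).

(** The leftmost factor of a product acts last, so [s'] is the stack after the letter has acted and
    [s] the stack before. Along a path, increasing positions run backwards in time. *)
Definition stack_step th c s' s : bool :=
  match th with
  | (false, false) => s' == s
  | (true, false) => s' == c :: s
  | (false, true) => s == c :: s'
  | (true, true) => (s' == s) && (ohead s == Some c)
  end.

Section Path.
Variables (k : nat) (th : 'I_k -> letter).

Definition legal_path (t : 'I_k -> I) (S : nat -> seq I) :=
  forall r : 'I_k, stack_step (th r) (t r) (S r) (S r.+1).

(** Each step changes the height by an amount depending on the letter alone, so two paths with the
    same letters have the same height profile up to a shift. Hence being matched does not depend on
    the indices. *)
Lemma path_size t S t' S' r : legal_path t S -> legal_path t' S' -> (r <= k)%N ->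
  (size (S r) + size (S' 0) = size (S' r) + size (S 0))%N.
Proof.
move=> h h'; elim: r => [|r IH] rk; first by rewrite addnC.
have {}IH := IH (ltnW rk).
have := h (Ordinal rk); have := h' (Ordinal rk); rewrite /stack_step /=.
case: (th (Ordinal rk)) => -[] [] /=.
- by move=> /andP[/eqP e1 _] /andP[/eqP e2 _]; rewrite -e1 -e2.
- by move=> /eqP e1 /eqP e2; move: IH; rewrite e1 e2 /= !addSn => -[].
- by move=> /eqP e1 /eqP e2; rewrite e1 e2 /= !addSn IH.
- by move=> /eqP e1 /eqP e2; rewrite -e1 -e2.
Qed.

(* Position b acts on the very letter that is on top after position a. *)
Definition matched (S : nat -> seq I) (a b : 'I_k) :=
  [/\ (a < b)%N, (th a).2, (th b).1,
    (forall r, (a < r <= b)%N -> (size (S a.+1) <= size (S r))%N) &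
    size (S b) = size (S a.+1)].

(** Between [a] and [b] the stack never falls below [S a.+1], which therefore stays untouched at the
    bottom; equal heights give [S b = S a.+1], and both indices are its top entry. *)
Lemma matched_eq t S a b : legal_path t S -> matched S a b -> t a = t b.
Proof.
move=> h [ab ta tb ge eqs].
have grow r : (a < r <= b)%N -> exists v, S r = v ++ S a.+1.
  elim: r => // r IH /andP[ar rb].
  move: ar; rewrite ltnS leq_eqVlt => /orP[/eqP ar|ar].
    by exists [::]; rewrite ar.
  have [|v vE] := IH; first by rewrite ar ltnW.
  have rk : (r < k)%N by exact: leq_trans rb (ltnW (ltn_ord b)).
  have sz := ge r.+1 (introT andP (conj (leqW ar) rb)).
  have := h (Ordinal rk); rewrite /stack_step /=; case: (th _) => -[] [] /=.
  - by move=> /andP[/eqP <- _]; exists v.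
  - move=> /eqP e; move: vE sz; rewrite e; case: v => [|x v] /=.
      by move=> <- /=; rewrite ltnn.
    by case=> _ ->; exists v.
  - by move=> /eqP ->; rewrite vE; exists (t (Ordinal rk) :: v).
  - by move=> /eqP <-; exists v.
have Sb : S b = S a.+1.
  have [v vE] := grow b (introT andP (conj ab (leqnn _))).
  have : size v = 0%N.
    by apply/eqP; rewrite -(eqn_add2r (size (S a.+1))) add0n -size_cat -vE eqs.
  by rewrite vE => /size0nil ->.
have ha : ohead (S a.+1) = Some (t a).
  have := h a; rewrite /stack_step; case: (th a) ta => -[] [] //= _.
    by move=> /andP[_ /eqP].
  by move=> /eqP ->.
have hb : ohead (S b) = Some (t b).
  have := h b; rewrite /stack_step; case: (th b) tb => -[] [] //= _.
    by move=> /andP[/eqP -> /eqP].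
  by move=> /eqP ->.
by move: ha; rewrite -Sb hb => -[].
Qed.

Lemma matched_transfer t S t' S' a b : legal_path t S -> legal_path t' S' ->
  matched S a b -> matched S' a b.
Proof.
move=> h h' [ab ta tb ge eqs].
have bk := ltnW (ltn_ord b).
have e r (rk : (r <= k)%N) := path_size h h' rk.
split => // [r /andP[ar rb]|].
  have := ge r (introT andP (conj ar rb)).
  have := e r (leq_trans rb bk); have := e a.+1 (leq_trans ab bk); lia.
have := e b bk; have := e a.+1 (leq_trans ab bk); lia.
Qed.

Lemma step_size t S (r : 'I_k) : legal_path t S ->
  ((size (S r.+1) < size (S r))%N -> (th r).1 /\ size (S r) = (size (S r.+1)).+1) /\
  ((size (S r) < size (S r.+1))%N -> (th r).2 /\ size (S r.+1) = (size (S r)).+1).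
Proof.
move=> /(_ r); rewrite /stack_step; case: (th r) => -[] [] /=.
- by move=> /andP[/eqP -> _]; rewrite ltnn.
- by move=> /eqP -> /=; split => //; rewrite ltnNge leqnSn.
- by move=> /eqP -> /=; split => //; rewrite ltnNge leqnSn.
- by move=> /eqP ->; rewrite ltnn.
Qed.

(** If the height falls below that of [S a.+1], the letter just before the first such position is
    the partner of [a]. If instead the stack at [b] is higher, the last lower position before [b] is
    its partner. *)
Lemma matched_trichotomy t S (a b : 'I_k) : legal_path t S -> (a < b)%N ->
  (th a).2 -> (th b).1 ->
  [\/ matched S a b,
      exists q : 'I_k, (a < q < b)%N /\ matched S a q |
      exists q : 'I_k, (a < q < b)%N /\ matched S q b].
Proof.
move=> h ab ta tb.
pose below r := ((a < r <= b)%N && (size (S r) < size (S a.+1))%N).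
have [ex|nex] := pselect (exists r, below r).
  apply: Or32; case: (ex_minnP ex) => r /andP[/andP[ar rb] rlt] rmin.
  have arl : (a.+1 < r)%N.
    by rewrite ltn_neqAle ar andbT; apply/eqP => e; rewrite -e ltnn in rlt.
  have rp : (r.-1.+1 = r)%N by rewrite prednK // (leq_trans _ ar).
  have qk : (r.-1 < k)%N by rewrite rp (leq_trans rb) // ltnW.
  pose q := Ordinal qk; have aq : (a < r.-1)%N by rewrite -ltnS rp.
  have above x : (a < x <= r.-1)%N -> (size (S a.+1) <= size (S x))%N.
    move=> /andP[ax xr]; rewrite leqNgt; apply/negP => xlt.
    have xr' : (x < r)%N by rewrite -rp ltnS.
    have : (r <= x)%N by apply: rmin; rewrite /below ax xlt (leq_trans (ltnW xr')).
    by rewrite leqNgt xr'.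
  have geq := above r.-1; rewrite aq leqnn /= in geq; have {}geq := geq isT.
  have [dn _] := step_size q h; move: dn; rewrite /= rp => dn.
  have [t1 sE] := dn (leq_trans rlt geq).
  exists q; split; first by rewrite /= aq -ltnS rp ltnS.
  split => //=; apply/eqP; rewrite eqn_leq geq andbT sE.
  exact: rlt.
have ge r : (a < r <= b)%N -> (size (S a.+1) <= size (S r))%N.
  by move=> rP; rewrite leqNgt; apply/negP => rlt; apply: nex; exists r; rewrite /below rP.
have [eqs|neqs] := eqVneq (size (S b)) (size (S a.+1)); first exact: Or31.
apply: Or33.
have Slt : (size (S a.+1) < size (S b))%N.
  by rewrite ltn_neqAle eq_sym neqs ge // ab /=.
pose low r := ((a < r <= b)%N && (size (S r) < size (S b))%N).
have ex : exists r, low r by exists a.+1; rewrite /low ltnS leqnn ab Slt.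
have bd r : low r -> (r <= b)%N by move=> /andP[/andP[]].
case: (ex_maxnP ex bd) => r /andP[/andP[ar rb] rlt] rmax.
have rb' : (r < b)%N.
  by rewrite ltn_neqAle rb andbT; apply/eqP => e; rewrite e ltnn in rlt.
pose q := Ordinal (ltn_trans rb' (ltn_ord b)).
have high x : (r < x <= b)%N -> (size (S b) <= size (S x))%N.
  move=> /andP[rx xb]; rewrite leqNgt; apply/negP => xlt.
  have : (x <= r)%N by apply: rmax; rewrite /low xb xlt (ltn_trans ar).
  by rewrite leqNgt rx.
have geq := high r.+1 (introT andP (conj (ltnSn r) rb')).
have [_ up] := step_size q h; have [t2 sE] := up (leq_trans rlt geq).
have eqb : size (S b) = size (S r.+1).
  by apply/eqP; rewrite eqn_leq geq /= [X in (X <= _)%N]sE.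
exists q; split; first by rewrite /= ar.
by split => //= x xP; rewrite -eqb; exact: high.
Qed.

End Path.
End StackPaths.

(** * Row and column sums of the transfer matrices *)

Section TransferKernels.
Context {R : realType} (I : finType).
Local Notation word := (seq (I * nat)).
Variables (aw : I -> R) (b rho : R) (p z : I -> nat -> R) (ws : seq word).
Implicit Types (th : letter) (c : I) (w : word).

(* Matrix entries of left multiplication by x_c on words of letters (c, n), where
   (c, n) is the normalised centered power of order n + 1 of the centered x_c. *)
Definition kernel th c (w' w : word) : R :=
  match th with
  | (false, false) => aw c * (w' == w)%:R
  | (true, false) => b * ((w' == (c, 0%N) :: w) && (ohead (map fst w) != Some c))%:R
  | (false, true) =>
      if w is (c', n) :: t then p c n * ((c' == c) && (w' == t))%:R else 0
  | (true, true) =>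
      if w is (c', n) :: t then (c' == c)%:R *
        (rho * (w' == (c, n.+1) :: t)%:R + z c n * (w' == (c, 0%N) :: t)%:R) else 0
  end.

Lemma kernel_step th c w' w : kernel th c w' w != 0 ->
  stack_step th c (map fst w') (map fst w).
Proof.
rewrite /kernel /stack_step; case: th => -[] [].
- case: w => [|[c' n] t]; rewrite ?eqxx // => h.
  have [cc|cc] := eqVneq c' c; last by rewrite (negbTE cc) mul0r eqxx in h.
  rewrite cc in h *; rewrite eqxx mul1r in h; rewrite /= eqxx andbT.
  have [->|h1] := eqVneq w' ((c, n.+1) :: t); first by rewrite /= eqxx.
  have [->|h2] := eqVneq w' ((c, 0%N) :: t); first by rewrite /= eqxx.
  by rewrite (negbTE h1) (negbTE h2) !mulr0 addr0 eqxx in h.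
- have [->|h] := eqVneq w' ((c, 0%N) :: w); first by rewrite /= eqxx.
  by rewrite mulr0 eqxx.
- case: w => [|[c' n] t]; rewrite ?eqxx //.
  have [->|_] := eqVneq c' c; last by rewrite mulr0 eqxx.
  by have [->|_] := eqVneq w' t; rewrite /= ?eqxx // mulr0 eqxx.
- by have [->|_] := eqVneq w' w; rewrite ?eqxx // mulr0 eqxx.
Qed.

Definition transfer th c : 'M[R]_(size ws) :=
  \matrix_(i, j) kernel th c (nth [::] ws i) (nth [::] ws j).

Lemma sum_words (F : word -> R) : \sum_(i < size ws) F (nth [::] ws i) = \sum_(w <- ws) F w.
Proof. by rewrite (big_nth [::]) big_mkord. Qed.

Hypothesis ws_uniq : uniq ws.

Lemma sum_word_indicator (C : R) w : 0 <= C -> \sum_(v <- ws) C * (v == w)%:R <= C.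
Proof.
move=> C0; rewrite -mulr_sumr ler_piMr //.
rewrite (_ : \sum_(v <- ws) _ = (count_mem w ws)%:R); last first.
  by rewrite -sum1_count natr_sum [RHS]big_mkcond /=; apply: eq_bigr => v _; case: eqP.
by rewrite count_uniq_mem //; case: (w \in ws).
Qed.

(** An annihilated or reset letter may carry any exponent [n], so row sums need weights summable in
    [n]; the finite list of words bounds the exponents that occur. *)
Lemma sum_word_heads c w (G : nat -> R) (C : R) :
  (forall n, 0 <= G n) -> (forall T, \sum_(n < T) G n <= C) ->
  \sum_(v <- ws) (if v is (c', n) :: t then ((c' == c) && (t == w))%:R * G n else 0) <= C.
Proof.
move=> G0 GC.
have [T TP] : exists T, forall v, v \in ws -> forall c' n t, v = (c', n) :: t -> (n < T)%N.
  elim: (ws) => [|v s [T TP]]; first by exists 0%N.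
  case: v => [|[c1 n1] t1].
    by exists T => v; rewrite inE => /orP[/eqP -> //|/TP].
  exists (maxn n1.+1 T) => v; rewrite inE => /orP[/eqP -> c' n t [_ <- _]|/TP h c' n t /h].
    by rewrite leq_max ltnSn.
  by rewrite leq_max => ->; rewrite orbT.
apply: (@le_trans _ _ (\sum_(v <- ws) \sum_(n < T) G n * (v == (c, nat_of_ord n) :: w)%:R)).
  rewrite big_seq [leRHS]big_seq; apply: ler_sum => v vws.
  have s0 : 0 <= \sum_(n < T) G n * (v == (c, nat_of_ord n) :: w)%:R.
    by apply: sumr_ge0 => i _; rewrite mulr_ge0.
  case: v vws s0 => [|[c' n] t] // /TP /(_ _ _ _ erefl) nT s0.
  have [cc|_] := eqVneq c' c; last by rewrite mul0r.
  have [tt|_] := eqVneq t w; last by rewrite mul0r.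
  rewrite mul1r (bigD1 (Ordinal nT)) //= cc tt eqxx mulr1 lerDl.
  by apply: sumr_ge0 => i _; rewrite mulr_ge0.
rewrite exchange_big /=; apply: le_trans (GC T); apply: ler_sum => n _.
exact: sum_word_indicator.
Qed.

Hypotheses (b0 : 0 <= b) (rho0 : 0 <= rho).
Variables (av : R).
Hypothesis av0 : 0 <= av.
Hypothesis aw_le : forall c, `|aw c| <= av.
Hypothesis p_le : forall c n, `|p c n| <= b.
Hypothesis p_sum : forall c T, \sum_(n < T) `|p c n| <= 2 * b.
Hypothesis z_le : forall c n, `|z c n| <= rho.
Hypothesis z_sum : forall c T, \sum_(n < T) `|z c n| <= rho.

(** Here [f] bounds the number of indices summed. A creation pays [f] in columns but not in rows, an
    annihilation in rows but not in columns, a scalar letter in both, and a letter acting on the top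
    in neither. *)
Definition col_weight th (f : R) : R :=
  match th with
  | (false, false) => av * f
  | (true, false) => b * f
  | (false, true) => b
  | (true, true) => 2 * rho
  end.

Definition row_weight th (f : R) : R :=
  match th with
  | (false, false) => av * f
  | (true, false) => b
  | (false, true) => 2 * b * f
  | (true, true) => 2 * rho
  end.

Lemma sum_const_pred (P : pred I) (C f : R) : 0 <= C -> #|P|%:R <= f ->
  \sum_(c | P c) C <= C * f.
Proof.
move=> C0 Pf; rewrite sumr_const -mulr_natr.
by apply: ler_wpM2l => //; apply: le_trans Pf; rewrite ler_nat; apply: subset_leq_card; apply/subsetP.
Qed.

Lemma sum_one_index (P : pred I) c0 (C : R) : 0 <= C ->
  \sum_(c | P c) (c0 == c)%:R * C <= C.
Proof.
move=> C0; apply: (@le_trans _ _ (\sum_c (c0 == c)%:R * C)).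
  rewrite [leLHS]big_mkcond /=; apply: ler_sum => c _.
  by case: ifP => // _; rewrite mulr_ge0.
rewrite (bigD1 c0) //= eqxx mul1r big1 ?addr0 // => c cc.
by rewrite eq_sym (negbTE cc) mul0r.
Qed.

Lemma transfer_colsum th (P : pred I) (f : R) j : #|P|%:R <= f ->
  \sum_(c | P c) colsum (transfer th c) j <= col_weight th f.
Proof.
move=> Pf; set w := nth [::] ws j.
have cE c : colsum (transfer th c) j = \sum_(w' <- ws) `|kernel th c w' w|.
  by rewrite -sum_words; apply: eq_bigr => i _; rewrite mxE.
under eq_bigr do rewrite cE.
rewrite /kernel /col_weight; case: th {cE} => -[] [].
- move: w => [|[c' n] t].
    by rewrite big1 ?mulr_ge0 // => c _; rewrite big1 // => w' _; rewrite normr0.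
  apply: le_trans (@sum_one_index P c' (2 * rho) _); last by rewrite mulr_ge0.
  apply: ler_sum => c _; have [_|_] := eqVneq c' c; last first.
    by rewrite mul0r big1 // => w' _; rewrite mul0r normr0.
  rewrite mul1r; apply: (@le_trans _ _ (\sum_(w' <- ws)
      (rho * (w' == (c, n.+1) :: t)%:R + rho * (w' == (c, 0%N) :: t)%:R))).
    apply: ler_sum => w' _; rewrite mul1r; apply: (le_trans (ler_normD _ _)).
    rewrite !normrM !normr_nat (ger0_norm rho0) lerD2l ler_wpM2r //.
  by rewrite big_split /= (_ : 2 * rho = rho + rho) ?lerD ?sum_word_indicator //; ring.
- apply: le_trans (sum_const_pred b0 Pf); apply: ler_sum => c _.
  apply: le_trans (sum_word_indicator ((c, 0%N) :: w) b0); apply: ler_sum => w' _.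
  rewrite normrM normr_nat (ger0_norm b0) ler_wpM2l // ler_nat.
  by case: (_ == _); case: (_ != _).
- move: w => [|[c' n] t].
    by rewrite big1 // => c _; rewrite big1 // => w' _; rewrite normr0.
  apply: le_trans (@sum_one_index P c' b b0).
  apply: ler_sum => c _; have [_|_] := eqVneq c' c; last first.
    by rewrite mul0r big1 // => w' _; rewrite /= mulr0 normr0.
  rewrite mul1r; apply: le_trans (sum_word_indicator t b0); apply: ler_sum => w' _.
  by rewrite normrM normr_nat ler_wpM2r.
- apply: le_trans (sum_const_pred av0 Pf); apply: ler_sum => c _.
  apply: le_trans (sum_word_indicator w av0).
  by apply: ler_sum => w' _; rewrite normrM normr_nat ler_wpM2r.
Qed.

Lemma transfer_rowsum th (P : pred I) (f : R) i : #|P|%:R <= f ->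
  \sum_(c | P c) rowsum (transfer th c) i <= row_weight th f.
Proof.
move=> Pf; set w' := nth [::] ws i.
have rE c : rowsum (transfer th c) i = \sum_(w <- ws) `|kernel th c w' w|.
  by rewrite -(sum_words (fun w => `|kernel th c w' w|)); apply: eq_bigr => j _; rewrite mxE.
under eq_bigr do rewrite rE.
rewrite /kernel /row_weight; case: th {rE} => -[] [].
- move: w' => [|[c' n'] t].
    rewrite big1 ?mulr_ge0 // => c _; rewrite big1 // => -[|[c1 n1] t1] _; rewrite ?normr0 //.
    by rewrite !mulr0 addr0 mulr0 normr0.
  apply: le_trans (@sum_one_index P c' (2 * rho) _); last by rewrite mulr_ge0.
  apply: ler_sum => c _; have [->|cc] := eqVneq c' c; last first.
    rewrite mul0r big1 // => -[|[c1 n1] t1] _; rewrite ?normr0 //.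
    by rewrite !eqseq_cons !xpair_eqE (negbTE cc) /= !mulr0 addr0 mulr0 normr0.
  rewrite mul1r; apply: (@le_trans _ _ (\sum_(w <- ws)
      (rho * (w == (c, n'.-1) :: t)%:R +
      (if w is (c1, n) :: t1 then ((c1 == c) && (t1 == t))%:R * `|z c n| else 0)))).
    apply: ler_sum => -[|[c1 n1] t1] _; first by rewrite normr0 addr0 mulr_ge0.
    rewrite !eqseq_cons !xpair_eqE !eqxx /=.
    have [_|_] := eqVneq c1 c; last by rewrite !mul0r normr0 addr0 mulr_ge0.
    rewrite mul1r /= [t == t1]eq_sym; have [_|_] := eqVneq t1 t; last first.
      by rewrite !andbF !mulr0 addr0 normr0 mul0r addr0.
    rewrite !andbT mul1r; apply: (le_trans (ler_normD _ _)).
    rewrite !normrM !normr_nat (ger0_norm rho0) lerD //.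
      by rewrite ler_wpM2l // ler_nat; case: eqP => // ->; rewrite eqxx.
    by rewrite ler_piMr // -[1]/(1%:R) ler_nat; case: (_ == _).
  rewrite big_split /= (_ : 2 * rho = rho + rho); last by ring.
  by rewrite lerD ?sum_word_indicator // sum_word_heads.
- move: w' => [|[c' n'] t].
    by rewrite big1 // => c _; rewrite big1 // => w _; rewrite mulr0 normr0.
  apply: le_trans (@sum_one_index P c' b b0).
  apply: ler_sum => c _; have [->|cc] := eqVneq c' c; last first.
    by rewrite mul0r big1 // => w _; rewrite eqseq_cons xpair_eqE (negbTE cc) /= mulr0 normr0.
  rewrite mul1r; apply: le_trans (sum_word_indicator t b0); apply: ler_sum => w _.
  rewrite normrM normr_nat (ger0_norm b0) ler_wpM2l // ler_nat eqseq_cons eq_sym.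
  by rewrite [w == t]eq_sym; case: (t == w); rewrite ?andbF //; case: (_ && _).
- have b20 : 0 <= 2 * b by rewrite mulr_ge0.
  apply: le_trans (sum_const_pred b20 Pf); apply: ler_sum => c _.
  apply: le_trans (@sum_word_heads c w' (fun n => `|p c n|) _ _ (p_sum c)) => //.
  apply: ler_sum => -[|[c1 n1] t1] _; first by rewrite normr0.
  by rewrite normrM normr_nat mulrC [w' == t1]eq_sym.
- apply: le_trans (sum_const_pred av0 Pf); apply: ler_sum => c _.
  apply: le_trans (sum_word_indicator w' av0).
  by apply: ler_sum => w _; rewrite normrM normr_nat eq_sym ler_wpM2r.
Qed.

End TransferKernels.

(** * Sums over index tuples with a fixed letter pattern *)

Section LetterSums.
Context {R : realType} (I : finType).
Variables (aw : I -> R) (b rho : R) (p z : I -> nat -> R) (ws : seq (seq (I * nat))).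
Hypothesis ws_uniq : uniq ws.
Hypotheses (b0 : 0 <= b) (rho0 : 0 <= rho).
Variables (h B S : R).
Hypotheses (h0 : 0 < h) (B1 : 1 <= B) (S1 : 1 <= S) (bh : b ^+ 2 = B * h).
Hypothesis aw_le : forall c, `|aw c| <= B * h.
Hypothesis p_le : forall c n, `|p c n| <= b.
Hypothesis p_sum : forall c T, \sum_(n < T) `|p c n| <= 2 * b.
Hypothesis z_le : forall c n, `|z c n| <= rho.
Hypothesis z_sum : forall c T, \sum_(n < T) `|z c n| <= rho.
Hypothesis I_le : #|I|%:R * h <= S.

Local Notation Y := (transfer aw b rho p z ws).
Local Notation n := (size ws).

Let B0 : 0 <= B. Proof. exact: le_trans ler01 B1. Qed.
Let S0 : 0 <= S. Proof. exact: le_trans ler01 S1. Qed.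
Let Bh0 : 0 <= B * h. Proof. by rewrite mulr_ge0 // ltW. Qed.

Section FixedLength.
Variable k : nat.
Implicit Types (e : rel 'I_k) (th : {ffun 'I_k -> letter}) (t : {ffun 'I_k -> I}).

Definition word_op th t : 'M[R]_n := \prod_(r < k) Y (th r) (t r).

Definition letter_sum (J : finType) (f : I -> J) e th : 'M[R]_n :=
  \sum_(t | respects e f t) word_op th t.

Definition forced th (x y : 'I_k) := [forall t, (word_op th t != 0) ==> (t x == t y)].

Lemma forcedP th x y : reflect (forall t, word_op th t != 0 -> t x = t y) (forced th x y).
Proof.
apply: (iffP forallP) => hf t; last by apply/implyP => /hf ->.
by move=> /(implyP (hf t)) /eqP.
Qed.

Definition link e th := [rel x y | [|| e x y, e y x, forced th x y | forced th y x]].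

Definition merged e th := connect (link e th).

Lemma merged_sym e th : symmetric (merged e th).
Proof.
apply: sym_connect_sym => x y /=.
by case: (e x y); case: (e y x); case: (forced th x y); case: (forced th y x).
Qed.

(** A nonzero product has a nonzero entry, hence a path of words through nonzero kernel entries;
    forgetting the exponents leaves a stack path. *)
Lemma word_op_path th t : word_op th t != 0 -> exists Sp, legal_path th t Sp.
Proof.
move=> hne; have [[i j] ij] : exists ij : 'I_n * 'I_n, word_op th t ij.1 ij.2 != 0.
  apply/existsP; apply: contraNT hne; rewrite negb_exists => /forallP hz.
  by apply/eqP/matrixP => i j; rewrite mxE; have := hz (i, j); rewrite negbK => /eqP.
have [q [_ _ qP]] := prod_entry_path ij.
exists (fun r => map fst (nth [::] ws (q r))) => r.
by have := qP r; rewrite mxE => /kernel_step.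
Qed.

Lemma matched_forced th t Sp x y : legal_path th t Sp -> matched th Sp x y -> forced th x y.
Proof.
move=> hS hm; apply/forcedP => t' /word_op_path[Sp' hS'].
exact: matched_eq hS' (matched_transfer hS hS' hm).
Qed.

(** Forced coincidences hold in every nonzero summand, so imposing them together with [e] changes
    nothing. The enlarged relation can reveal gains that [e] alone hides. *)
Lemma letter_sum_merged (J : finType) (f : I -> J) e th :
  letter_sum f e th = letter_sum f (merged e th) th.
Proof.
rewrite /letter_sum [LHS]big_mkcond [RHS]big_mkcond; apply: eq_bigr => t _.
have [->|hne] := eqVneq (word_op th t) 0; first by case: ifP; case: ifP.
suff -> : respects e f t = respects (merged e th) f t by [].
apply/respectsP/respectsP => hr x y xy; last first.
  by apply: hr; apply: connect1; rewrite /= xy.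
case/connectP: xy => q; elim: q x => [|x' q IH] x /=; first by move=> _ ->.
move=> /andP[xx' qP] /(IH _ qP) <-.
case/or4P: xx' => [/hr //|/hr //|/forcedP -> //|/forcedP/(_ _ hne) -> //].
Qed.

(** These are the letters whose weight improves because of a tie: a creation gains in columns from a
    later partner, an annihilation in rows from an earlier one, a scalar letter from any partner. *)
Definition harmful (s : rel 'I_k) th (r : 'I_k) :=
  [|| (th r == (true, false)) && [exists x : 'I_k, (r < x)%N && s r x],
      (th r == (false, true)) && [exists x : 'I_k, (x < r)%N && s x r] |
      (th r == (false, false)) && [exists x : 'I_k, (x != r) && s r x]].

                                                                          
(** Without harmful letters, a tie between [x < y] means that [x] reads the top of the stack and [y]
    leaves a letter there. The stack pattern then produces the equality by itself. *)
Lemma harmless_eq e th t : (forall r, ~~ harmful (merged e th) th r) ->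
  word_op th t != 0 -> forall x y, merged e th x y -> t x = t y.
Proof.
move=> good hne; set s := merged e th in good *.
have [Sp hS] := word_op_path hne.
have ssym x y : s x y = s y x := merged_sym e th x y.
have strans x y u : s x y -> s y u -> s x u by exact: connect_trans.
have type2 (x y : 'I_k) : (x < y)%N -> s x y -> (th x).2.
  move=> xy sxy; have := good x; rewrite /harmful; case: (th x) => -[] [] //=.
    by move=> /negP; case; rewrite orbF; apply/existsP; exists y; rewrite xy.
  move=> /negP; case; apply/existsP; exists y; rewrite sxy andbT.
  by apply/eqP => yx; rewrite yx ltnn in xy.
have type1 (x y : 'I_k) : (x < y)%N -> s x y -> (th y).1.
  move=> xy sxy; have := good y; rewrite /harmful; case: (th y) => -[] [] //=.
    by move=> /negP; case; rewrite orbF; apply/existsP; exists x; rewrite xy.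
  move=> /negP; case; apply/existsP; exists x; rewrite ssym sxy andbT.
  by apply/eqP => yx; rewrite yx ltnn in xy.
(* Induction on the distance: either the two positions are matched, or one is matched with an
   intermediate [q]. In the latter case [q] lies in the same merged class and the remaining pair is
   closer. *)
have main d (x y : 'I_k) : (y - x <= d)%N -> (x < y)%N -> s x y -> t x = t y.
  elim: d x y => [|d IH] x y dxy xy sxy.
    by move: dxy; rewrite leqn0 subn_eq0 leqNgt xy.
  have [m|[q [/andP[xq qy] m]]|[q [/andP[xq qy] m]]] :=
    matched_trichotomy hS xy (type2 _ _ xy sxy) (type1 _ _ xy sxy).
  - exact: matched_eq hS m.
  - have sxq : s x q by apply: connect1; rewrite /= (matched_forced hS m) !orbT.
    rewrite (matched_eq hS m); apply: IH => //; first by move: dxy xq qy; clear; lia.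
    by apply: strans sxy; rewrite ssym.
  - have sqy : s q y by apply: connect1; rewrite /= (matched_forced hS m) !orbT.
    rewrite -(matched_eq hS m); apply: IH => //; first by move: dxy xq qy; clear; lia.
    by apply: strans sxy _; rewrite ssym.
move=> x y sxy; case: (ltngtP x y) => xy.
- exact: main (leqnn _) xy sxy.
- by apply/esym; apply: main (leqnn _) xy _; rewrite ssym.
- by rewrite (val_inj xy).
Qed.

(** It dominates each possible product of column and row weight of one letter: [4 rho^2], [B S],
    [2 B S] and [B^2 S^2], since [B] and [S] are at least 1. *)
Definition word_bound : R := 4 * rho ^+ 2 + 2 * B ^+ 2 * S ^+ 2.

Lemma word_bound_ge0 : 0 <= word_bound.
Proof. by rewrite addr_ge0 // ?mulr_ge0 ?sqr_ge0. Qed.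

Let fact (d : R) := d / h.
Let fact_ge0 d : 0 <= d -> 0 <= fact d.
Proof. by move=> d0; rewrite divr_ge0 // ltW. Qed.

(** With [b^2 = B h] and at most [d / h] indices in a set of mass [d], all powers of [h] cancel. The
    uniformity in the number of cells rests on this. *)
Let weight_prod (th : letter) (d d' : R) : 0 <= d -> 0 <= d' ->
  col_weight b rho (B * h) th (fact d) * row_weight b rho (B * h) th (fact d') =
  match th with
  | (false, false) => B ^+ 2 * (d * d')
  | (true, false) => B * d
  | (false, true) => 2 * B * d'
  | (true, true) => 4 * rho ^+ 2
  end.
Proof.
have hn : h != 0 by rewrite gt_eqF.
move=> d0 d0'; rewrite /fact; case: th => -[] [] /=.
- by ring.
- by transitivity (b ^+ 2 * (d / h)); [ring|rewrite bh; field].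
- by transitivity (2 * b ^+ 2 * (d' / h)); [ring|rewrite bh; field].
- by field.
Qed.

Section Bounds.
Variables (J : finType) (f : I -> J) (s : rel 'I_k) (th : {ffun 'I_k -> letter}) (de : R).
Hypotheses (ssym : symmetric s) (de0 : 0 <= de) (deS : de <= S).
Hypothesis fib : forall u, #|[pred c | f c == u]|%:R * h <= de.

Let cf (r : 'I_k) := if [exists x : 'I_k, (r < x)%N && s r x] then de else S.
Let rf (r : 'I_k) := if [exists x : 'I_k, (x < r)%N && s x r] then de else S.
Let al r := col_weight b rho (B * h) (th r) (fact (cf r)).
Let be r := row_weight b rho (B * h) (th r) (fact (rf r)).

Let cf_ge r : de <= cf r.
Proof. by rewrite /cf; case: ifP. Qed.
Let rf_ge r : de <= rf r.
Proof. by rewrite /rf; case: ifP. Qed.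
Let cf_le r : cf r <= S.
Proof. by rewrite /cf; case: ifP. Qed.
Let rf_le r : rf r <= S.
Proof. by rewrite /rf; case: ifP. Qed.
Let cf_ge0 r : 0 <= cf r. Proof. exact: le_trans de0 (cf_ge r). Qed.
Let rf_ge0 r : 0 <= rf r. Proof. exact: le_trans de0 (rf_ge r). Qed.

Let al_ge0 r : 0 <= al r.
Proof.
rewrite /al; move: (fact (cf r)) (fact_ge0 (cf_ge0 r)) => g g0.
by rewrite /col_weight; case: (th r) => -[] []; rewrite ?mulr_ge0 ?(ltW h0).
Qed.

Let be_ge0 r : 0 <= be r.
Proof.
rewrite /be; move: (fact (rf r)) (fact_ge0 (rf_ge0 r)) => g g0.
by rewrite /row_weight; case: (th r) => -[] []; rewrite ?mulr_ge0 ?(ltW h0).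
Qed.

Let cardP (P : pred I) (d : R) : #|P|%:R * h <= d -> #|P|%:R <= fact d.
Proof. by rewrite ler_pdivlMr. Qed.

Lemma letter_sum_schur : op_bounded (letter_sum f s th) (\prod_r (al r * be r)).
Proof.
rewrite big_split /=; apply: schur_test.
- exact: prodr_ge0.
- exact: prodr_ge0.
- move=> j; apply: (@le_trans _ _ (\sum_(t | respects s f t) colsum (word_op th t) j)).
    rewrite /colsum exchange_big /=; apply: ler_sum => i _; rewrite summxE.
    exact: ler_norm_sum.
  apply: (@word_colsum _ _ _ _ k (fun r c => Y (th r) c) f s al) => // [r j' nex|r u j'].
    rewrite /al /cf (negbTE nex).
    exact: (@transfer_colsum _ _ aw b rho p z ws ws_uniq b0 rho0 _ Bh0 aw_le p_le z_le
      (th r) predT _ j' (cardP I_le)).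
  apply: (@transfer_colsum _ _ aw b rho p z ws ws_uniq b0 rho0 _ Bh0 aw_le p_le z_le
      (th r) (fun c => f c == u) _ j').
  by apply: cardP; exact: le_trans (fib u) (cf_ge r).
- move=> i; apply: (@le_trans _ _ (\sum_(t | respects s f t) rowsum (word_op th t) i)).
    rewrite /rowsum exchange_big /=; apply: ler_sum => j _; rewrite summxE.
    exact: ler_norm_sum.
  apply: (@word_rowsum _ _ _ _ k (fun r c => Y (th r) c) f s be) => // [r j' nex|r u j'].
    rewrite /be /rf (negbTE nex).
    exact: (@transfer_rowsum _ _ aw b rho p z ws ws_uniq b0 rho0 _ Bh0 aw_le p_sum z_sum
      (th r) predT _ j' (cardP I_le)).
  apply: (@transfer_rowsum _ _ aw b rho p z ws ws_uniq b0 rho0 _ Bh0 aw_le p_sum z_sum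
      (th r) (fun c => f c == u) _ j').
  by apply: cardP; exact: le_trans (fib u) (rf_ge r).
Qed.

Let BB : B <= B ^+ 2. Proof. by rewrite expr2 ler_peMr. Qed.
Let B2_ge0 : 0 <= B ^+ 2. Proof. exact: sqr_ge0. Qed.
Let rho2_ge0 : 0 <= rho ^+ 2. Proof. exact: sqr_ge0. Qed.
Let SS : S <= S ^+ 2. Proof. by rewrite expr2 ler_peMr. Qed.

Let two_factor_bound (d d' g : R) : 0 <= d -> 0 <= d' -> d <= S -> d' <= S ->
  0 <= g -> d * d' <= S ^+ 2 * g -> B ^+ 2 * (d * d') <= word_bound * g.
Proof.
move=> d0 d0' dS dS' g0 dd; apply: (@le_trans _ _ (B ^+ 2 * (S ^+ 2 * g))).
  by rewrite ler_wpM2l.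
rewrite mulrA ler_wpM2r // /word_bound.
rewrite -mulrA; have := mulr_ge0 B2_ge0 (sqr_ge0 S); have := rho2_ge0.
move: (rho ^+ 2) (B ^+ 2 * S ^+ 2) => x y; lra.
Qed.

Let one_factor_bound (d g : R) : 0 <= d -> 0 <= g -> d <= S * g -> 2 * B * d <= word_bound * g.
Proof.
move=> d0 g0 dg; apply: (@le_trans _ _ (2 * B * (S * g))).
  by rewrite ler_wpM2l // mulr_ge0.
rewrite mulrA ler_wpM2r // /word_bound; apply: (@le_trans _ _ (2 * B ^+ 2 * S ^+ 2)).
  by rewrite ler_pM ?mulr_ge0 // ler_wpM2l.
by rewrite lerDr mulr_ge0.
Qed.

Let weight_le r : al r * be r <= word_bound.
Proof.
rewrite /al /be weight_prod //; case: (th r) => -[] [].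
- by rewrite /word_bound lerDl !mulr_ge0 ?sqr_ge0.
- apply: (@le_trans _ _ (2 * B * cf r)).
    by rewrite ler_wpM2r // ler_peMl // ler1n.
  rewrite -[leRHS]mulr1; apply: one_factor_bound => //; by rewrite mulr1.
- rewrite -[leRHS]mulr1; apply: one_factor_bound => //; by rewrite mulr1.
- rewrite -[leRHS]mulr1; apply: two_factor_bound => //.
  by rewrite mulr1 expr2 ler_pM.
Qed.

Lemma letter_sum_bounded : op_bounded (letter_sum f s th) (word_bound ^+ k).
Proof.
apply: op_bounded_le letter_sum_schur.
rewrite -[X in _ ^+ X]card_ord -prodr_const; apply: ler_prod => r _.
by rewrite weight_le mulr_ge0.
Qed.

Let weight_harmful r : harmful s th r -> al r * be r <= word_bound * de.
Proof.
have deSde : de <= S * de by rewrite ler_peMl.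
rewrite /harmful /al /be weight_prod //.
case/or3P => /andP[/eqP ->].
- rewrite /cf => ->; apply: le_trans (one_factor_bound de0 de0 deSde).
  by rewrite ler_wpM2r // ler_peMl // ler1n.
- by rewrite /rf => ->; apply: one_factor_bound.
- move=> /existsP[x /andP[xr srx]].
  apply: two_factor_bound => //.
  case: (ltngtP x r) => [xlt|rlt|/val_inj xE]; last by rewrite xE eqxx in xr.
    rewrite /rf; have -> : [exists y : 'I_k, (y < r)%N && s y r].
      by apply/existsP; exists x; rewrite xlt ssym.
    by rewrite ler_wpM2r // (le_trans (cf_le r)).
  rewrite /cf; have -> : [exists y : 'I_k, (r < y)%N && s r y].
    by apply/existsP; exists x; rewrite rlt.
  by rewrite mulrC ler_wpM2r // (le_trans (rf_le r)).
Qed.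

Lemma letter_sum_harmful r : harmful s th r ->
  op_bounded (letter_sum f s th) (word_bound ^+ k * de).
Proof.
move=> hr; apply: op_bounded_le letter_sum_schur.
rewrite (bigD1 r) //=.
apply: (@le_trans _ _ (word_bound * de * \prod_(i < k | i != r) word_bound)).
  apply: ler_pM; rewrite ?mulr_ge0 ?weight_harmful //.
    by apply: prodr_ge0 => i _; rewrite mulr_ge0.
  by apply: ler_prod => i _; rewrite weight_le mulr_ge0.
rewrite mulrAC ler_wpM2r // -[X in _ <= X ^+ _]/word_bound.
rewrite -[X in _ <= _ ^+ X]card_ord -prodr_const.
by rewrite [leRHS](bigD1 r).
Qed.

End Bounds.

Definition coarse_sum (J : finType) (f : I -> J) e : 'M[R]_n :=
  \sum_(t | respects e f t) \prod_(r < k) \sum_th Y th (t r).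

Lemma coarse_sumE (J : finType) (f : I -> J) e :
  coarse_sum f e = \sum_(th : {ffun 'I_k -> letter}) letter_sum f e th.
Proof.
rewrite /coarse_sum /letter_sum [RHS]exchange_big /=; apply: eq_bigr => t _.
by rewrite bigA_distr_bigA.
Qed.

Local Notation card_letters := (#|{ffun 'I_k -> letter}|%:R).

Lemma coarse_sum_bounded (J : finType) (f : I -> J) e :
  op_bounded (coarse_sum f e) (card_letters ^+ 2 * word_bound ^+ k).
Proof.
rewrite coarse_sumE; apply: op_bounded_sum => th; rewrite letter_sum_merged.
apply: letter_sum_bounded S0 (lexx S) _ => u.
by apply: le_trans I_le; rewrite ler_wpM2r ?(ltW h0) // ler_nat max_card.
Qed.

(** For each letter pattern there are two cases. A harmful letter makes both sums small by a factor
    [de]; without one, every nonzero summand satisfies the constraints for [f] and for [id] alike,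
    and the sums agree. *)
Lemma coarse_sum_diff (J : finType) (f : I -> J) e (de : R) :
  h <= de -> de <= S -> (forall u, #|[pred c | f c == u]|%:R * h <= de) ->
  op_bounded (coarse_sum f e - coarse_sum id e)
    (card_letters ^+ 2 * (4 * (word_bound ^+ k * de))).
Proof.
move=> hde deS fib; have de0 : 0 <= de by exact: le_trans (ltW h0) hde.
rewrite !coarse_sumE -sumrB; apply: op_bounded_sum => th.
rewrite (letter_sum_merged f) (letter_sum_merged id).
case: (pickP (harmful (merged e th) th)) => [r hr|nh].
  apply: op_boundedB.
    exact: (letter_sum_harmful (merged_sym e th) de0 deS fib hr).
  (* For [id] the fibers are single cells, of mass [h <= de]. *)
  apply: (letter_sum_harmful (merged_sym e th) de0 deS _ hr) => u.
  by rewrite (eq_card (B := pred1 u)) // card1 mul1r.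
have -> : letter_sum f (merged e th) th - letter_sum id (merged e th) th = 0.
  apply/eqP; rewrite subr_eq0; apply/eqP.
  rewrite /letter_sum [LHS]big_mkcond [RHS]big_mkcond; apply: eq_bigr => t _.
  have [->|hne] := eqVneq (word_op th t) 0; first by case: ifP; case: ifP.
  have he x y : merged e th x y -> t x = t y.
    by apply: harmless_eq => // r; rewrite nh.
  have -> : respects (merged e th) f t by apply/respectsP => x y /he ->.
  by have -> : respects (merged e th) id t by apply/respectsP => x y /he ->.
by apply: op_bounded0; rewrite mulr_ge0 // mulr_ge0 // exprn_ge0 // word_bound_ge0.
Qed.

End FixedLength.
End LetterSums.

(** * The free model *)

Section GeometricSums.
Context {R : realType}.

Lemma half_powers_sum T : \sum_(n < T) (2^-1 : R) ^+ n <= 2.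
Proof.
suff -> : \sum_(n < T) (2^-1 : R) ^+ n = 2 - 2 * 2^-1 ^+ T.
  by rewrite lerBlDr lerDl mulr_ge0 // exprn_ge0 // invr_ge0.
elim: T => [|T IH]; first by rewrite big_ord0 expr0 mulr1 subrr.
by rewrite big_ord_recr /= IH exprS; field.
Qed.

End GeometricSums.

Section CharacteristicWords.
Context (I : finType).
Local Notation word := (seq (I * nat)).

(** The letter [(c, n)] counts [n + 1], the power of the centered element it contains. One
    multiplication by a generator raises the degree by at most 1. *)
Definition degree (w : word) := sumn [seq l.2.+1 | l <- w].
Definition alternating (w : word) := sorted (fun c d : I => c != d) (map fst w).

Lemma bounded_words T : exists ws : seq word,
  uniq ws /\ forall w, (w \in ws) = (degree w <= T)%N && alternating w.
Proof.
pose fix L d : seq word := if d is d'.+1 then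
  [::] :: flatten [seq [seq l :: w | w <- L d'] | l <- [seq (c, n) | c <- enum I, n <- iota 0 T]]
  else [:: [::]].
have inL d w : (size w <= d)%N -> (degree w <= T)%N -> w \in L d.
  elim: d w => [|d IH] [|[c n] w] //=; rewrite ltnS => sw; rewrite /degree /= => dw.
  rewrite inE; apply/orP; right; apply/flattenP.
  exists [seq (c, n) :: w0 | w0 <- L d].
    apply: map_f; apply/allpairsP; exists (c, n); split; rewrite ?mem_enum //=.
    by rewrite mem_iota /= add0n; apply: leq_trans dw; exact: leq_addr.
  by apply: map_f; apply: IH => //; apply: leq_trans dw; exact: leq_addl.
exists (undup [seq w <- L T | (degree w <= T)%N && alternating w]).
split=> [|w]; first exact: undup_uniq.
rewrite mem_undup mem_filter; case: (boolP ((degree w <= T)%N && alternating w)) => //= /andP[dw _].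
apply: inL => //; apply: leq_trans dw; rewrite /degree.
by elim: w => //= l w IH; rewrite addSn ltnS (leq_trans IH) // leq_addl.
Qed.

End CharacteristicWords.

Section FreeModel.
Context {R : realType} (A : tracial_space R) (I : finType).
Local Notation M := (@ts_alg R A).
Variable x : I -> ts_op A.
Variables (K B h S : R).
Hypotheses (xM : forall c, M (x c)) (xs : forall c, selfadjoint (x c)).
Hypothesis x_free : freely_independent x.
Hypotheses (K0 : 0 < K) (h0 : 0 < h) (B1 : 1 <= B) (S1 : 1 <= S).
Hypothesis x_le : forall c v, nrm (x c v) <= K * nrm v.
Hypothesis mean_le : forall c, `|tr (x c)| <= B * h.
Hypothesis sq_le : forall c, tr (x c ^+ 2) <= B * h.
Hypothesis I_le : #|I|%:R * h <= S.

Let one : ts_op A := 1.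
Definition centered c : ts_op A := x c - (tr (x c))%:C%C *: one.
Local Notation y := centered.
Let L := 2 * K.
(** Twice the norm bound [2 K] of the centered elements, so that moments divided by powers of
    [growth] decay like [2^-n] and are summable. *)
Definition growth := 4 * K.
Local Notation rho := growth.
Definition spread : R := Num.sqrt (B * h).
Local Notation b := spread.
Definition moment c n : R := tr (y c ^+ n).

Lemma alg_scalar (a : R[i]) : M (a *: one).
Proof. by apply: algZ; exact: alg1. Qed.

Lemma centeredM c : M (y c).
Proof. by apply: algB => //; exact: alg_scalar. Qed.

Lemma centered_sa c : selfadjoint (y c).
Proof. by apply: selfadjointB => //; apply: selfadjointZ; exact: selfadjoint1. Qed.

Lemma tr_scalar (a : R) : tr (a%:C%C *: one) = a.
Proof. by rewrite trZ ?tr1 ?mulr1 //; exact: alg1. Qed.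

Lemma tr_abs_le (T : ts_op A) (C : R) : M T -> selfadjoint T -> 0 <= C ->
  (forall v, nrm (T v) <= C * nrm v) -> `|tr T| <= C.
Proof.
move=> MT sT C0 TC; rewrite ler_norml.
have sc a : selfadjoint (a%:C%C *: one) by apply: selfadjointZ; exact: selfadjoint1.
have ab v : `|rdot (T v) v| <= C * nrm v ^+ 2.
  by apply: (le_trans (rdot_abs _ _)); rewrite expr2 mulrA ler_wpM2r ?nrm_ge0.
have le1 : tr ((- C)%:C%C *: one) <= tr T.
  apply: tr_le => //; [exact: alg_scalar|] => v.
  by rewrite rdotZl rdotxx mulNr; have := ab v; rewrite ler_norml => /andP[].
have le2 : tr T <= tr (C%:C%C *: one).
  apply: tr_le => //; [exact: alg_scalar|] => v.
  by rewrite rdotZl rdotxx; have := ab v; rewrite ler_norml => /andP[].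
by rewrite !tr_scalar in le1 le2; rewrite le1.
Qed.

Let L0 : 0 < L. Proof. by rewrite mulr_gt0. Qed.

Lemma tr_x_le c : `|tr (x c)| <= K.
Proof. by apply: tr_abs_le => //; exact: ltW. Qed.

Lemma centered_le c v : nrm (y c v) <= L * nrm v.
Proof.
rewrite -[y c v]/(x c v - (tr (x c))%:C%C *: v); apply: (le_trans (nrmD _ _)).
rewrite nrmN nrmZ /L -mulrA mulr2n mulrDl mul1r lerD ?x_le //.
by rewrite ler_wpM2r ?nrm_ge0 // tr_x_le.
Qed.

Lemma centeredX_le c n v : nrm ((y c ^+ n) v) <= L ^+ n * nrm v.
Proof.
elim: n => [|n IH]; first by rewrite !expr0 mul1r.
rewrite !exprS -mulrA; apply: (le_trans (centered_le _ _)).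
by rewrite ler_wpM2l // ltW.
Qed.

Lemma moment1 c : moment c 1 = 0.
Proof.
by rewrite /moment expr1 trB ?tr_scalar ?subrr //; exact: alg_scalar.
Qed.

Lemma moment_le c n : `|moment c n| <= L ^+ n.
Proof.
apply: tr_abs_le; [exact/algX/centeredM|exact/selfadjointX/centered_sa|exact/exprn_ge0/ltW|].
exact: centeredX_le.
Qed.

Lemma moment2_le c : moment c 2 <= B * h.
Proof.
apply: le_trans (sq_le c).
have -> : moment c 2 = tr (x c ^+ 2) - tr (x c) ^+ 2.
  rewrite /moment; set t := tr (x c).
  have -> : y c ^+ 2 = x c ^+ 2 - t%:C%C *: x c - t%:C%C *: x c + (t ^+ 2)%:C%C *: one.
    rewrite /centered -/t !expr2 mulrBl !mulrBr bop_scaleAl !bop_scaleAr bop_scaleAl.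
    by rewrite !mulr1 mul1r scalerA -rmorphM /= opprB addrA addrAC.
  have h1 : M (x c ^+ 2) by exact: algX.
  have h2 : M (t%:C%C *: x c) by exact: algZ.
  have h3 : M (x c ^+ 2 - t%:C%C *: x c) by exact: algB.
  rewrite trD; [|exact: algB|exact: alg_scalar].
  by rewrite !trB // tr_scalar trZ // -/t; ring.
by rewrite lerBlDr lerDl sqr_ge0.
Qed.

(** Writing [y^(n+2)] as [y y^n y] bounds it by [L^n y^2]. All moments of order at least 2 are thus
    [O(h)], which makes the annihilation weights [O(b)]. *)
Lemma moment_ge2_le c n : `|moment c n.+2| <= L ^+ n * (B * h).
Proof.
apply: (@le_trans _ _ (L ^+ n * moment c 2)); last first.
  by rewrite ler_wpM2l ?moment2_le // exprn_ge0 // ltW.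
have My := centeredM c; have sy := centered_sa c.
have Msq : M (y c ^+ 2) by exact: algX.
have ssq : selfadjoint (y c ^+ 2) by exact: selfadjointX.
have key v : `|rdot ((y c ^+ n.+2) v) v| <= L ^+ n * rdot ((y c ^+ 2) v) v.
  rewrite selfadjoint_sq //.
  have -> : (y c ^+ n.+2) v = y c ((y c ^+ n) (y c v)).
    by rewrite exprS exprSr.
  rewrite selfadjointE //; apply: (le_trans (rdot_abs _ _)).
  by rewrite expr2 mulrA ler_wpM2r ?nrm_ge0 // centeredX_le.
have Mc (a : R) : M (a%:C%C *: (y c ^+ 2)) by exact: algZ.
have sc (a : R) : selfadjoint (a%:C%C *: (y c ^+ 2)) by exact: selfadjointZ.
rewrite ler_norml -mulNr /moment -!trZ //.
apply/andP; split; apply: tr_le => //; try exact: algX; try exact: selfadjointX.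
  move=> v; rewrite rdotZl mulNr; by have := key v; rewrite ler_norml => /andP[].
by move=> v; rewrite rdotZl; have := key v; rewrite ler_norml => /andP[].
Qed.

Lemma spread_gt0 : 0 < b.
Proof. by rewrite sqrtr_gt0 mulr_gt0 // (lt_le_trans ltr01). Qed.

Lemma spread_sq : b ^+ 2 = B * h.
Proof. by rewrite sqr_sqrtr // mulr_ge0 ?(ltW h0) // (le_trans ler01). Qed.

Let rho_gt0 : 0 < rho. Proof. by rewrite mulr_gt0. Qed.
Let rhoL : rho = 2 * L. Proof. by rewrite /growth /L; ring. Qed.

Definition pop_weight c n : R := b^-1 * rho ^- n * moment c n.+2.
Definition reset_weight c n : R := - (rho ^- n * moment c n.+1).

Lemma powers_ratio n : rho ^- n * L ^+ n = 2^-1 ^+ n.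
Proof.
have Ln : L ^+ n != 0 by rewrite expf_neq0 // gt_eqF.
by rewrite rhoL exprMn invfM -mulrA mulVf // mulr1 exprVn.
Qed.

Lemma pop_weight_le2 c n : `|pop_weight c n| <= b * 2^-1 ^+ n.
Proof.
have bn : b != 0 by rewrite gt_eqF // spread_gt0.
rewrite /pop_weight !normrM ger0_norm ?invr_ge0 ?(ltW spread_gt0) //.
rewrite ger0_norm ?invr_ge0 ?exprn_ge0 ?(ltW rho_gt0) //.
apply: (@le_trans _ _ (b^-1 * rho ^- n * (L ^+ n * (B * h)))).
  rewrite ler_wpM2l ?moment_ge2_le // mulr_ge0 ?invr_ge0 ?exprn_ge0 ?(ltW rho_gt0) //.
  exact/ltW/spread_gt0.
rewrite -spread_sq -powers_ratio; move: (rho ^- n) (L ^+ n) => q s.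
rewrite le_eqVlt; apply/orP; left; apply/eqP.
by transitivity ((b^-1 * b) * b * (q * s)); [ring|rewrite mulVf // mul1r].
Qed.

Lemma reset_weight_le2 c n : `|reset_weight c n| <= L * 2^-1 ^+ n.
Proof.
rewrite /reset_weight normrN normrM ger0_norm ?invr_ge0 ?exprn_ge0 ?(ltW rho_gt0) //.
rewrite -powers_ratio mulrCA ler_wpM2l ?invr_ge0 ?exprn_ge0 ?(ltW rho_gt0) //.
by rewrite -exprS moment_le.
Qed.

Let half_le1 n : (2^-1 : R) ^+ n <= 1.
Proof. by rewrite exprn_ile1 ?invr_ge0 // invf_le1 // ler1n. Qed.

Lemma pop_weight_le c n : `|pop_weight c n| <= b.
Proof.
apply: (le_trans (pop_weight_le2 c n)).
by rewrite ler_piMr // ltW // spread_gt0.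
Qed.

Lemma pop_weight_sum c T : \sum_(n < T) `|pop_weight c n| <= 2 * b.
Proof.
apply: (@le_trans _ _ (\sum_(n < T) b * 2^-1 ^+ n)).
  by apply: ler_sum => n _; exact: pop_weight_le2.
by rewrite -mulr_sumr mulrC ler_wpM2r ?half_powers_sum // ltW // spread_gt0.
Qed.

Lemma reset_weight_le c n : `|reset_weight c n| <= rho.
Proof.
apply: (le_trans (reset_weight_le2 c n)).
apply: (@le_trans _ _ L); first by rewrite ler_piMr // ltW.
by rewrite rhoL ler_peMl ?(ltW L0) // ler1n.
Qed.

Lemma reset_weight_sum c T : \sum_(n < T) `|reset_weight c n| <= rho.
Proof.
apply: (@le_trans _ _ (\sum_(n < T) L * 2^-1 ^+ n)).
  by apply: ler_sum => n _; exact: reset_weight_le2.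
by rewrite -mulr_sumr rhoL mulrC ler_wpM2r ?half_powers_sum // ltW.
Qed.

(** The factor [b^-1] balances creation and annihilation: [y c] is [b] times the letter [(c, 0)],
    and moments of size [b^2] come back with weight [b]. *)
Definition letter_elt c n : ts_op A :=
  (b^-1 * rho ^- n)%:C%C *: (y c ^+ n.+1 - (moment c n.+1)%:C%C *: one).

Lemma letter_eltM c n : M (letter_elt c n).
Proof.
apply: algZ; apply: algB; last exact: alg_scalar.
exact/algX/centeredM.
Qed.

Lemma phi_letter_elt c n : ts_trace (letter_elt c n) = 0.
Proof.
have h1 : M (y c ^+ n.+1) by exact/algX/centeredM.
have h2 := alg_scalar (moment c n.+1)%:C%C.
rewrite phiZ; last exact: algB.
rewrite phiB // phi_real //; last exact/selfadjointX/centered_sa.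
rewrite phiZ ?phi1 ?mulr1 ?subrr ?mulr0 //; exact: alg1.
Qed.

Lemma centered_letter0 c : y c = b%:C%C *: letter_elt c 0.
Proof.
rewrite /letter_elt expr0 invr1 mulr1 expr1 moment1 scale0r subr0.
by rewrite scalerA -rmorphM /= mulfV ?scale1r // gt_eqF // spread_gt0.
Qed.

(** With [m_j] the moments of [y], [y (y^(n+1) - m_(n+1))] is [(y^(n+2) - m_(n+2)) + m_(n+2) -
    m_(n+1) y]. The three terms are the raised letter, the annihilation and the reset to exponent
    0. *)
Lemma centered_letter c n : y c * letter_elt c n =
  rho%:C%C *: letter_elt c n.+1 + (pop_weight c n)%:C%C *: one +
  (reset_weight c n)%:C%C *: letter_elt c 0.
Proof.
have bn : b != 0 by rewrite gt_eqF // spread_gt0.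
have rn : rho != 0 by rewrite gt_eqF.
have e1 : (reset_weight c n)%:C%C *: letter_elt c 0 =
    ((reset_weight c n) * b^-1)%:C%C *: y c.
  by rewrite [y c in RHS]centered_letter0 scalerA -rmorphM /= mulfVK.
rewrite e1 /letter_elt bop_scaleAr mulrBr bop_scaleAr mulr1 -exprS.
rewrite scalerA -rmorphM /= [in LHS]scalerBr [in RHS]scalerBr !scalerA -!rmorphM /=.
have -> : rho * (b^-1 * rho ^- n.+1) = b^-1 * rho ^- n.
  by rewrite exprS invfM mulrCA [rho * _]mulrA mulfV // mul1r.
rewrite -addrA -addrA; congr (_ + _).
rewrite addrA -[in RHS]scaleNr -scalerDl -rmorphN -rmorphD /=.
rewrite (_ : - (_ * moment c n.+2) + pop_weight c n = 0); last first.
  by rewrite /pop_weight addNr.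
rewrite scale0r add0r -scaleNr -rmorphN /=; congr (_%:C%C *: _).
by rewrite /reset_weight; ring.
Qed.

Definition word_elt (w : seq (I * nat)) : ts_op A := \prod_(l <- w) letter_elt l.1 l.2.

Lemma word_eltM w : M (word_elt w).
Proof. by apply: alg_prod => l _; exact: letter_eltM. Qed.

Lemma word_elt_cons c n w : word_elt ((c, n) :: w) = letter_elt c n * word_elt w.
Proof. by rewrite /word_elt big_cons. Qed.

Lemma star_centered c : smallest star_subalgebra [set x c] (y c).
Proof.
move=> Bs [Bstar xB]; have [B1' BZ _ _] := Bstar.
rewrite /centered addrC -scaleNr.
apply: BZ => //.
exact: xB.
Qed.

Lemma star_letter c n : smallest star_subalgebra [set x c] (letter_elt c n).
Proof.
move=> Bs [Bstar xB]; have [B1' BZ BM Bst] := Bstar.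
have By : Bs (y c) by exact: star_centered.
have B0 : Bs 0 by have := BZ (-1) _ _ B1' B1'; rewrite scaleN1r addNr.
have Bn m : Bs (y c ^+ m) by elim: m => [|m IH] //; rewrite exprS; exact: BM.
rewrite /letter_elt -[_ *: _]addr0; apply: (BZ) => //.
by rewrite addrC -scaleNr; exact: BZ.
Qed.

Lemma phi_word_elt w : w != [::] -> alternating w -> ts_trace (word_elt w) = 0.
Proof.
move=> wn wa; have := x_free (s := [seq (l.1, letter_elt l.1 l.2) | l <- w]).
rewrite big_map; apply.
- by case: w wn {wa}.
- by move: wa; rewrite /alternating !sorted_map.
- move=> q /mapP[l _ ->] /=; split; [exact: star_letter|exact: phi_letter_elt].
Qed.

End FreeModel.

(** * Matrices on words that compute the trace *)

Section Representation.
Context {R : realType} (A : tracial_space R) (I : finType).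
Local Notation M := (@ts_alg R A).
Variable x : I -> ts_op A.
Variables (K B h S : R).
Hypotheses (xM : forall c, M (x c)) (xs : forall c, selfadjoint (x c)).
Hypothesis x_free : freely_independent x.
Hypotheses (K0 : 0 < K) (h0 : 0 < h) (B1 : 1 <= B) (S1 : 1 <= S).
Hypothesis x_le : forall c v, nrm (x c v) <= K * nrm v.
Hypothesis mean_le : forall c, `|tr (x c)| <= B * h.
Hypothesis sq_le : forall c, tr (x c ^+ 2) <= B * h.
Hypothesis I_le : #|I|%:R * h <= S.

Local Notation rho := (growth K).
Local Notation b := (spread B h).
Local Notation pw := (pop_weight x K B h).
Local Notation zw := (reset_weight x K).
Local Notation we := (word_elt x K B h).
Local Notation le_ := (letter_elt x K B h).

Section FixedWords.
Variables (T : nat) (ws : seq (seq (I * nat))).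
Hypothesis ws_uniq : uniq ws.
Hypothesis ws_mem : forall w, (w \in ws) = (degree w <= T)%N && alternating w.
Local Notation n := (size ws).
Local Notation wd := (nth [::] ws).
Local Notation Y := (transfer (fun c => tr (x c)) b rho pw zw ws).

Definition realize (v : 'cV[R]_n) : ts_op A := \sum_(i < n) (v i 0)%:C%C *: we (wd i).

Definition supported r (v : 'cV[R]_n) := forall i, v i 0 != 0 -> (degree (wd i) <= r)%N.

(** Words of degree above [T] are cut off, so the matrix is faithful only on vectors of degree at
    most [T - d], where [d] is the degree that [X] can add. *)
Definition represents d (X : ts_op A) (Xh : 'M[R]_n) :=
  M X /\ forall r v, (r + d <= T)%N -> supported r v ->
    supported (r + d) (Xh *m v) /\ realize (Xh *m v) = X * realize v.

Lemma realizeD u v : realize (u + v) = realize u + realize v.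
Proof.
rewrite /realize -big_split /=; apply: eq_bigr => i _.
by rewrite mxE rmorphD scalerDl.
Qed.

Lemma realizeN v : realize (- v) = - realize v.
Proof.
rewrite /realize -sumrN; apply: eq_bigr => i _.
by rewrite mxE rmorphN scaleNr.
Qed.

Lemma realize0 : realize 0 = 0.
Proof. by rewrite /realize big1 // => i _; rewrite mxE scale0r. Qed.

Lemma supportedD r u v : supported r u -> supported r v -> supported r (u + v).
Proof.
move=> ur vr i; rewrite mxE => h1; have [u0|/ur //] := eqVneq (u i 0) 0.
by apply: vr; apply: contraNneq h1 => ->; rewrite u0 addr0.
Qed.

Lemma supportedN r v : supported r v -> supported r (- v).
Proof. by move=> vr i; rewrite mxE oppr_eq0; exact: vr. Qed.

Lemma supported0 r : supported r 0.
Proof. by move=> i; rewrite mxE eqxx. Qed.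

Lemma sum_word_pick (w0 : seq (I * nat)) (C : R) : w0 \in ws ->
  \sum_(w <- ws) (C * (w == w0)%:R)%:C%C *: we w = C%:C%C *: we w0.
Proof.
move=> w0ws; rewrite (bigD1_seq w0) //= eqxx mulr1 big1 ?addr0 // => w wn.
by rewrite (negbTE wn) mulr0 scale0r.
Qed.

Lemma x_word c w : x c * we w = (tr (x c))%:C%C *: we w + centered x c * we w.
Proof.
rewrite /centered mulrBl bop_scaleAl mul1r addrC subrK.
by [].
Qed.

Lemma sum_kernel c w : w \in ws -> (degree w < T)%N ->
  \sum_(w' <- ws) (\sum_th kernel (fun c => tr (x c)) b rho pw zw th c w' w)%:C%C *: we w' =
  x c * we w.
Proof.
move=> wws dw; have := wws; rewrite ws_mem => /andP[_ aw].
have split4 (F : letter -> R) : \sum_th F th =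
    F (true, true) + F (true, false) + F (false, true) + F (false, false).
  transitivity (\sum_a \sum_c F (a, c)); last by rewrite !big_bool /= !addrA.
  by rewrite pair_bigA; apply: eq_bigr => -[].
under eq_bigr do rewrite split4 !rmorphD /= !scalerDl.
rewrite !big_split /= (_ : \sum_(w' <- ws) (tr (x c) * (w' == w)%:R)%:C%C *: we w' =
  (tr (x c))%:C%C *: we w); last exact: sum_word_pick.
rewrite x_word addrC; congr (_ + _).
(* The cases are the empty word, a top letter of another index, and one of index [c]. Apart from the
   scalar part, the first two only create; the last follows [centered_letter]. *)
case: w wws dw aw => [|[c' m] t] wws dw aw.
  rewrite [X in X + _ + _]big1 ?add0r; last by move=> w' _; rewrite /= rmorph0 scale0r.
  rewrite [X in _ + X]big1 ?addr0; last by move=> w' _; rewrite /= rmorph0 scale0r.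
  under eq_bigr do rewrite andbT.
  rewrite sum_word_pick; last by rewrite ws_mem /degree /= addn0 dw.
  by rewrite /word_elt big_cons !big_nil !mulr1 -centered_letter0.
have [cc|cc] := eqVneq c' c; last first.
  rewrite [X in X + _ + _]big1 ?add0r; last by move=> w' _; rewrite /= mul0r rmorph0 scale0r.
  rewrite [X in _ + X]big1 ?addr0; last by move=> w' _; rewrite /= mulr0 rmorph0 scale0r.
  under eq_bigr => w' _ do rewrite /= (_ : Some c' != Some c) ?andbT //.
  rewrite sum_word_pick; last first.
    rewrite ws_mem /alternating /= eq_sym cc /= andbC; move: aw; rewrite /alternating /= => -> /=.
    by rewrite /degree /= add1n.
  by rewrite word_elt_cons -bop_scaleAl -centered_letter0.
rewrite cc in wws dw aw *.
rewrite [X in _ + X + _]big1 ?addr0; last first.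
  by move=> w' _; rewrite /= eqxx andbF mulr0 rmorph0 scale0r.
under [X in X + _]eq_bigr do rewrite /= mul1r rmorphD /= scalerDl.
rewrite big_split /=.
rewrite sum_word_pick; last first.
  by rewrite ws_mem /alternating /=; move: aw; rewrite /alternating /= => ->; rewrite andbT.
rewrite sum_word_pick; last first.
  rewrite ws_mem /alternating /=; move: aw; rewrite /alternating /= => ->; rewrite andbT.
  by move: dw; rewrite /degree /=; lia.
rewrite sum_word_pick; last first.
  rewrite ws_mem; apply/andP; split.
    by apply: leq_trans (ltnW dw); rewrite /degree /= leq_addl.
  by move: aw; rewrite /alternating /= => /path_sorted.
rewrite !word_elt_cons mulrA centered_letter // !mulrDl !bop_scaleAl mul1r.
by rewrite addrAC.
Qed.

Lemma represents_gen c : represents 1 (x c) (\sum_th Y th c).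
Proof.
split=> // r v rT vr.
have entry (i j : 'I_n) : (\sum_th Y th c) i j =
    \sum_th kernel (fun c => tr (x c)) b rho pw zw th c (wd i) (wd j).
  by rewrite summxE; apply: eq_bigr => th _; rewrite mxE.
split.
  move=> i; rewrite mxE => hi.
  have [j hj] : exists j, (\sum_th Y th c) i j * v j 0 != 0.
    apply/existsP; apply: contraNT hi; rewrite negb_exists => /forallP hz.
    by apply/eqP; apply: big1 => j _; have := hz j; rewrite negbK => /eqP.
  move: hj; rewrite mulf_eq0 negb_or => /andP[hij /vr dj].
  move: hij; rewrite entry => hth.
  have [th hk] : exists th, kernel (fun c => tr (x c)) b rho pw zw th c (wd i) (wd j) != 0.
    apply/existsP; apply: contraNT hth; rewrite negb_exists => /forallP hz.
    by apply/eqP; apply: big1 => th _; have := hz th; rewrite negbK => /eqP.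
  suff : (degree (wd i) <= (degree (wd j)).+1)%N by move=> /leq_trans; apply; rewrite addn1 ltnS.
  move: hk; rewrite /kernel; case: th => -[] [].
  - case: (wd j) => [|[c' m] t]; rewrite ?eqxx //; case: (c' == c); rewrite ?mul0r ?eqxx // mul1r.
    have [->|_] := eqVneq (wd i) ((c, m.+1) :: t); first by rewrite /degree /= addSn.
    have [->|_] := eqVneq (wd i) ((c, 0%N) :: t); last by rewrite !mulr0 addr0 eqxx.
    by rewrite /degree /= addSn add0n ltnS (leq_trans (leq_addl m.+1 _)).
  - have [->|_] := eqVneq (wd i) ((c, 0%N) :: wd j); last by rewrite mulr0 eqxx.
    by rewrite /degree /= add1n.
  - case: (wd j) => [|[c' m] t]; rewrite ?eqxx //; case: (c' == c); rewrite ?mulr0 ?eqxx //=.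
    have [->|_] := eqVneq (wd i) t; last by rewrite mulr0 eqxx.
    by rewrite /degree /= (leq_trans (leq_addl m.+1 _)).
  - by have [->|_] := eqVneq (wd i) (wd j); rewrite ?leqnSn // mulr0 eqxx.
rewrite /realize; under eq_bigr do rewrite mxE rmorph_sum /= scaler_suml.
rewrite exchange_big /= mulr_sumr; apply: eq_bigr => j _.
rewrite bop_scaleAr.
have [->|vj] := eqVneq (v j 0) 0.
  by rewrite scale0r big1 // => i _; rewrite mulr0 scale0r.
rewrite -(@sum_kernel c (wd j)); first last.
- by apply: leq_ltn_trans (vr _ vj) _; rewrite -ltnS -addn1.
- by rewrite mem_nth.
rewrite (big_nth [::]) big_mkord scaler_sumr; apply: eq_bigr => i _.
by rewrite entry rmorphM /= scalerA mulrC.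
Qed.

Lemma represents1 : represents 0 1 1.
Proof.
split; first exact: alg1.
by move=> r v _ vr; rewrite mul1mx addn0 mul1r.
Qed.

Lemma representsM d e X Z Xh Zh : represents d X Xh -> represents e Z Zh ->
  represents (e + d) (X * Z) (Xh * Zh).
Proof.
move=> [XM hX] [ZM hZ]; split; first exact: algM.
move=> r v; rewrite addnA => rT vr.
have [h1 h2] := hZ r v (leq_trans (leq_addr _ _) rT) vr.
have [h3 h4] := hX (r + e)%N _ rT h1.
by rewrite -[Xh * Zh]/(Xh *m Zh) -mulmxA; split => //; rewrite h4 h2 mulrA.
Qed.

Lemma represents_prod k (X : 'I_k -> ts_op A) (Xh : 'I_k -> 'M[R]_n) :
  (forall r, represents 1 (X r) (Xh r)) ->
  represents k (\prod_(r < k) X r) (\prod_(r < k) Xh r).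
Proof.
elim: k X Xh => [|k IH] X Xh hX; first by rewrite !big_ord0; exact: represents1.
rewrite !big_ord_recl.
have := representsM (hX ord0) (IH _ _ (fun r => hX (lift ord0 r))).
by rewrite addn1.
Qed.

Lemma representsX d X Xh m : represents d X Xh -> represents (m * d) (X ^+ m) (Xh ^+ m).
Proof.
move=> hX; elim: m => [|m IH]; first exact: represents1.
by rewrite !exprS mulSn addnC; exact: representsM.
Qed.

Lemma represents_sum d (J : finType) (P : pred J) (X : J -> ts_op A) (Xh : J -> 'M[R]_n) :
  (forall j, P j -> represents d (X j) (Xh j)) ->
  represents d (\sum_(j | P j) X j) (\sum_(j | P j) Xh j).
Proof.
move=> hX; elim/big_rec2: _ => [|j Zh Z Pj [ZM hZ]].
  split; first exact: alg0.
  by move=> r v _ _; rewrite mul0mx mul0r realize0; split => //; exact: supported0.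
have [XM hXj] := hX j Pj; split; first exact: algD.
move=> r v rT vr; have [h1 h2] := hXj r v rT vr; have [h3 h4] := hZ r v rT vr.
by rewrite mulmxDl mulrDl realizeD h2 h4; split => //; exact: supportedD.
Qed.

Lemma representsB d X Z Xh Zh : represents d X Xh -> represents d Z Zh ->
  represents d (X - Z) (Xh - Zh).
Proof.
move=> [XM hX] [ZM hZ]; split; first exact: algB.
move=> r v rT vr; have [h1 h2] := hX r v rT vr; have [h3 h4] := hZ r v rT vr.
rewrite mulmxBl mulrBl realizeD realizeN h2 h4; split => //.
by apply: supportedD => //; exact: supportedN.
Qed.

(** Every nonempty alternating word has trace 0, so [tr X] is the coordinate at the empty word of
    the image of that word. One coordinate is at most the Euclidean norm; no orthogonality of words
    is involved. *)
Lemma represents_tr d X Xh (C : R) : represents d X Xh -> (d <= T)%N -> 0 <= C ->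
  op_bounded Xh C -> tr X ^+ 2 <= C.
Proof.
move=> [XM hX] dT C0 hC.
have ws0 : [::] \in ws by rewrite ws_mem.
have i0P : (index [::] ws < n)%N by rewrite index_mem.
pose i0 := Ordinal i0P.
have wi0 : wd i0 = [::] by exact: nth_index.
pose e0 : 'cV[R]_n := delta_mx i0 0.
have e0E i : e0 i 0 = (i == i0)%:R by rewrite mxE eqxx andbT.
have [|_ hr] := hX 0%N e0 dT.
  by move=> i; rewrite e0E; have [->|] := eqVneq i i0; rewrite ?wi0 // eqxx.
have re0 : realize e0 = 1.
  rewrite /realize (bigD1 i0) //= e0E eqxx scale1r wi0 big1 ?addr0.
    by rewrite /word_elt big_nil.
  by move=> i ii; rewrite e0E (negbTE ii) scale0r.
rewrite re0 mulr1 in hr; set v := Xh *m e0 in hr.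
have trE : tr X = v i0 0.
  rewrite -hr /tr /realize phi_sum; last by move=> i _; apply: algZ; exact: word_eltM.
  rewrite (bigD1 i0) //= big1 ?addr0.
    have we0 : we [::] = 1 by rewrite /word_elt big_nil.
    by rewrite wi0 we0 phiZ ?phi1 ?mulr1 //; exact: alg1.
  move=> i ii; rewrite phiZ; last exact: word_eltM.
  rewrite phi_word_elt ?mulr0 //.
    apply: contra ii => /eqP wi; rewrite -val_eqE /= -(@nth_uniq _ [::] ws) // wi.
    by rewrite nth_index.
  by have := mem_nth [::] (ltn_ord i); rewrite ws_mem => /andP[].
rewrite trE; apply: (@le_trans _ _ (sqn v)).
  by rewrite /sqn (bigD1 i0) //= lerDl sumr_ge0 // => i _; exact: sqr_ge0.
apply: (le_trans (hC e0)); rewrite ler_piMr // /sqn (bigD1 i0) //= e0E eqxx expr1n big1 ?addr0 //.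
by move=> i ii; rewrite e0E (negbTE ii) expr0n.
Qed.

End FixedWords.

Section CoarseSums.
Variable k : nat.

Definition coarse_poly (J : finType) (f : I -> J) (e : rel 'I_k) : ts_op A :=
  \sum_(t : {ffun 'I_k -> I} | respects e f t) \prod_(r < k) x (t r).

Definition reverse_rel (e : rel 'I_k) : rel 'I_k := [rel r s | e (rev_ord r) (rev_ord s)].

Lemma adjoint_word (t : {ffun 'I_k -> I}) :
  is_adjoint (\prod_(r < k) x (t r)) (\prod_(r < k) x (t (rev_ord r))).
Proof.
have gen m (y : 'I_m -> ts_op A) : (forall r, selfadjoint (y r)) ->
    is_adjoint (\prod_(r < m) y r) (\prod_(r < m) y (rev_ord r)).
  elim: m y => [|m IH] y hy; first by rewrite !big_ord0; exact: is_adjoint1.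
  rewrite big_ord_recl big_ord_recr /=.
  have -> : rev_ord ord_max = ord0 :> 'I_m.+1 by apply: val_inj; rewrite /= subnn.
  apply: is_adjointM; first exact: hy.
  have -> : \prod_(i < m) y (rev_ord (widen_ord (leqnSn m) i)) =
      \prod_(i < m) y (lift ord0 (rev_ord i)).
    apply: eq_bigr => i _; congr y; apply: val_inj => /=.
    by rewrite /bump /= add1n subSS -subSn // ltn_ord.
  exact: (IH (fun i => y (lift ord0 i))).
by apply: gen.
Qed.

Lemma adjoint_coarse_poly (J : finType) (f : I -> J) e :
  is_adjoint (coarse_poly f e) (coarse_poly f (reverse_rel e)).
Proof.
pose rv (t : {ffun 'I_k -> I}) : {ffun 'I_k -> I} := [ffun r => t (rev_ord r)].
have rvK : involutive rv by move=> t; apply/ffunP => r; rewrite !ffunE rev_ordK.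
rewrite [X in is_adjoint _ X](_ : _ = \sum_(t : {ffun 'I_k -> I} | respects e f t)
    \prod_(r < k) x (t (rev_ord r))).
  by apply: is_adjoint_sum => t _; exact: adjoint_word.
rewrite /coarse_poly (reindex_inj (inv_inj rvK)) /=; apply: eq_big => [t|t _].
  apply/respectsP/respectsP => ht r s.
    by move=> rs; have := ht (rev_ord r) (rev_ord s); rewrite /reverse_rel /= !ffunE !rev_ordK; apply.
  by move=> /ht; rewrite !ffunE.
by apply: eq_bigr => r _; rewrite ffunE.
Qed.

Lemma coarse_polyM (J : finType) (f : I -> J) e : M (coarse_poly f e).
Proof. by apply: alg_sum => t _; apply: alg_prod => r _. Qed.

(** The truncation [T] grows with the order of the moment but [C] does not, so
    [tr ((X' X)^m) <= C^m] for every [m]. The adjoint needs its own matrix, because transposition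
    does not represent it. *)
Lemma opnorm_represented (X X' : ts_op A) (C : R) : is_adjoint X X' -> 0 <= C ->
  (forall T ws, uniq ws ->
     (forall w, (w \in ws) = (degree w <= T)%N && alternating w) ->
     exists Xh Xh' : 'M[R]_(size ws), [/\ represents T k X Xh, represents T k X' Xh',
       op_bounded Xh C & op_bounded Xh' C]) ->
  opnorm X <= Num.sqrt C.
Proof.
move=> XX' C0 rep.
have [XM X'M] : M X /\ M X'.
  have [ws [wu wm]] := bounded_words I 0.
  by have [Xh [Xh' [[hX _] [hX' _] _ _]]] := rep 0%N ws wu wm.
apply: (opnorm_from_moments XM X'M XX' (sqrtr_ge0 _)) => m; rewrite sqr_sqrtr //.
have [ws [wu wm]] := bounded_words I (m * (k + k)).
have [Xh [Xh' [hX hX' bX bX']]] := rep _ ws wu wm.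
have CC : 0 <= C * C by rewrite mulr_ge0.
have := represents_tr wu wm (representsX m (representsM hX' hX)) (leqnn _)
  (exprn_ge0 m CC) (op_boundedX m CC (op_boundedM C0 bX' bX)).
rewrite -expr2 -exprM mulnC exprM => ht.
apply: le_trans (ler_norm _) _.
by rewrite -(@ler_pXn2r _ 2) ?nnegrE ?exprn_ge0 // real_normK ?num_real.
Qed.

Local Notation card_letters := (#|{ffun 'I_k -> letter}|%:R).
Local Notation wb := (word_bound rho B S).

Lemma represents_coarse T ws : uniq ws ->
  (forall w, (w \in ws) = (degree w <= T)%N && alternating w) ->
  forall (J : finType) (f : I -> J) e,
  represents T k (coarse_poly f e)
    (coarse_sum (fun c => tr (x c)) b rho pw zw ws f e).
Proof.
move=> wu wm J f e; apply: represents_sum => t _; apply: represents_prod => r.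
exact: represents_gen.
Qed.

Let b_ge0 : 0 <= b. Proof. exact/ltW/(spread_gt0 h0 B1). Qed.
Let rho_ge0 : 0 <= rho. Proof. by rewrite mulr_ge0 // ltW. Qed.
Let wbk_ge0 : 0 <= wb ^+ k. Proof. by rewrite exprn_ge0 // word_bound_ge0. Qed.

Lemma opnorm_coarse_poly (J : finType) (f : I -> J) e :
  opnorm (coarse_poly f e) <= Num.sqrt (card_letters ^+ 2 * wb ^+ k).
Proof.
apply: (opnorm_represented (adjoint_coarse_poly f e)) => [|T ws wu wm].
  by rewrite mulr_ge0.
exists (coarse_sum (fun c => tr (x c)) b rho pw zw ws f e).
exists (coarse_sum (fun c => tr (x c)) b rho pw zw ws f (reverse_rel e)).
have bd e' := coarse_sum_bounded wu b_ge0 rho_ge0 h0 B1 S1 (spread_sq h0 B1) mean_le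
  (pop_weight_le xM xs K0 h0 B1 x_le sq_le) (pop_weight_sum xM xs K0 h0 B1 x_le sq_le)
  (reset_weight_le xM xs K0 x_le) (reset_weight_sum xM xs K0 x_le) I_le f e'.
by split => //; exact: represents_coarse.
Qed.

Lemma opnorm_coarse_diff (J : finType) (f : I -> J) e (de : R) :
  h <= de -> de <= S -> (forall u, #|[pred c | f c == u]|%:R * h <= de) ->
  opnorm (coarse_poly f e - coarse_poly id e) <=
    Num.sqrt (card_letters ^+ 2 * (4 * (wb ^+ k * de))).
Proof.
move=> hde deS fib; have de0 : 0 <= de by exact: le_trans (ltW h0) hde.
have adj : is_adjoint (coarse_poly f e - coarse_poly id e)
    (coarse_poly f (reverse_rel e) - coarse_poly id (reverse_rel e)).
  by apply: is_adjointB; exact: adjoint_coarse_poly.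
apply: (opnorm_represented adj) => [|T ws wu wm].
  by rewrite mulr_ge0 // mulr_ge0 // mulr_ge0.
exists (coarse_sum (fun c => tr (x c)) b rho pw zw ws f e -
  coarse_sum (fun c => tr (x c)) b rho pw zw ws id e).
exists (coarse_sum (fun c => tr (x c)) b rho pw zw ws f (reverse_rel e) -
  coarse_sum (fun c => tr (x c)) b rho pw zw ws id (reverse_rel e)).
have bd e' := coarse_sum_diff wu b_ge0 rho_ge0 h0 B1 S1 (spread_sq h0 B1) mean_le
  (pop_weight_le xM xs K0 h0 B1 x_le sq_le) (pop_weight_sum xM xs K0 h0 B1 x_le sq_le)
  (reset_weight_le xM xs K0 x_le) (reset_weight_sum xM xs K0 x_le) I_le e' hde deS fib.
by split => //; apply: representsB; exact: represents_coarse.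
Qed.

End CoarseSums.
End Representation.

(** * Approximation by cells *)

Section Cells.
Context {R : realType}.
Local Notation leb := (@lebesgue_measure R).
Implicit Types (E F G : set R).

Lemma lebU2 E F : measurable E -> measurable F -> (leb (E `|` F) <= leb E + leb F)%E.
Proof. by move=> mE mF; exact: measureU2. Qed.

Lemma leb_le E F : measurable E -> measurable F -> E `<=` F -> (leb E <= leb F)%E.
Proof.
by move=> mE mF EF; apply: le_measure => //; rewrite inE; [exact: mE|exact: mF].
Qed.

Lemma lebD E F : measurable E -> measurable F -> (leb E < +oo)%E ->
  leb (E `\` F) = (leb E - leb (E `&` F))%E.
Proof. by move=> mE mF; exact: measureD. Qed.

Lemma lebU E F : measurable E -> measurable F -> E `&` F = set0 ->
  leb (E `|` F) = (leb E + leb F)%E.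
Proof. by move=> mE mF EF; rewrite measureU. Qed.

(** The family of intervals may be uncountable. Each point of the set is joined inside it to a
    rational on its right, so the set is a countable union of the intervals [J q] of points joined
    to [q]. *)
Lemma half_open_union_measurable E : half_open_union E -> measurable E.
Proof.
case=> F EF; pose J (q : rat) := [set x | forall y, (ratr q <= y <= x) || (x <= y <= ratr q) -> E y].
have Jm q : measurable (J q).
  apply: measurable_realfun.is_interval_measurable => x y Jx Jy z /andP[xz zy] w /orP[/andP[qw wz]|/andP[zw wq]].
    by apply: Jy; rewrite qw (le_trans wz).
  by apply: Jx; rewrite wq (le_trans xz) ?orbT.
suff -> : E = \bigcup_(q in setT) J q by apply: bigcupT_measurable_rat => q; exact: Jm.
apply/seteqP; split=> x.
  rewrite {1}EF => -[[a b] Fab]; rewrite /= in_itv /= => /andP[ax xb].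
  have [q] := rat_in_itvoo xb; rewrite in_itv /= => /andP[xq qb].
  exists q => // y /orP[/andP[qy yx]|/andP[xy yq]].
    by have := lt_le_trans xq (le_trans qy yx); rewrite ltxx.
  rewrite EF; exists (a, b) => //=; rewrite in_itv /= (le_trans ax) //=.
  exact: le_lt_trans yq qb.
case=> q _ Jx; apply: Jx; case: (leP (ratr q) x) => [qx|/ltW qx]; rewrite ?lexx ?qx ?orbT //.
Qed.

Lemma setY_measurable E F : measurable E -> measurable F -> measurable (E `+` F).
Proof. by move=> mE mF; apply: measurableU; exact: measurableD. Qed.

Lemma measure_setY_triangle E F G : measurable E -> measurable F -> measurable G ->
  (leb (E `+` G) <= leb (E `+` F) + leb (F `+` G))%E.
Proof.
move=> mE mF mG; apply: (@le_trans _ _ (leb ((E `+` F) `|` (F `+` G)))).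
  apply: leb_le; [exact: setY_measurable| |].
    by apply: measurableU; exact: setY_measurable.
  by move=> x /=; have [|] := pselect (F x); tauto.
by apply: lebU2; exact: setY_measurable.
Qed.

Lemma finite_subadditive (J : finType) (P : pred J) (B : J -> set R) :
  (forall j, measurable (B j)) ->
  (leb (\big[setU/set0]_(j | P j) B j) <= \sum_(j | P j) leb (B j))%E.
Proof.
move=> mB; suff [] : measurable (\big[setU/set0]_(j | P j) B j) /\
  (leb (\big[setU/set0]_(j | P j) B j) <= \sum_(j | P j) leb (B j))%E by [].
elim/big_rec2: _ => [|j y X Pj [mX le]]; first by rewrite measure0; split.
split; first exact: measurableU.
by apply: (@le_trans _ _ (leb (B j) + leb X)%E); [exact: lebU2|exact: leeD2l].
Qed.

Lemma bigsetU_in (J : finType) (B : J -> set R) j x : B j x -> (\big[setU/set0]_j B j) x.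
Proof. by move=> Bx; rewrite (bigD1 j) //=; left. Qed.

Lemma leb_cell a b : a <= b -> leb `[a, b[%classic = (b - a)%:E.
Proof.
move=> ab; rewrite lebesgue_measure_itv /= lte_fin.
by case: ltgtP ab => // -> _; rewrite subrr.
Qed.

Lemma bigcup_cells_measurable p (P : set 'I_p) (a b : 'I_p -> R) :
  measurable (\bigcup_(c in P) `[a c, b c[%classic).
Proof.
by apply: fin_bigcup_measurable => [|c _]; [exact: finite_finset|exact: measurable_itv].
Qed.

(** Any grid cell of side [1 / (n+1)] that meets this set lies inside [U]. *)
Definition deep (U : set R) (n : nat) : set R :=
  [set x | - n%:R <= x <= n%:R /\ forall y, `|x - y| < n.+1%:R^-1 -> U y].

Lemma deep_measurable U n : measurable (deep U n).
Proof.
have -> : deep U n = `[- n%:R, n%:R]%classic `&` ~` (\bigcup_(y in ~` U) ball y (n.+1%:R^-1 : R)).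
  apply/seteqP; split => x /=.
    case=> xn xU; split; first by rewrite in_itv.
    by case=> y Uy; rewrite /ball /= distrC => /xU.
  rewrite in_itv /= => -[xn nU]; split => // y xy.
  by apply: contrapT => Uy; apply: nU; exists y => //; rewrite /ball /= distrC.
apply: measurableI; first exact: measurable_itv.
apply: measurableC; apply: measurable_realfun.open_measurable; apply: bigcup_open => y _.
exact: ball_open.
Qed.

Lemma deep_nondecreasing U : nondecreasing_seq (deep U).
Proof.
move=> n m nm; apply/subsetPset => x [/andP[xn1 xn2] xU]; split.
  have nm' : (n%:R : R) <= m%:R by rewrite ler_nat.
  by apply/andP; split; lra.
move=> y xy; apply: xU; apply: lt_le_trans xy _.
by rewrite lef_pV2 ?posrE ?ler_nat.
Qed.

Lemma deep_cover U x : open U -> U x -> exists n, deep U n x.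
Proof.
move=> oU Ux; have /nbhs_ballP[r /= r0 rU] : nbhs x U by exact: open_nbhs_nbhs.
exists (maxn (Num.truncn `|x|).+1 (Num.truncn r^-1).+1).
set n := maxn _ _.
have h1 : `|x| <= n%:R.
  apply: le_trans (ltW (truncnS_gt _)) _; rewrite ler_nat; exact: leq_maxl.
have h2 : r^-1 <= n.+1%:R.
  by apply: le_trans (ltW (truncnS_gt _)) _; rewrite ler_nat leqW // leq_maxr.
split; first by rewrite -ler_norml.
move=> y xy; apply: rU; rewrite /ball /=; apply: lt_le_trans xy _.
by rewrite -[leRHS]invrK lef_pV2 ?posrE ?invr_gt0.
Qed.

Lemma deep_approximation (U F : set R) (e : R) : open U -> F `<=` U -> measurable F ->
  (leb F < +oo)%E -> 0 < e -> exists N, forall n, (N <= n)%N -> (leb (F `\` deep U n) < e%:E)%E.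
Proof.
move=> oU FU mF Foo e0.
pose K n := F `&` deep U n.
have mK n : measurable (K n) by apply: measurableI => //; exact: deep_measurable.
have Kinc : nondecreasing_seq K.
  move=> n m nm; apply/subsetPset => x [Fx dx]; split => //.
  by have /subsetPset := deep_nondecreasing U nm; apply.
have KF : \bigcup_n K n = F.
  apply/seteqP; split=> [x [n _ []] //|x Fx].
  by have [n dn] := deep_cover oU (FU x Fx); exists n.
have mF' : measurable (\bigcup_n K n) by rewrite KF.
have cv := nondecreasing_cvg_mu (mu := @lebesgue_measure R) mK mF' Kinc; rewrite KF in cv.
have fF : leb F \is a fin_num by rewrite ge0_fin_numE.
have lt : (leb F - e%:E < leb F)%E by rewrite lteBlDr // lteDl // lte_fin.
have [N _ NP] : \forall n \near \oo, (leb F - e%:E < leb (K n))%E.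
  have := cv; move=> /(_ [set y | (leb F - e%:E < y)%E]); apply.
  apply: open_nbhs_nbhs; split => //.
  exact: open_ereal_gt_ereal.
exists N => n Nn; have := NP n Nn => /= h.
have -> : F `\` deep U n = F `\` K n.
  by rewrite /K setDIr setDv set0U.
rewrite lebD //.
rewrite (_ : F `&` K n = K n); last by rewrite /K setIA setIid.
have fK : leb (K n) \is a fin_num.
  rewrite ge0_fin_numE //; apply: le_lt_trans Foo.
  by apply: leb_le => // x [].
by rewrite lteBlDr // addeC -lteBlDr.
Qed.

(** Each [F j] is enclosed in an open set with little excess. The cells of a fine grid that meet the
    deep part of [F j] stay in that open set, and disjointness of the [F j] controls the cells
    claimed by several of them. *)
Lemma cell_approximation L (F : 'I_L -> set R) (eps : R) :
  (forall j, measurable (F j)) -> (forall j, (leb (F j) < +oo)%E) ->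
  (forall i j x, F i x -> F j x -> i = j) -> 0 < eps ->
  exists p (a : 'I_p -> R) (h : R) (kap : 'I_p -> 'I_L),
    [/\ 0 < h, h <= eps, disjoint_intervals a (fun c => a c + h) &
     forall j, (leb (F j `+` \bigcup_(c in [set c | kap c = j]) `[a c, (a c + h)%R[%classic)
        < eps%:E)%E].
Proof.
move=> mF Foo dF eps0.
(* The error of one fiber consists of at most [L] outer excesses and one inner loss, and
   [(L + 1) e0 < eps]. *)
pose e0 := eps / L.+2%:R.
have e00 : 0 < e0 by rewrite divr_gt0.
have /choice[U UP] : forall j, exists U : set R,
    [/\ open U, F j `<=` U & (leb (U `\` F j) < e0%:E)%E].
  by move=> j; exact: (lebesgue_regularity_outer (mF j) (Foo j) e00).
have oU j : open (U j) by have [] := UP j.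
have FU j : F j `<=` U j by have [] := UP j.
have Ue j : (leb (U j `\` F j) < e0%:E)%E by have [] := UP j.
have mU j : measurable (U j) by exact: measurable_realfun.open_measurable.
have /choice[N0 N0P] : forall j, exists N, forall n, (N <= n)%N ->
    (leb (F j `\` deep (U j) n) < e0%:E)%E.
  by move=> j; exact: deep_approximation.
pose n := maxn (\max_j N0 j) (Num.truncn eps^-1).+1.
pose h : R := n.+1%:R^-1.
have h0 : 0 < h by rewrite invr_gt0.
have he : h <= eps.
  rewrite -[eps]invrK lef_pV2 ?posrE ?invr_gt0 //.
  by apply: le_trans (ltW (truncnS_gt _)) _; rewrite ler_nat leqW // leq_maxr.
have nN j : (N0 j <= n)%N by rewrite leq_max leq_bigmax.
pose K j := F j `&` deep (U j) n.
pose P := (n.+1 * (2 * n.+1))%N.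
pose g (c : nat) : R := - n.+1%:R + c%:R * h.
pose C c : set R := `[g c, g c + h[%classic.
have gS c : g c + h = g c.+1 by rewrite /g -addrA -(natr1 c) mulrDl mul1r.
have gle c d : (c <= d)%N -> g c <= g d.
  by move=> cd; rewrite /g lerD2l ler_wpM2r ?(ltW h0) // ler_nat.
have C_inj c d x : C c x -> C d x -> c = d.
  wlog cd : c d / (c <= d)%N => [wl|].
    by case: (leqP c d) => [|/ltnW] cd Cc Cd; [exact: wl|apply/esym; exact: wl].
  rewrite /C /= !in_itv /= => /andP[c1 c2] /andP[d1 d2].
  move: cd; rewrite leq_eqVlt => /orP[/eqP //|cd].
  have := lt_le_trans c2 _; rewrite gS => /(_ _ (gle _ _ cd)) x1.
  by have := lt_le_trans x1 d1; rewrite ltxx.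
have C_cover (x : R) : - n%:R <= x <= n%:R -> exists2 c, (c < P)%N & C c x.
  move=> /andP[x1 x2]; have n1 : (0 : R) < n.+1%:R by [].
  pose y := (x + n.+1%:R) * n.+1%:R.
  have y0 : 0 <= y by rewrite mulr_ge0 // -natr1; lra.
  have /andP[y1 y2] := truncn_itv y0.
  exists (Num.truncn y).
    rewrite truncn_lt_nat // /y /P natrM mulrC ltr_pM2l // natrM -[n.+1%:R]natr1; lra.
  have yh z : z * h <= y * h -> z * h <= x + n.+1%:R by rewrite /y /h mulfK // gt_eqF.
  rewrite /C /= in_itv /= gS /g; apply/andP; split.
    rewrite addrC lerBlDr; apply: yh; by rewrite ler_wpM2r // ltW.
  rewrite addrC ltrBrDr (_ : x + n.+1%:R = y * h); first by rewrite ltr_pM2r.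
  by rewrite /y /h mulfK // gt_eqF.
have C_near c x y : C c x -> C c y -> `|x - y| < h.
  rewrite /C /= !in_itv /= => /andP[c1 c2] /andP[d1 d2].
  by rewrite ltr_norml; apply/andP; split; lra.
(* A cell is kept if it meets some [K j]; among the labels that qualify, [kap] picks one. *)
pose hit (c : 'I_P) (j : 'I_L) := `[< exists x, K j x /\ C c x >].
pose D := [set c : 'I_P | [exists j, hit c j]]%SET.
have /choice[kap kapP] : forall i : 'I_#|D|, exists j, hit (enum_val i) j.
  by move=> i; have := enum_valP i; rewrite inE => /existsP.
exists #|D|, (fun i : 'I_#|D| => g (val (enum_val i))), h, kap; split => //.
  split=> [i|]; first by rewrite ltrDl.
  move=> i j _ _ [x [xi xj]]; apply: enum_val_inj; apply: val_inj.
  exact: (C_inj _ _ x).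
move=> j; set A := \bigcup_(c in _) _.
have mA : measurable A by exact: bigcup_cells_measurable.
have near_in l c x y : hit c l -> C c x -> C c y -> deep (U l) n x -> U l y.
  by move=> _ Cx Cy [_]; apply; exact: C_near Cx Cy.
apply: (@le_lt_trans _ _ (leb ((F j `\` deep (U j) n) `|`
    \big[setU/set0]_l (U l `\` F l)))).
  apply: leb_le.
  - exact: setY_measurable.
  - apply: measurableU; first by apply: measurableD => //; exact: deep_measurable.
    by apply: bigsetU_measurable => l _; exact: measurableD.
  move=> x [[Fx nA]|[[i /= ki Ci] nF]].
    have [dx|ndx] := pselect (deep (U j) n x); last by left.
    right; have [c cP Cx] := C_cover x dx.1.
    have hcj : hit (Ordinal cP) j by apply/asboolP; exists x.
    have cD : Ordinal cP \in D by rewrite inE; apply/existsP; exists j.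
    pose i := enum_rank_in cD (Ordinal cP).
    have iE : enum_val i = Ordinal cP by rewrite enum_rankK_in.
    have [kij|kij] := eqVneq (kap i) j.
      by exfalso; apply: nA; exists i => //; rewrite /= iE.
    apply: (bigsetU_in (j := kap i)); split.
      have /asboolP[y [[_ dy] Cy]] := kapP i.
      have Cx' : C (enum_val i) x by rewrite iE.
      exact: (near_in _ (enum_val i) y x (kapP i)).
    by move=> Fkx; move/eqP: kij; apply; exact: dF Fkx Fx.
  right; apply: (bigsetU_in (j := j)); split => //.
  have := kapP i; rewrite ki => hij; have /asboolP[y [[_ dy] Cy]] := hij.
  exact: (near_in _ (enum_val i) y x hij).
apply: (@le_lt_trans _ _ (e0%:E + \sum_(l < L) e0%:E)%E).
  apply: (@le_trans _ _ (leb (F j `\` deep (U j) n) + leb (\big[setU/set0]_l (U l `\` F l)))%E).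
    apply: lebU2; first by apply: measurableD => //; exact: deep_measurable.
    by apply: bigsetU_measurable => l _; exact: measurableD.
  apply: leeD; first by rewrite ltW // N0P.
  apply: (le_trans (finite_subadditive _ _)) => [l|]; first exact: measurableD.
  by apply: lee_sum => l _; rewrite ltW.
rewrite sumEFin -EFinD lte_fin sumr_const card_ord -mulrS -[_ *+ L.+1]mulr_natr /e0.
by rewrite mulrAC ltr_pdivrMr // ltr_pM2l // ltr_nat.
Qed.

End Cells.

(** * The uniform division of a set of finite measure *)

Section Pieces.
Context {R : realType} (E : set R).
Local Notation leb := (@lebesgue_measure R).
Hypotheses (mE : measurable E) (Eoo : (leb E < +oo)%E).

Let s := fine (leb E).
Let G (x : R) := fine (leb (E `&` `]-oo, x[%classic)).

Let mG x : measurable (E `&` `]-oo, x[%classic).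
Proof. by apply: measurableI => //; exact: measurable_itv. Qed.

Let finite_sub F : measurable F -> F `<=` E -> leb F \is a fin_num.
Proof.
move=> mF FE; rewrite ge0_fin_numE //.
by apply: le_lt_trans Eoo; exact: leb_le.
Qed.

Let GE x : leb (E `&` `]-oo, x[%classic) = (G x)%:E.
Proof. by rewrite fineK // finite_sub // => y []. Qed.

Let sE : leb E = s%:E.
Proof. by rewrite fineK // finite_sub. Qed.

Let s_ge0 : 0 <= s.
Proof. by rewrite fine_ge0. Qed.

Let G_mono x y : x <= y -> G x <= G y.
Proof.
move=> xy; rewrite -lee_fin -!GE; apply: leb_le => // z [Ez]; rewrite /= !in_itv /= => zx.
by split => //; exact: lt_le_trans zx xy.
Qed.

Let G_diff x y : x <= y -> leb (E `&` `[x, y[%classic) = (G y - G x)%:E.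
Proof.
move=> xy; rewrite EFinB -!GE.
rewrite [X in _ = (leb X - _)%E](_ : _ = (E `&` `]-oo, x[%classic) `|` (E `&` `[x, y[%classic)).
  rewrite lebU //.
  - by rewrite addeAC subee ?add0e // finite_sub // => z [].
  - by apply: measurableI => //; exact: measurable_itv.
  - apply/seteqP; split=> // z [[_ +] [_ +]]; rewrite /= !in_itv /= => zx /andP[xz _].
    by have := lt_le_trans zx xz; rewrite ltxx.
apply/seteqP; split=> z.
  move=> [Ez]; rewrite /= in_itv /= => zy; case: (ltP z x) => zx; [left|right]; split => //=.
  by rewrite in_itv /= zx.
move=> [[Ez]|[Ez]]; rewrite /= in_itv /= => hz; split => //=; rewrite in_itv /=.
  exact: lt_le_trans hz xy.
by case/andP: hz.
Qed.

(** A compact subset of the level set with extreme points [x] and [y] lies in [E] between them, up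
    to the point [y]. There the mass is [G y - G x <= c2 - c1], and inner regularity concludes. *)
Let G_level (c1 c2 : R) : c1 <= c2 ->
  (leb (E `&` [set x | (c1 <= G x < c2)%R]) <= (c2 - c1)%:E)%E.
Proof.
move=> c12; set D := E `&` _.
have mD : measurable D.
  apply: measurableI => //; apply: measurable_realfun.is_interval_measurable.
  move=> x y /= /andP[x1 x2] /andP[y1 y2] z /andP[xz zy].
  by rewrite (le_trans x1 (G_mono xz)) (le_lt_trans (G_mono zy) y2).
have Doo : (leb D < +oo)%E by apply: le_lt_trans Eoo; apply: leb_le => // x [].
apply/lee_addgt0Pr => e e0.
have [K [cK KD Ke]] := lebesgue_regularity_inner mD Doo e0.
have mK : measurable K by exact: measurable_realfun.compact_measurable.
have DK : (leb D <= leb K + leb (D `\` K))%E.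
  apply: (@le_trans _ _ (leb (K `|` (D `\` K)))).
    apply: leb_le => //; first by apply: measurableU => //; exact: measurableD.
    by move=> x Dx; have [|] := pselect (K x); [left|right].
  by apply: lebU2 => //; exact: measurableD.
apply: (le_trans DK); apply: leeD; last exact: ltW.
have [K0|/set0P Kn0] := eqVneq K set0; first by rewrite K0 measure0 lee_fin subr_ge0.
have cid : {within K, continuous (@idfun R)} by apply: continuous_subspaceT => x; exact: cvg_id.
have [y /set_mem Ky ymax] := compact_EVT_max Kn0 cK cid.
have [x /set_mem Kx xmin] := compact_EVT_min Kn0 cK cid.
have [_ /= /andP[x1 x2]] := KD x Kx.
have [_ /= /andP[y1 y2]] := KD y Ky.
have xy : x <= y by apply: xmin; exact: mem_set.
apply: (@le_trans _ _ (leb ((E `&` `[x, y[%classic) `|` [set y]))).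
  apply: leb_le => //.
    apply: measurableU; last exact: measurable_set1.
    by apply: measurableI => //; exact: measurable_itv.
  move=> z Kz; have zK := mem_set Kz.
  have := ymax z zK; rewrite /= le_eqVlt => /orP[/eqP ->|zy]; first by right.
  left; split; first by have [] := KD z Kz.
  by rewrite /= in_itv /= zy andbT; exact: xmin.
apply: le_trans (lebU2 _ _) _.
- by apply: measurableI => //; exact: measurable_itv.
- exact: measurable_set1.
rewrite G_diff // lebesgue_measure_set1 adde0 lee_fin.
by rewrite lerB // ltW.
Qed.

Lemma piece_measurable N i : measurable (piece E N i).
Proof.
apply: measurableI => //; apply: measurable_realfun.is_interval_measurable.
move=> x y /= /andP[x1 x2] /andP[y1 y2] z /andP[xz zy].
by rewrite (le_trans x1 (G_mono xz)) (le_lt_trans (G_mono zy) y2).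
Qed.

Lemma piece_le N i : (0 < N)%N -> (leb (piece E N i) <= (s / N%:R)%:E)%E.
Proof.
move=> N0; have N0' : (0 : R) < N%:R by rewrite ltr0n.
have le12 : i%:R * s / N%:R <= i.+1%:R * s / N%:R.
  by rewrite ler_pM2r ?invr_gt0 // ler_wpM2r // ler_nat.
apply: le_trans (G_level le12) _; rewrite lee_fin le_eqVlt; apply/orP; left; apply/eqP.
by rewrite -natr1; ring.
Qed.

Lemma piece_finite N i : (leb (piece E N i) < +oo)%E.
Proof. by apply: le_lt_trans Eoo; apply: leb_le => // [|x []//]; exact: piece_measurable. Qed.

Lemma piece_disjoint N i j x : (0 < N)%N -> piece E N i x -> piece E N j x -> i = j.
Proof.
move=> N0 [Ex /andP[i1 i2]] [_ /andP[j1 j2]].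
have N0' : (0 : R) < N%:R by rewrite ltr0n.
have aux a b : (a < b)%N -> G x < a.+1%:R * s / N%:R -> b%:R * s / N%:R <= G x -> False.
  move=> ab ga gb; have := lt_le_trans (le_lt_trans gb ga) _.
  move=> /(_ (b%:R * s / N%:R)); rewrite ltxx => h; have /h // : a.+1%:R * s / N%:R <= b%:R * s / N%:R.
  by rewrite ler_pM2r ?invr_gt0 // ler_wpM2r // ler_nat.
case: (ltngtP i j) => // ij; exfalso; [exact: aux ij i2 j1|exact: aux ij j2 i1].
Qed.

Lemma piece_refine N m i : (0 < N)%N -> (0 < m)%N -> (i < N)%N ->
  piece E N i = \bigcup_(j in [set j : 'I_(N * m) | (j %/ m)%N = i]) piece E (N * m) j.
Proof.
move=> N0 m0 iN; have N0' : (0 : R) < N%:R by rewrite ltr0n.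
have m0' : (0 : R) < m%:R by rewrite ltr0n.
have Nm0 : (0 : R) < (N * m)%:R by rewrite ltr0n muln_gt0 N0.
have scale a : a%:R * s / N%:R = (a * m)%:R * s / (N * m)%:R.
  by rewrite !natrM; field; rewrite !gt_eqF.
have mono a b : (a <= b)%N -> a%:R * s / (N * m)%:R <= b%:R * s / (N * m)%:R.
  by move=> ab; rewrite ler_pM2r ?invr_gt0 // ler_wpM2r // ler_nat.
apply/seteqP; split=> x.
  move=> [Ex /andP[x1 x2]].
  have s0 : 0 < s.
    rewrite lt_neqAle s_ge0 andbT; apply/eqP => s00; move: x1 x2.
    by rewrite -/s -s00 !mulr0 !mul0r => /le_lt_trans h /h; rewrite ltxx.
  (* On this scale the fine pieces are the unit steps, so the integer part of [g] is the index of
     the fine piece. *)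
  pose g := G x * (N * m)%:R / s.
  have gG : G x = g * s / (N * m)%:R by rewrite /g; field; rewrite !gt_eqF.
  have g0 : 0 <= g.
    by rewrite /g divr_ge0 // mulr_ge0 ?(ltW Nm0) // fine_ge0.
  have cmp1 a : (a%:R * s / (N * m)%:R <= G x) = (a%:R <= g).
    by rewrite gG ler_pM2r ?invr_gt0 // ler_pM2r.
  have cmp2 a : (G x < a%:R * s / (N * m)%:R) = (g < a%:R).
    by rewrite gG ltr_pM2r ?invr_gt0 // ltr_pM2r.
  move: x1 x2; rewrite -/s -/(G x) !scale cmp1 cmp2 => x1 x2.
  have /andP[t1 t2] := truncn_itv g0.
  have tlt : (Num.truncn g < N * m)%N.
    rewrite truncn_lt_nat //; apply: lt_le_trans x2 _.
    by rewrite ler_nat leq_mul2r iN orbT.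
  exists (Ordinal tlt).
    have h1 : (i * m <= Num.truncn g)%N by rewrite truncn_ge_nat.
    have h2 : (Num.truncn g < i.+1 * m)%N by rewrite truncn_lt_nat.
    rewrite /=; apply/eqP; rewrite eqn_leq -ltnS ltn_divLR // h2 /=.
    by rewrite leq_divRL.
  by split => //; rewrite -/s -/(G x) cmp1 cmp2 t1 t2.
case=> j /= ji [Ex /andP[x1 x2]]; split => //; rewrite !scale.
apply/andP; split.
  apply: le_trans x1; apply: mono; rewrite -ji; exact: leq_trunc_div.
apply: lt_le_trans x2 _; apply: mono; rewrite -ji.
by rewrite -ltn_divLR.
Qed.

End Pieces.

(** * Stationary processes with free increments *)

Section Laws.
Context {R : realType}.
Local Notation law := (probability (measurableTypeR R) R).

Lemma compactly_supported_integrable (nu : law) (f : R -> R) : compactly_supported nu ->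
  continuous f -> nu.-integrable setT (EFin \o f).
Proof.
move=> [K cK K0] fc.
have mf : measurable_fun setT f by exact: measurable_realfun.continuous_measurable_fun.
have mK : measurable K by exact: measurable_realfun.compact_measurable.
apply/(@negligible_integrable _ _ _ nu setT (~` K)) => //.
- exact: measurableC.
- exact/measurable_realfun.measurable_EFinP.
rewrite setTD setCK; apply: measurable_bounded_integrable => //.
- by apply: le_lt_trans (probability_le1 nu mK) _; rewrite ltry.
- exact: measurable_funTS.
have /compact_bounded : compact (f @` K).
  by apply: continuous_compact => //; exact: continuous_subspaceT.
rewrite /= => -[M0 [M0r bM]]; exists M0; split=> // y My x Kx.
by apply: bM => //; exists x.
Qed.

(** Integrate [min(|m|,1) <= min(|x|,1) + |x - m|] with [|x - m| <= 1/8 + 2 (x - m)^2], the latter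
    being [(4 |x - m| - 1)^2 >= 0]. *)
Lemma mean_le_truncated (nu : law) : compactly_supported nu ->
  Num.min `|\int[nu]_x (x ^+ 1)| 1 <= \int[nu]_x (Num.min `|x| 1) + 8^-1 +
    2 * (\int[nu]_x (x ^+ 2) - (\int[nu]_x (x ^+ 1)) ^+ 2).
Proof.
move=> cs; set m := \int[nu]_x (x ^+ 1).
have fc (f : R -> R) : continuous f -> nu.-integrable setT (EFin \o f).
  exact: compactly_supported_integrable.
have cX n : continuous (fun x : R => x ^+ n) by move=> x; exact: exprn_continuous.
have cmin : continuous (fun x : R => Num.min `|x| 1).
  by move=> x; apply: continuous_min; [exact: norm_continuous | exact: cst_continuous].
have ccst (c : R) : continuous (fun x : R => c) by move=> x; exact: cst_continuous.
have cZ (c : R) n : continuous (fun x : R => c * x ^+ n).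
  by move=> x; apply: cvgM; [exact: cvg_cst | exact: cX].
pose g (x : R) : R := Num.min `|x| 1 + (8^-1 + 2 * m ^+ 2) + (2 * x ^+ 2 - 4 * m * x ^+ 1).
have le_g x : Num.min `|m| 1 <= g x.
  have h : Num.min `|m| 1 <= Num.min `|x| 1 + `|x - m|.
    have := ler_normD x (m - x); rewrite addrC subrK (distrC m x) => tri.
    have d0 := normr_ge0 (x - m).
    by rewrite /Num.min; do 2 case: ifP => ?; lra.
  apply: le_trans h _; rewrite /g expr1.
  have := sqr_ge0 (4 * `|x - m| - 1); have := real_normK (num_real (x - m)).
  set d := `|x - m| => dE ?.
  have : d <= 8^-1 + 2 * d ^+ 2 by nra.
  rewrite dE; nra.
have c1 : continuous (fun x : R => Num.min `|x| 1 + (8^-1 + 2 * m ^+ 2)).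
  by move=> x; apply: cvgD; [exact: cmin | exact: ccst].
have c2 : continuous (fun x : R => 2 * x ^+ 2 - 4 * m * x ^+ 1).
  by move=> x; apply: cvgB; exact: cZ.
have -> : \int[nu]_x (Num.min `|x| 1) + 8^-1 + 2 * (\int[nu]_x (x ^+ 2) - m ^+ 2) =
          \int[nu]_x g x.
  rewrite /g RintegralD //; [|exact: fc|exact: fc].
  rewrite RintegralD //; [|exact: fc|exact: fc].
  rewrite RintegralB //; [|exact: fc|exact: fc].
  rewrite !RintegralZl //; [|exact: fc|exact: fc].
  rewrite (Rintegral_cst nu) // (_ : fine (nu setT) = 1); last by rewrite probability_setT.
  by rewrite -/m; ring.
rewrite -[leLHS](_ : \int[nu]_x (Num.min `|m| 1) = _).
  apply: le_Rintegral => //; [exact/fc/ccst|].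
  by apply: fc => x; apply: cvgD; [exact: c1 | exact: c2].
by rewrite (Rintegral_cst nu) // (_ : fine (nu setT) = 1) ?mulr1 // probability_setT.
Qed.

(** Weak continuity tests bounded functions only, and the mean is not one. The truncated first
    moment tends to 0 and the variance is [O(t)], so [mean_le_truncated] makes [min(|m|,1) < 1] for
    small [t]. *)
Lemma mean_bounded_near0 (mu : law) (mu_ : R -> law) (v : R) :
  is_free_conv_semigroup mu mu_ -> (forall t : R, 0 < t -> compactly_supported (mu_ t)) ->
  (forall t : R, 0 < t -> \int[mu_ t]_x (x ^+ 2) - (\int[mu_ t]_x (x ^+ 1)) ^+ 2 <= t * v) ->
  exists2 d : R, 0 < d & forall t : R, 0 < t < d -> `|\int[mu_ t]_x (x ^+ 1)| <= 1.
Proof.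
move=> [_ mu0 _ wk] cs vle.
have cmin : continuous (fun x : R => Num.min `|x| 1).
  by move=> x; apply: continuous_min; [exact: norm_continuous | exact: cst_continuous].
have bmin : exists C : R, forall x : R, `|Num.min `|x| 1| <= C.
  exists 1 => x; rewrite ger0_norm; first by rewrite ge_min lexx orbT.
  by rewrite le_min normr_ge0 ler01.
have := wk _ cmin bmin; move/continuous_within_itvcyP => [_].
have -> : \int[mu_ 0]_x Num.min `|x| 1 = 0.
  rewrite /Rintegral (@eq_measure_integral _ _ _ _ (@dirac _ _ (0 : measurableTypeR R) R)); last first.
    by move=> B mB _; exact: mu0.
  rewrite integral_dirac //; last first.
    apply/measurable_realfun.measurable_EFinP.
    exact: measurable_realfun.continuous_measurable_fun.
  by rewrite /= normr0 /Num.min ltr01 mulr0.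
move=> /cvgrPdist_lt /(_ 8^-1 ltac:(by lra)) [d /= d0 dP].
have v0 : 0 < 16 * (`|v| + 1) by rewrite mulr_gt0 // ltr_wpDl.
exists (Num.min d (16 * (`|v| + 1))^-1); first by rewrite lt_min d0 invr_gt0.
move=> t /andP[t0]; rewrite lt_min => /andP[td tv].
have := dP t; rewrite /ball_ /= sub0r normrN (gtr0_norm t0) => /(_ td t0).
rewrite sub0r normrN => /(le_lt_trans (ler_norm _)) small.
have := mean_le_truncated (cs _ t0); have := vle _ t0.
set m := \int[mu_ t]_x (x ^+ 1); set a := \int[mu_ t]_x Num.min `|x| 1 in small *.
set q := \int[mu_ t]_x (x ^+ 2) - _ => qle h.
have tv16 : t * v <= 16^-1.
  have : t * (16 * (`|v| + 1)) < 1 by rewrite -ltr_pdivlMr // mul1r.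
  have := ler_norm v; nra.
have : Num.min `|m| 1 < 1 by lra.
by rewrite gt_min ltxx orbF => /ltW.
Qed.
End Laws.

(** The difference [k] from the linear function is additive, vanishes at positive integers and is
    bounded on [(0, 1]], hence bounded everywhere. Applied to all multiples of [t] this forces
    [k t = 0]. *)
Lemma bounded_additive_linear (R : realType) (g : R -> R) (d C : R) : 0 < d ->
  (forall s t, 0 < s -> 0 < t -> g (s + t) = g s + g t) ->
  (forall t, 0 < t < d -> `|g t| <= C) -> forall t, 0 < t -> g t = t * g 1.
Proof.
move=> d0 gD gC t t0; pose k (s : R) := g s - s * g 1.
have kD s u : 0 < s -> 0 < u -> k (s + u) = k s + k u.
  by move=> s0 u0; rewrite /k gD //; ring.
have kM n s : 0 < s -> k (n.+1%:R * s) = n.+1%:R * k s.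
  move=> s0; elim: n => [|n IH]; first by rewrite !mul1r.
  rewrite -natr1 mulrDl mul1r kD ?IH ?mulr_gt0 ?ltr0n //; first by ring.
have k1 : k 1 = 0 by rewrite /k mul1r subrr.
pose N := Num.truncn d^-1.
have N0 : (0 : R) < N.+1%:R by rewrite ltr0n.
have Nd : N.+1%:R^-1 < d.
  by rewrite -(invrK d) ltf_pV2 ?posrE ?invr_gt0 // truncnS_gt.
pose D := N.+1%:R * (C + `|g 1|).
have kr r : 0 < r <= 1 -> `|k r| <= D.
  move=> /andP[r0 r1]; have rN0 : 0 < r / N.+1%:R by rewrite divr_gt0.
  have -> : k r = N.+1%:R * k (r / N.+1%:R) by rewrite -kM // mulrC divfK ?gt_eqF.
  rewrite normrM (gtr0_norm N0) ler_pM2l //.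
  have rN : r / N.+1%:R <= N.+1%:R^-1 by rewrite ler_piMl // invr_ge0 ltW.
  have N1 : N.+1%:R^-1 <= (1 : R) by rewrite invf_le1 // ler1n.
  apply: (le_trans (ler_normB _ _)); apply: lerD.
    by apply: gC; rewrite rN0 (le_lt_trans rN).
  by rewrite normrM ler_piMl // gtr0_norm // (le_trans rN).
have D0 : 0 <= D by apply: le_trans (kr 1 _); rewrite ?ltr01 ?lexx.
have bnd n : n.+1%:R * `|k t| <= D.
  have n0 : (0 : R) < n.+1%:R by rewrite ltr0n.
  rewrite -[n.+1%:R]gtr0_norm // -normrM -kM //.
  have s0 : 0 < n.+1%:R * t by rewrite mulr_gt0.
  set s := n.+1%:R * t in s0 *.
  have /andP[qs sq] := truncn_itv (ltW s0); set q := Num.truncn s in qs sq.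
  have kq m : (0 < m)%N -> k m%:R = 0.
    by case: m => // m _; rewrite -[m.+1%:R]mulr1 kM // k1 mulr0.
  have [rE|r0] := eqVneq (s - q%:R) 0.
    have /eqP := rE; rewrite subr_eq0 => /eqP sE.
    have q0 : (0 < q)%N by move: s0; rewrite sE ltr0n.
    by rewrite sE kq // normr0.
  have rr : 0 < s - q%:R <= 1.
    rewrite lt_def r0 subr_ge0 qs /= lerBlDl.
    by rewrite natr1 ltW.
  have [q0|q0] := posnP q.
    by move: rr; rewrite q0 subr0 => /kr.
  have /andP[r1 _] := rr.
  have -> : s = q%:R + (s - q%:R) by ring.
  by rewrite kD ?ltr0n // kq // add0r; exact: kr.
suff k0 : k t = 0 by apply/eqP; rewrite -subr_eq0; apply/eqP.
apply/eqP; rewrite -normr_le0 leNgt; apply/negP => kt.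
have := bnd (Num.truncn (D / `|k t|)); apply/negP; rewrite -ltNge.
by rewrite -ltr_pdivrMr // truncnS_gt.
Qed.

Section FreePair.
Context {R : realType} (A : tracial_space R) (I : eqType).
Local Notation M := (@ts_alg R A).
Local Notation star T := (smallest star_subalgebra [set T]).
Variable x : I -> ts_op A.
Hypotheses (xM : forall i, M (x i)) (xs : forall i, selfadjoint (x i)).
Hypothesis x_free : freely_independent x.

Lemma alg_adjoint (S T : ts_op A) : M S -> is_adjoint S T -> M T.
Proof.
move=> MS ST; have [/(_ _ MS)[U MU SU] _] := ts_vN A.
suff -> : T = U by [].
by apply: bop_ext => v; apply: rdot_inj => z; rewrite !(rdotC _ z) /rdot -ST -SU.
Qed.

Lemma star_gen (T : ts_op A) : star T T.
Proof. by move=> B [_ /(_ T)]; apply. Qed.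

Lemma star_closed (T : ts_op A) : star_subalgebra (star T).
Proof.
split.
- by move=> B [[B1 _ _ _] _].
- by move=> a S U hS hU B BT; have [[_ + _ _] _] := BT; apply; [exact: hS | exact: hU].
- by move=> S U hS hU B BT; have [[_ _ + _] _] := BT; apply; [exact: hS | exact: hU].
- by move=> S U hS SU B BT; have [[_ _ _ h] _] := BT; exact: (h _ _ (hS _ BT) SU).
Qed.

Lemma star_alg (T : ts_op A) : M T -> star T `<=` M.
Proof.
move=> MT S; apply; split; last by move=> _ ->.
split; [exact: alg1 | | exact: algM | exact: alg_adjoint].
by move=> a S1 S2 h1 h2; apply: algD => //; exact: algZ.
Qed.

Lemma phi_free i j a b : i != j -> star (x i) a -> star (x j) b ->
  ts_trace (a * b) = ts_trace a * ts_trace b.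
Proof.
move=> ij sa sb; have Ma := star_alg (xM i) sa; have Mb := star_alg (xM j) sb.
pose cen (y : ts_op A) : ts_op A := (- ts_trace y) *: (1 : ts_op A) + y.
have cenS k y : star (x k) y -> star (x k) (cen y).
  by move=> sy; have [s1 sl _ _] := star_closed (x k); exact: sl.
have cen0 y : M y -> ts_trace (cen y) = 0.
  by move=> My; rewrite phi_linear ?phi1 ?mulr1 ?addNr //; exact: alg1.
have := x_free (s := [:: (i, cen a); (j, cen b)]) isT.
rewrite /= ij !big_cons big_nil mulr1 /=.
have h p : p \in [:: (i, cen a); (j, cen b)] -> star (x p.1) p.2 /\ ts_trace p.2 = 0.
  by rewrite !inE => /orP[]/eqP-> /=; split; [exact: cenS | exact: cen0 | exact: cenS | exact: cen0].
move=> /(_ isT h).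
have -> : cen a * cen b = (- ts_trace a) *: cen b + ((- ts_trace b) *: a + a * b).
  rewrite {1}/cen mulrDl bop_scaleAl mul1r; congr (_ + _).
  by rewrite /cen mulrDr bop_scaleAr mulr1.
have Mc : M (cen b) by apply: algD => //; apply: algZ; exact: alg1.
have Mab : M (a * b) by exact: algM.
have Mba : M ((- ts_trace b) *: a + a * b) by apply: algD => //; exact: algZ.
rewrite phi_linear // cen0 // mulr0 add0r phi_linear // => /eqP.
by rewrite mulNr addrC subr_eq0 mulrC => /eqP.
Qed.

Lemma tr_free i j a b : i != j -> star (x i) a -> star (x j) b ->
  selfadjoint a -> selfadjoint b -> tr (a * b) = tr a * tr b.
Proof.
move=> ij sa sb aa bb; rewrite {1}/tr (phi_free ij sa sb).
rewrite (phi_real (star_alg (xM i) sa) aa) (phi_real (star_alg (xM j) sb) bb).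
by rewrite -rmorphM.
Qed.

Lemma tr_conj_free i j a y : i != j -> star (x i) y -> selfadjoint y -> star (x j) a ->
  selfadjoint a -> tr (y * a * y) = tr a * tr (y ^+ 2).
Proof.
move=> ij sy yy sa aa; have My := star_alg (xM i) sy; have Ma := star_alg (xM j) sa.
have [_ _ syM _] := star_closed (x i).
have -> : tr (y * a * y) = tr (y ^+ 2 * a).
  by rewrite /tr phi_trace; [rewrite mulrA | exact: algM|].
rewrite (mulrC (tr a)); apply: (@tr_free i j) => //; last exact: selfadjointX.
exact: syM.
Qed.

Lemma tr_conj_bound (y W : ts_op A) (C : R) : M y -> selfadjoint y -> M W -> selfadjoint W ->
  0 <= C -> opnorm W <= C -> `|tr (y * W * y)| <= C * tr (y ^+ 2).
Proof.
move=> My yy MW WW C0 WC.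
have conj_sa (U : ts_op A) : selfadjoint U -> selfadjoint (y * U * y).
  by move=> UU; have := is_adjointM (is_adjointM yy UU) yy; rewrite mulrA.
have b v : `|rdot ((y * W * y) v) v| <= C * rdot ((y ^+ 2) v) v.
  have -> : rdot ((y * W * y) v) v = rdot (W (y v)) (y v) by exact: (selfadjointE (W (y v)) v yy).
  have -> : rdot ((y ^+ 2) v) v = nrm (y v) ^+ 2 by exact: selfadjoint_sq.
  apply: (le_trans (rdot_abs _ _)); rewrite expr2 mulrA ler_wpM2r ?nrm_ge0 //.
  by apply: (le_trans (nrm_opnorm _ _)); rewrite ler_wpM2r ?nrm_ge0.
have Myw : M (y * W * y) by apply: algM => //; exact: algM.
have My2 := algX 2 My; have yy2 := selfadjointX 2 yy.
rewrite ler_norml -mulNr -!trZ //; apply/andP; split.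
  apply: tr_le => //; [exact: algZ | exact: selfadjointZ| exact: conj_sa |] => v.
  by have := b v; rewrite ler_norml rdotZl mulNr => /andP[].
apply: tr_le => //; [exact: algZ | exact: conj_sa | exact: selfadjointZ|] => v.
by have := b v; rewrite ler_norml rdotZl => /andP[].
Qed.

(* The bound on tr (y x_i y) is used at y = x_i^p (x_i +/- K); with P = K - x_i
   and Q = K + x_i the sum of the two is 2 K P Q = P Q P + Q P Q. *)
Lemma opnorm_free_summand i j : i != j ->
  opnorm (x i) <= opnorm (x i + x j) + `|tr (x j)| + 1.
Proof.
move=> ij; set C := opnorm _ in |- *; set K := _ + 1.
have C0 : 0 <= opnorm (x i + x j) by exact: opnorm_ge0.
have K0 : 0 < K by rewrite /K ltr_wpDl // addr_ge0.
have [s1 sl sM _] := star_closed (x i).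
have sX n : star (x i) (x i ^+ n).
  by elim: n => [|n IH] //; rewrite exprS; apply: sM => //; exact: star_gen.
pose t n := tr (x i ^+ n).
have XM n : M (x i ^+ n) by exact: algX.
(* Freeness and the trace property turn [tr (y x_j y)] into [tr (x_j) tr (y^2)], so only the mean of
   [x_j] enters. *)
have bound (y : ts_op A) : star (x i) y -> selfadjoint y ->
    `|tr (y * x i * y)| <= K * tr (y ^+ 2).
  move=> sy yy; have My := star_alg (xM i) sy.
  have := tr_conj_bound My yy (algD (xM i) (xM j)) (selfadjointD (xs i) (xs j)) C0 (lexx _).
  rewrite mulrDr mulrDl trD; [|by apply: algM => //; apply: algM..].
  rewrite (tr_conj_free ij sy yy (@star_gen _) (xs j)) => h.
  have := tr_sq_ge0 My yy; set q := tr (y ^+ 2) in h *; set p := tr _ in h * => q0.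
  have -> : p = p + tr (x j) * q - tr (x j) * q by ring.
  apply: (le_trans (ler_normB _ _)); rewrite normrM (ger0_norm q0) /K -addrA mulrDl.
  by rewrite lerD // ler_wpM2r // lerDl.
have step p (e : R) : e ^+ 2 = K ^+ 2 ->
    `|t p.*2.+3 + 2 * e * t p.*2.+2 + K ^+ 2 * t p.*2.+1| <=
    K * (t p.*2.+2 + 2 * e * t p.*2.+1 + K ^+ 2 * t p.*2).
  move=> eK; set y : ts_op A := e%:C%C *: x i ^+ p + x i ^+ p.+1.
  have sy : star (x i) y by apply: sl; exact: sX.
  have yy : selfadjoint y.
    by apply: selfadjointD; [apply: selfadjointZ|]; exact: selfadjointX.
  have conj (U : ts_op A) n : U = x i ^+ n -> tr (y * U * y) =
      t (p.*2 + n).+2 + 2 * e * t (p.*2 + n).+1 + K ^+ 2 * t (p.*2 + n)%N.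
    move=> ->; have -> : y * x i ^+ n * y =
       (e ^+ 2)%:C%C *: x i ^+ (p.*2 + n) +
       ((2 * e)%:C%C *: x i ^+ (p.*2 + n).+1 + x i ^+ (p.*2 + n).+2).
      rewrite /y mulrDl bop_scaleAl -!exprD mulrDl !mulrDr !bop_scaleAl !bop_scaleAr -!exprD.
      rewrite scalerA -rmorphM -expr2 -addrA; congr (_ + _).
        by congr (_ *: x i ^+ _); lia.
      rewrite addrA; congr (_ + _); last by congr (x i ^+ _); lia.
      have -> : (p + n + p.+1 = (p.*2 + n).+1)%N by lia.
      have -> : (p.+1 + n + p = (p.*2 + n).+1)%N by lia.
      by rewrite mulr_natl mulr2n rmorphD scalerDl.
    rewrite !trD ?trZ ?eK //; try exact: algZ; last by apply: algD => //; exact: algZ.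
    by rewrite /t; ring.
  have := bound _ sy yy; rewrite (conj _ 1%N) ?expr1 // addn1.
  have -> : y ^+ 2 = y * 1 * y by rewrite mulr1.
  by rewrite (conj _ 0%N) // addn0.
have ratio p : t p.*2.+2 <= K ^+ 2 * t p.*2.
  have := step p K erefl; have := step p (- K) (sqrrN _); rewrite !ler_norml.
  move=> /andP[h1 _] /andP[_ h2].
  rewrite -subr_ge0 -(pmulr_rge0 _ (_ : 0 < 2 * K)) ?mulr_gt0 //.
  nra.
apply: opnorm_from_moments (xs i) (ltW K0) _ => // p.
rewrite -expr2 -exprM mul2n; elim: p => [|p IH]; first by rewrite !expr0 tr1.
rewrite doubleS [leRHS]exprS; apply: le_trans (ratio p) _.
by rewrite ler_wpM2l // exprn_ge0 // ltW.
Qed.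
End FreePair.

(** * Moments, norms and covariances of the increments *)

Section Process.
Context {R : realType} (A : tracial_space R).
Local Notation law := (probability (measurableTypeR R) R).
Local Notation M := (@ts_alg R A).
Variables (mu : law) (mu_ : R -> law) (X : R -> R -> ts_op A).
Hypothesis semi : is_free_conv_semigroup mu mu_.
Hypothesis sfi : stationary_free_increments mu_ X.

Lemma incrementM a b : a < b -> M (X a b).
Proof. by move/(sfi_selfadjoint sfi) => []. Qed.

Lemma increment_sa a b : a < b -> selfadjoint (X a b).
Proof. by move/(sfi_selfadjoint sfi) => []. Qed.

Lemma tr_increment_law a b n : a < b -> tr (X a b ^+ n) = \int[mu_ (b - a)]_x (x ^+ n).
Proof. by move/(sfi_law sfi) => [_ h]; rewrite /tr h. Qed.

Lemma tr_increment_shift a b c d n : a < b -> c < d -> b - a = d - c ->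
  tr (X a b ^+ n) = tr (X c d ^+ n).
Proof. by move=> ab cd e; rewrite !tr_increment_law // e. Qed.

Definition both (s t : R) : 'I_2 -> R := fun i => if (i : nat) == 0%N then s else t.

Lemma adjacent_disjoint a b c : a < b -> b < c -> disjoint_intervals (both a b) (both b c).
Proof.
move=> ab bc; split=> [[[|[|[]]]] //|].
move=> [[|[|[]]] // i0] [[|[|[]]] // j0] _ _ [x []]; rewrite /both /= !in_itv /=;
  move=> /andP[? ?] /andP[? ?]; try exact: val_inj.
- by exfalso; lra.
- by exfalso; lra.
Qed.

Lemma adjacent_free a b c : a < b -> b < c ->
  freely_independent (fun i : 'I_2 => X (both a b i) (both b c i)).
Proof. by move=> ab bc; apply: (sfi_free sfi); exact: adjacent_disjoint. Qed.

Let i0 : 'I_2 := ord0.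
Let i1 : 'I_2 := lift ord0 ord0.

Lemma adjacentM a b c : a < b -> b < c -> forall i, M (X (both a b i) (both b c i)).
Proof. by move=> ab bc [[|[|[]]]] // i; exact: incrementM. Qed.

Lemma adjacent_sa a b c : a < b -> b < c -> forall i, selfadjoint (X (both a b i) (both b c i)).
Proof. by move=> ab bc [[|[|[]]]] // i; exact: increment_sa. Qed.

Lemma tr_adjacent a b c : a < b -> b < c -> tr (X a b * X b c) = tr (X a b) * tr (X b c).
Proof.
move=> ab bc.
have := @tr_free _ _ _ _ (adjacentM ab bc) (adjacent_free ab bc) i0 i1 (X a b) (X b c) isT.
by apply; [exact: star_gen | exact: star_gen | exact: increment_sa | exact: increment_sa].
Qed.

Definition mean : R := tr (X 0 1).
Definition var : R := tr (X 0 1 ^+ 2) - mean ^+ 2.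
Let m t : R := tr (X 0 t).
Let v t : R := tr (X 0 t ^+ 2) - m t ^+ 2.

Lemma tr_sqD (S T : ts_op A) : M S -> M T ->
  tr ((S + T) ^+ 2) = tr (S ^+ 2) + 2 * tr (S * T) + tr (T ^+ 2).
Proof.
move=> MS MT; have MST := algM MS MT; have MTS := algM MT MS.
rewrite expr2 mulrDl !mulrDr !trD -?expr2 //; try exact: algX;
  try by apply: algD => //; exact: algX.
have -> : tr (T * S) = tr (S * T) by rewrite /tr phi_trace.
by ring.
Qed.

Let m_shift a b : a < b -> tr (X a b) = m (b - a).
Proof.
move=> ab; have := @tr_increment_shift a b 0 (b - a) 1 ab; rewrite subr_gt0 subr0.
by move=> /(_ ab erefl); rewrite !expr1.
Qed.

Let s_shift a b : a < b -> tr (X a b ^+ 2) = v (b - a) + m (b - a) ^+ 2.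
Proof.
move=> ab; rewrite subrK; apply: tr_increment_shift => //; first by rewrite subr_gt0.
by rewrite subr0.
Qed.

Let mD s t : 0 < s -> 0 < t -> m (s + t) = m s + m t.
Proof.
move=> s0 t0; have st : s < s + t by rewrite ltrDl.
rewrite /m -(sfi_additive sfi s0 st) trD; [|exact: incrementM|exact: incrementM].
by rewrite (m_shift st) (addrC s t) addrK.
Qed.

Let vD s t : 0 < s -> 0 < t -> v (s + t) = v s + v t.
Proof.
move=> s0 t0; have st : s < s + t by rewrite ltrDl.
rewrite /v mD // -(sfi_additive sfi s0 st) tr_sqD; [|exact: incrementM|exact: incrementM].
rewrite tr_adjacent // (s_shift st) (m_shift st) (addrC s t) addrK.
by rewrite /v -/(m s); ring.
Qed.

Lemma tr_sq_le (S : ts_op A) : M S -> selfadjoint S -> tr S ^+ 2 <= tr (S ^+ 2).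
Proof.
move=> MS SS; pose c := - tr S.
pose u : ts_op A := c%:C%C *: (1 : ts_op A).
have M1 : M u by apply: algZ; exact: alg1.
have := @tr_sq_ge0 _ _ (S + u) (algD MS M1) (selfadjointD SS (selfadjointZ c selfadjoint1)).
rewrite tr_sqD // [u ^+ 2]expr2 /u bop_scaleAl mul1r bop_scaleAr mulr1 scalerA -rmorphM /=.
by rewrite !trZ ?tr1 //; [rewrite /c expr2; nra | exact: alg1].
Qed.

Let v_ge0 t : 0 < t -> 0 <= v t.
Proof. by move=> t0; rewrite subr_ge0 tr_sq_le //; [exact: incrementM | exact: increment_sa]. Qed.

Lemma var_ge0 : 0 <= var.
Proof. exact: v_ge0. Qed.

(** A nonnegative additive function is monotone, hence bounded by [v 1] on [(0, 1)]. *)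
Let v_lin t : 0 < t -> v t = t * var.
Proof.
have -> : var = v 1 by [].
apply: (@bounded_additive_linear _ v 1 (v 1) ltr01 vD) => s /andP[s0 s1].
have s1' : 0 < 1 - s by rewrite subr_gt0.
rewrite ger0_norm ?v_ge0 //; have := vD s0 s1'; rewrite addrC subrK => ->.
by rewrite lerDl v_ge0.
Qed.

(** Additivity alone allows wild solutions of the Cauchy equation; the bound near 0 coming from the
    weak continuity of the semigroup excludes them. *)
Let m_lin t : 0 < t -> m t = t * mean.
Proof.
have mE s : 0 < s -> m s = \int[mu_ s]_x (x ^+ 1).
  by move=> s0; rewrite -[s in mu_ s]subr0 -tr_increment_law.
have [||d d0 dP] := mean_bounded_near0 (v := var) semi.
- by move=> s s0; have := sfi_law sfi s0; rewrite subr0 => -[].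
- move=> s s0; rewrite -v_lin // -mE // /v lerD2r.
  by rewrite (tr_increment_law 2 s0) subr0.
have -> : mean = m 1 by [].
apply: (@bounded_additive_linear _ m d 1 d0 mD) => s /[dup] /dP + /andP[s0 _].
by rewrite -mE.
Qed.

Lemma tr_increment a b : a < b -> tr (X a b) = (b - a) * mean.
Proof. by move=> ab; rewrite m_shift // m_lin // subr_gt0. Qed.

Lemma tr_increment_sq a b : a < b -> tr (X a b ^+ 2) = (b - a) * var + ((b - a) * mean) ^+ 2.
Proof. by move=> ab; rewrite s_shift // v_lin ?m_lin // subr_gt0. Qed.

Definition increment_bound := opnorm (X 0 1) + `|mean| + 1.

(** An increment shorter than 1 is a free summand of an increment of length 1, whose norm is that of
    [X 0 1] because the moments agree. [opnorm_free_summand] then gives one bound for all short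
    increments. *)
Lemma opnorm_increment a b : a < b -> b - a <= 1 -> opnorm (X a b) <= increment_bound.
Proof.
move=> ab ba1.
have unit_le : opnorm (X a (a + 1)) <= opnorm (X 0 1).
  have a1 : a < a + 1 by rewrite ltrDl.
  have M1 := incrementM a1.
  apply: opnorm_from_moments (increment_sa a1) (opnorm_ge0 _) _ => // p.
  rewrite -expr2 -exprM (@tr_increment_shift _ _ 0 1) //; last by rewrite addrC addKr subr0.
  apply: le_trans (ler_norm _) _; rewrite -exprM.
  have X01 : M (X 0 1) by exact: incrementM.
  apply: tr_abs_le; [exact: algX | | by rewrite exprn_ge0 ?opnorm_ge0|].
    by apply: selfadjointX; exact: increment_sa.
  elim: (2 * p)%N => [|n IH] w; first by rewrite !expr0 mul1r.
  rewrite !exprS; apply: le_trans (nrm_opnorm (X 0 1) ((X 0 1 ^+ n) w)) _.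
  by rewrite -[leRHS]mulrA ler_wpM2l ?opnorm_ge0.
have [<-|ba] := eqVneq (a + 1) b.
  by apply: (le_trans unit_le); rewrite /increment_bound -addrA lerDl addr_ge0.
have bc : b < a + 1 by rewrite lt_def ba -lerBlDl.
have := @opnorm_free_summand _ _ _ _ (adjacentM ab bc) (adjacent_sa ab bc) (adjacent_free ab bc) i0 i1 isT.
rewrite /both /= (sfi_additive sfi ab bc) tr_increment // => h.
apply: (le_trans h); rewrite lerD2r lerD // normrM ler_piMl // ger0_norm; lra.
Qed.

Lemma tr_nested t s u : t < s -> s <= u ->
  tr (X t s * X t u) = (s - t) * var + mean ^+ 2 * (s - t) * (u - t).
Proof.
move=> ts; rewrite le_eqVlt => /orP[/eqP <-|su].
  by rewrite -expr2 tr_increment_sq //; ring.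
rewrite -(sfi_additive sfi ts su) mulrDr trD; [|by apply: algM; exact: incrementM..].
rewrite -expr2 tr_increment_sq // tr_adjacent // !tr_increment //; ring.
Qed.

(** From a common starting point [t] the covariance of [X t u] and [X t w] is [var] times
    [min(u,w) - t], as for Brownian motion. Writing both increments as differences from [t] covers
    all relative positions at once. *)
Lemma tr_increment_mul a b c d : a < b -> c < d -> tr (X a b * X c d) =
  var * (Num.min b d - Num.min b c - Num.min a d + Num.min a c)
  + mean ^+ 2 * (b - a) * (d - c).
Proof.
move=> ab cd; pose t := Num.min a c - 1.
have [ta tc] : t < a /\ t < c.
  by rewrite /t /Num.min; case: ifP => *; split; lra.
have tb := lt_trans ta ab; have td := lt_trans tc cd.
have dif u w : t < u -> u < w -> X u w = X t w - X t u.
  by move=> tu uw; rewrite -(sfi_additive sfi tu uw) addrC addKr.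
have Mt u : t < u -> M (X t u) by exact: incrementM.
have MM u w : t < u -> t < w -> M (X t u * X t w) by move=> *; apply: algM; exact: Mt.
have com (S T : ts_op A) : M S -> M T -> tr (S * T) = tr (T * S).
  by move=> MS MT; rewrite /tr phi_trace.
have cov u w : t < u -> t < w ->
    tr (X t u * X t w) = (Num.min u w - t) * var + mean ^+ 2 * (u - t) * (w - t).
  move=> tu tw; rewrite minElt; case: ltP => uw; first by rewrite tr_nested ?(ltW uw).
  by rewrite (com _ _ (Mt _ tu) (Mt _ tw)) tr_nested ?(ltW uw) //; ring.
rewrite (dif a b) // (dif c d) // mulrBl !mulrBr !trB; try exact: MM; last 2 first.
- by apply: algB; exact: MM.
- by apply: algB; exact: MM.
rewrite !cov //; first by ring.
all: exact: MM.
Qed.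
End Process.

Section IntervalFamilies.
Context {R : realType}.
Local Notation leb := (@lebesgue_measure R).

Lemma leb_bigcup (J : finType) (D : set J) (F : J -> set R) :
  (forall j, measurable (F j)) -> trivIset D F ->
  leb (\bigcup_(j in D) F j) = (\sum_(j | j \in D) leb (F j))%E.
Proof.
move=> mF tF; have fD : finite_set D by exact: finite_finset.
rewrite (measure_fin_bigcup leb fD tF (fun j _ => mF j)).
rewrite fsbig_mkcond (fsbigE (index_enum J)); last 3 first.
- exact: index_enum_uniq.
- by [].
- by move=> j _; rewrite mem_index_enum.
by rewrite [RHS]big_mkcond; apply: eq_big => [j|j _]; rewrite ?in_setT // /patch; case: ifP.
Qed.

Definition span n (a b : 'I_n -> R) : set R := \bigcup_i `[a i, b i[%classic.

Lemma span_measurable n (a b : 'I_n -> R) : measurable (span a b).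
Proof. exact: bigcup_cells_measurable. Qed.

(** The length of the intersection, in the form that the covariance of two increments takes. *)
Definition overlap (a b c d : R) :=
  Num.min b d - Num.min b c - Num.min a d + Num.min a c.

Lemma leb_itv_overlap a b c d : a < b -> c < d ->
  leb (`[a, b[%classic `&` `[c, d[%classic) = (overlap a b c d)%:E.
Proof.
move=> ab cd.
have -> : `[a, b[%classic `&` `[c, d[%classic = `[Num.max a c, Num.min b d[%classic.
  apply/seteqP; split=> x /=; rewrite !in_itv /= ge_max lt_min.
    by move=> [/andP[-> ->] /andP[-> ->]].
  by move=> /andP[/andP[-> ->] /andP[-> ->]].
rewrite lebesgue_measure_itv /= lte_fin /overlap.
case: ifP => h; [congr (_%:E)|congr (_%:E)]; move: h; rewrite /Num.min /Num.max.
  by do !case: ifP => ?; lra.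
by move/negbT; rewrite -leNgt; do !case: ifP => ?; lra.
Qed.

Lemma leb_span n (a b : 'I_n -> R) : disjoint_intervals a b ->
  leb (span a b) = (\sum_i (b i - a i))%:E.
Proof.
move=> [ab tri]; rewrite /span leb_bigcup //.
rewrite -sumEFin; apply: eq_big => [j|j _]; first by rewrite in_setT.
by rewrite leb_cell // ltW.
Qed.

Lemma leb_span_cap n n' (a b : 'I_n -> R) (a' b' : 'I_n' -> R) :
  disjoint_intervals a b -> disjoint_intervals a' b' ->
  leb (span a b `&` span a' b') = (\sum_i \sum_j overlap (a i) (b i) (a' j) (b' j))%:E.
Proof.
move=> [ab tri] [ab' tri'].
pose F (p : 'I_n * 'I_n') := `[a p.1, b p.1[%classic `&` `[a' p.2, b' p.2[%classic : set R.
have -> : span a b `&` span a' b' = \bigcup_p F p.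
  apply/seteqP; split=> x; first by move=> [[i _ xi] [j _ xj]]; exists (i, j).
  by move=> [[i j] _ [xi xj]]; split; [exists i | exists j].
rewrite leb_bigcup; last 2 first.
- by move=> p; apply: measurableI; exact: measurable_itv.
- move=> [i j] [i' j'] _ _ [x [[xi xj] [xi' xj']]].
  have ii : i = i' by apply: tri => //; exists x.
  by have jj : j = j' by [apply: tri' => //; exists x]; rewrite ii jj.
rewrite pair_bigA -sumEFin; apply: eq_big => [p|p _]; first by rewrite in_setT.
by rewrite leb_itv_overlap.
Qed.
End IntervalFamilies.

Section FamilySums.
Context {R : realType} (A : tracial_space R).
Local Notation law := (probability (measurableTypeR R) R).
Local Notation leb := (@lebesgue_measure R).
Local Notation M := (@ts_alg R A).
Variables (mu : law) (mu_ : R -> law) (X : R -> R -> ts_op A).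
Hypothesis semi : is_free_conv_semigroup mu mu_.
Hypothesis sfi : stationary_free_increments mu_ X.

Definition family_sum n (a b : 'I_n -> R) : ts_op A := \sum_i X (a i) (b i).

Lemma family_sumM n (a b : 'I_n -> R) : disjoint_intervals a b -> M (family_sum a b).
Proof. by move=> [ab _]; apply: alg_sum => i _; apply: (incrementM sfi). Qed.

Lemma family_sum_sa n (a b : 'I_n -> R) :
  disjoint_intervals a b -> selfadjoint (family_sum a b).
Proof. by move=> [ab _]; apply: is_adjoint_sum => i _; apply: (increment_sa sfi). Qed.

Lemma tr_sum J (r : seq J) (P : pred J) (F : J -> ts_op A) :
  (forall j, P j -> M (F j)) -> tr (\sum_(j <- r | P j) F j) = \sum_(j <- r | P j) tr (F j).
Proof.
move=> MF; rewrite /tr phi_sum //.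
by apply: (big_morph (fun z : R[i] => complex.Re z)) => // -[? ?] [? ?].
Qed.

Lemma tr_family_mul n n' (a b : 'I_n -> R) (a' b' : 'I_n' -> R) :
  disjoint_intervals a b -> disjoint_intervals a' b' ->
  tr (family_sum a b * family_sum a' b') =
  var X * fine (leb (span a b `&` span a' b')) +
  mean X ^+ 2 * fine (leb (span a b)) * fine (leb (span a' b')).
Proof.
move=> d d'; rewrite (leb_span_cap d d') !leb_span //=.
case: d => ab _; case: d' => ab' _.
have MX i j : M (X (a i) (b i) * X (a' j) (b' j)).
  by apply: algM; apply: (incrementM sfi).
rewrite /family_sum mulr_suml tr_sum; last first.
  by move=> i _; rewrite mulr_sumr; apply: alg_sum => j _; exact: MX.
rewrite -mulrA mulr_suml !mulr_sumr -big_split /=; apply: eq_bigr => i _.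
rewrite mulr_sumr tr_sum => [|j _]; last exact: MX.
rewrite !mulr_sumr -big_split /=; apply: eq_bigr => j _.
by rewrite (tr_increment_mul semi sfi) // -!mulrA.
Qed.

(** Expanding the square with [tr_family_mul] leaves [var] times the measure of the symmetric
    difference plus [mean^2] times the squared difference of the total lengths. *)
Lemma family_dist n n' (a b : 'I_n -> R) (a' b' : 'I_n' -> R) (e : R) :
  disjoint_intervals a b -> disjoint_intervals a' b' ->
  (leb (span a b `+` span a' b') <= e%:E)%E ->
  tr ((family_sum a b - family_sum a' b') ^+ 2) <= var X * e + mean X ^+ 2 * e ^+ 2.
Proof.
move=> d d'; have mU := span_measurable a b; have mV := span_measurable a' b'.
have fU := leb_span d; have fV := leb_span d'; have fW := leb_span_cap d d'.
have MS := family_sumM d; have MT := family_sumM d'.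
have [SM TM] : M (family_sum a b * family_sum a b) /\ M (family_sum a' b' * family_sum a' b').
  by split; exact: algM.
have -> : tr ((family_sum a b - family_sum a' b') ^+ 2) =
    tr (family_sum a b * family_sum a b) - 2 * tr (family_sum a b * family_sum a' b') +
    tr (family_sum a' b' * family_sum a' b').
  rewrite tr_sqD //; last exact: algN.
  by rewrite expr2 mulrN trN ?sqrrN ?expr2; [ring | exact: algM].
rewrite !tr_family_mul // !setIid fU fV fW /=.
set u := \sum_i _; set w := \sum_i _; set v := \sum_i _ => de; move: fU fV fW; rewrite -/u -/v -/w => fU fV fW.
have Uw : leb (span a b `\` span a' b') = (u - w)%:E by rewrite lebD // ?fU ?fW ?ltry // -EFinB.
have Vw : leb (span a' b' `\` span a b) = (v - w)%:E.
  by rewrite lebD // ?fV ?ltry // setIC fW -EFinB.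
have uw : 0 <= u - w by rewrite -lee_fin -Uw measure_ge0.
have vw : 0 <= v - w by rewrite -lee_fin -Vw measure_ge0.
have le : (u - w) + (v - w) <= e.
  rewrite -lee_fin (le_trans _ de) // /setY lebU ?Uw ?Vw //; try exact: measurableD.
  by apply/seteqP; split=> x //= [[? ?] [? ?]].
have v0 := var_ge0 sfi.
have m0 : 0 <= mean X ^+ 2 by exact: sqr_ge0.
have -> : var X * u + mean X ^+ 2 * u * u - 2 * (var X * w + mean X ^+ 2 * u * v) +
    (var X * v + mean X ^+ 2 * v * v) =
    var X * ((u - w) + (v - w)) + mean X ^+ 2 * (u - v) ^+ 2 by ring.
apply: lerD; first exact: ler_wpM2l.
apply: ler_wpM2l => //.
have : (u - v) ^+ 2 = ((u - w) - (v - w)) ^+ 2 by ring.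
move=> ->; nra.
Qed.
End FamilySums.

(** * Values of the process on sets of finite measure *)

Section ProcessValues.
Context {R : realType} (A : tracial_space R).
Local Notation law := (probability (measurableTypeR R) R).
Local Notation leb := (@lebesgue_measure R).
Local Notation M := (@ts_alg R A).
Variables (mu : law) (mu_ : R -> law) (X : R -> R -> ts_op A).
Hypothesis semi : is_free_conv_semigroup mu mu_.
Hypothesis sfi : stationary_free_increments mu_ X.

(** The constant [B] of the free model: at least 1, and for [h <= 1] large enough that both the mean
    and the second moment of an increment of length [h] are at most [B h]. *)
Definition mean_rate : R := 1 + `|mean X| + (var X + mean X ^+ 2).
Let B := mean_rate.
Let K := increment_bound X.

Lemma mean_rate_ge1 : 1 <= B.
Proof.
rewrite /B /mean_rate -addrA lerDl addr_ge0 // addr_ge0 ?(var_ge0 sfi) //.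
exact: sqr_ge0.
Qed.

Lemma increment_bound_gt0 : 0 < K.
Proof. by rewrite /K /increment_bound ltr_wpDl // addr_ge0 // opnorm_ge0. Qed.

Lemma increment_le a h v : 0 < h <= 1 -> nrm (X a (a + h) v) <= K * nrm v.
Proof.
move=> /andP[h0 h1]; have ah : a < a + h by rewrite ltrDl.
apply: (le_trans (nrm_opnorm _ _)); rewrite ler_wpM2r ?nrm_ge0 //.
by apply: (opnorm_increment semi sfi ah); rewrite addrC addKr.
Qed.

Lemma increment_mean_le a h : 0 < h <= 1 -> `|tr (X a (a + h))| <= B * h.
Proof.
move=> /andP[h0 h1]; rewrite (tr_increment semi sfi) ?ltrDl // addrC addKr.
rewrite normrM gtr0_norm // mulrC ler_pM2r // /B /mean_rate.
have := var_ge0 sfi; have := sqr_ge0 (mean X); lra.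
Qed.

Lemma increment_sq_le a h : 0 < h <= 1 -> tr (X a (a + h) ^+ 2) <= B * h.
Proof.
move=> /andP[h0 h1]; rewrite (tr_increment_sq semi sfi) ?ltrDl // (addrC a) addrK.
have -> : h * var X + (h * mean X) ^+ 2 = (var X + h * mean X ^+ 2) * h by ring.
rewrite ler_pM2r // /B /mean_rate.
have : h * mean X ^+ 2 <= mean X ^+ 2 by rewrite ler_piMl // sqr_ge0.
have := normr_ge0 (mean X); lra.
Qed.

(** A plain sum is the polynomial of degree 1 without constraints, so the general norm estimate also
    bounds it uniformly in the number of cells. *)
Lemma family_sum_coarse n (a b : 'I_n -> R) :
  family_sum X a b = coarse_poly (k := 1) (fun c => X (a c) (b c)) id (fun _ _ => false).
Proof.
rewrite /family_sum /coarse_poly; pose g (c : 'I_n) : {ffun 'I_1 -> 'I_n} := [ffun=> c].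
rewrite (reindex g) /=; last first.
  exists (fun t => t ord0) => [c _|t _]; first by rewrite ffunE.
  by apply/ffunP => r; rewrite ffunE (ord1 r).
apply: eq_big => [c|c _].
  by apply/esym/respectsP.
by rewrite big_ord1 ffunE.
Qed.

Definition family_constant (S : R) : R :=
  Num.sqrt (#|{ffun 'I_1 -> letter}|%:R ^+ 2 * word_bound (growth K) B S ^+ 1).

Lemma family_sum_le n (a : 'I_n -> R) (h S : R) v : 0 < h <= 1 -> 1 <= S ->
  disjoint_intervals a (fun c => a c + h) -> n%:R * h <= S ->
  nrm (family_sum X a (fun c => a c + h) v) <= family_constant S * nrm v.
Proof.
move=> h01 S1 dis nS; have /andP[h0 _] := h01.
have lt c : a c < a c + h by rewrite ltrDl.
apply: (le_trans (nrm_opnorm _ _)); rewrite ler_wpM2r ?nrm_ge0 // family_sum_coarse.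
apply: (opnorm_coarse_poly (K := K) (B := B) (h := h)) => //.
- by move=> c; apply: (incrementM sfi).
- by move=> c; apply: (increment_sa sfi).
- exact: (sfi_free sfi dis).
- exact: increment_bound_gt0.
- exact: mean_rate_ge1.
- by move=> c w; apply: increment_le.
- by move=> c; apply: increment_mean_le.
- by move=> c; apply: increment_sq_le.
- by rewrite card_ord.
Qed.

Lemma tr_sqD_le (S T : ts_op A) : M S -> M T -> selfadjoint S -> selfadjoint T ->
  tr ((S + T) ^+ 2) <= 2 * tr (S ^+ 2) + 2 * tr (T ^+ 2).
Proof.
move=> MS MT SS TT; have := tr_sq_ge0 (algB MS MT) (selfadjointB SS TT).
rewrite !tr_sqD //; last exact: algN.
rewrite mulrN trN ?sqrrN; [lra | exact: algM].
Qed.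

Let V := var X + mean X ^+ 2.
Let V0 : 0 <= V. Proof. by rewrite addr_ge0 ?sqr_ge0 // (var_ge0 sfi). Qed.

(** The measure tolerance at level [l], chosen so that the sums at two consecutive levels differ by
    at most [8^-l] in squared 2-norm, the rate required by [fast_cauchy_limit]. *)
Definition gauge (l : nat) : R := 8^-1 ^+ l / (4 * (V + 1)).

Lemma gauge_gt0 l : 0 < gauge l.
Proof. by rewrite divr_gt0 ?exprn_gt0 ?invr_gt0 ?mulr_gt0 // ltr_wpDl. Qed.

Lemma gaugeS_le l : gauge l.+1 <= gauge l.
Proof.
rewrite /gauge ler_pM2r ?invr_gt0 ?mulr_gt0 ?ltr_wpDl // exprS ler_piMl //; lra.
Qed.

Lemma gauge_le l : gauge l <= 4^-1.
Proof.
apply: (@le_trans _ _ (gauge 0)); last first.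
  rewrite /gauge expr0 mul1r lef_pV2 ?posrE ?mulr_gt0 ?ltr_wpDl //.
  by have := V0; lra.
by elim: l => // l IH; exact: le_trans (gaugeS_le l) IH.
Qed.

Lemma gaugeE l : 4 * (V + 1) * gauge l = 8^-1 ^+ l.
Proof. by rewrite /gauge mulrC divfK // gt_eqF // mulr_gt0 // ltr_wpDl. Qed.

Lemma gauge_small (d : R) : 0 < d -> exists N, forall l, (N <= l)%N -> gauge l <= d.
Proof.
move=> d0; have [||N NP] := @expr_small R 8^-1 d; [lra|exact: d0|].
exists N => l Nl; apply: le_trans (ltW (NP l Nl)); rewrite -gaugeE.
have := V0; have := gauge_gt0 l; nra.
Qed.

Lemma family_dist1 n n' (a b : 'I_n -> R) (a' b' : 'I_n' -> R) (F : set R) (d e : R) :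
  measurable F -> disjoint_intervals a b -> disjoint_intervals a' b' -> d + e <= 1 ->
  (leb (F `+` span a b) <= d%:E)%E -> (leb (F `+` span a' b') <= e%:E)%E ->
  tr ((family_sum X a b - family_sum X a' b') ^+ 2) <= V * (d + e).
Proof.
move=> mF D D' de1 Fd Fe; have mU := span_measurable a b; have mU' := span_measurable a' b'.
have le : (leb (span a b `+` span a' b') <= (d + e)%:E)%E.
  apply: (le_trans (measure_setY_triangle mU mF mU')).
  by rewrite EFinD [span a b `+` F]setYC; apply: leeD.
have h := family_dist semi sfi D D' le; apply: (le_trans h).
have de0 : 0 <= d + e by rewrite -lee_fin (le_trans _ le) // measure_ge0.
rewrite /V [leRHS]mulrDl lerD2l ler_wpM2l ?sqr_ge0 // expr2 ler_piMl //.
Qed.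

Section Limit.
Variable F : set R.
Hypotheses (mF : measurable F) (Foo : (leb F < +oo)%E).
Variables (n : nat -> nat) (a : forall l, 'I_(n l) -> R) (h : nat -> R).
Arguments a : clear implicits.
Hypothesis h01 : forall l, 0 < h l <= 1.
Let b l c := a l c + h l.
Arguments b : clear implicits.
Hypothesis dis : forall l, disjoint_intervals (a l) (b l).
Hypothesis app : forall l, (leb (F `+` span (a l) (b l)) <= (gauge l)%:E)%E.
Let S l : ts_op A := family_sum X (a l) (b l).

Lemma family_mass l : (n l)%:R * h l <= fine (leb F) + 2.
Proof.
have mU := span_measurable (a l) (b l).
have : (leb (span (a l) (b l)) <= (fine (leb F) + 1)%:E)%E.
  rewrite EFinD fineK; last by rewrite fin_real // (lt_le_trans (ltNyr 0) (measure_ge0 _ _)) Foo.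
  apply: (@le_trans _ _ (leb (F `|` (F `+` span (a l) (b l))))).
    apply: leb_le => //; first by apply: measurableU => //; exact: setY_measurable.
    by move=> x /= xU; have [|] := pselect (F x); tauto.
  apply: (le_trans (lebU2 mF (setY_measurable mF mU))); rewrite leeD2l //.
  by apply: (le_trans (app l)); rewrite lee_fin; have := gauge_le l; lra.
rewrite leb_span // lee_fin (eq_bigr (fun=> h l)); last by move=> c _; rewrite /b addrC addKr.
rewrite sumr_const card_ord -mulr_natl; lra.
Qed.

Lemma family_bound : 0 <= family_constant (fine (leb F) + 2) /\
  forall l x, nrm (S l x) <= family_constant (fine (leb F) + 2) * nrm x.
Proof.
split=> [|l x]; first exact: sqrtr_ge0.
apply: family_sum_le => //; last exact: family_mass.
by rewrite -lerBlDr (le_trans _ (fine_ge0 _)) ?measure_ge0 //; lra.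
Qed.

Lemma process_value_limit : exists2 T : ts_op A,
  (forall x, tends (fun l => S l x) (T x)) & is_process_value X F T.
Proof.
have [C0 CS] := family_bound.
have [l|l||l x|l|T ST [MT TT Tl]] := @fast_cauchy_limit _ _ S (family_constant (fine (leb F) + 2)).
- exact: (family_sumM sfi).
- exact: (family_sum_sa sfi).
- exact: C0.
- exact: CS.
- have := gauge_le l; have := gauge_le l.+1; have := gaugeS_le l; have := gauge_gt0 l.
  have := gaugeE l; have := V0 => v0 gE g0 gS g1 g2.
  apply: (le_trans (family_dist1 mF (dis l.+1) (dis l) _ (app l.+1) (app l))); first by lra.
  by rewrite -gE; nra.
exists T => //; split=> // e e0.
have V1 : 0 < 8 * (V + 1) by rewrite mulr_gt0 // ltr_wpDl.
pose d := Num.min 4^-1 (e / (8 * (V + 1))).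
have d0 : 0 < d by rewrite lt_min divr_gt0 //; lra.
have [d1 d2] : d <= 4^-1 /\ d * (8 * (V + 1)) <= e.
  by rewrite -ler_pdivlMr // /d !ge_min !lexx orbT.
exists d => // p a' b' dis' small.
have [N1 N1P] := gauge_small d0; have [|N2 N2P] := Tl (e / 8); first by rewrite divr_gt0.
pose l := maxn N1 N2; have lg := N1P l (leq_maxl _ _); have lT := N2P l (leq_maxr _ _).
have MS := family_sumM sfi dis'; have SS := family_sum_sa sfi dis'.
have MSl := family_sumM sfi (dis l); have SSl := family_sum_sa sfi (dis l).
rewrite -/(family_sum X a' b').
rewrite (phi_real (algX 2 (algB MT MS)) (selfadjointX 2 (selfadjointB TT SS))) ltcR.
have -> : T - family_sum X a' b' = (T - S l) + (S l - family_sum X a' b').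
  by rewrite addrA subrK.
have dd : d + d <= 1 by lra.
have := family_dist1 mF (dis l) dis' dd (le_trans (app l) _) (ltW small).
rewrite lee_fin => /(_ lg) near.
have := tr_sqD_le (algB MT MSl) (algB MSl MS) (selfadjointB TT SSl) (selfadjointB SSl SS).
have := V0; nra.
Qed.
End Limit.

(** Two values are both 2-norm close to the same approximating sum. Such sums must exist arbitrarily
    near [F], since otherwise the condition defining a value would be vacuous. *)
Lemma process_value_unique (F : set R) (S T : ts_op A) :
  (forall d : R, 0 < d -> exists n (a b : 'I_n -> R), disjoint_intervals a b /\
     (leb (F `+` span a b) < d%:E)%E) ->
  is_process_value X F S -> is_process_value X F T -> S = T.
Proof.
move=> ex [MS SS Sl] [MT TT Tl]; have Md := algB MS MT; have sd := selfadjointB SS TT.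
suff : tr ((S - T) ^+ 2) <= 0.
  move=> le; have := phi_faithful Md sd; rewrite -expr2.
  rewrite (phi_real (algX 2 Md) (selfadjointX 2 sd)).
  have -> : tr ((S - T) ^+ 2) = 0 by apply/eqP; rewrite eq_le le tr_sq_ge0.
  by move=> /(_ erefl)/eqP; rewrite subr_eq0 => /eqP.
apply/ler_addgt0Pr => e e0; rewrite add0r.
have [|d1 d10 d1P] := Sl (e / 4); first by rewrite divr_gt0.
have [|d2 d20 d2P] := Tl (e / 4); first by rewrite divr_gt0.
have [|n [a [b [dis]]]] := ex (Num.min d1 d2); first by rewrite lt_min d10.
have MU := family_sumM sfi dis; have UU := family_sum_sa sfi dis.
rewrite EFin_min lt_min => /andP[/(d1P _ _ _ dis) + /(d2P _ _ _ dis)].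
rewrite -/(family_sum X a b); set U := family_sum X a b in MU UU *.
rewrite (phi_real (algX 2 (algB MS MU)) (selfadjointX 2 (selfadjointB SS UU))) ltcR => l1.
rewrite (phi_real (algX 2 (algB MT MU)) (selfadjointX 2 (selfadjointB TT UU))) ltcR => l2.
have := tr_sqD_le (algB MS MU) (algB MU MT) (selfadjointB SS UU) (selfadjointB UU TT).
rewrite addrA subrK -(opprB T U) sqrrN; lra.
Qed.

(** Existence of a value keeps [process_at] from falling back on its default 0, and uniqueness
    identifies it with the strong limit of any sufficiently fast approximation. *)
Lemma process_at_limit (F : set R) (n : nat -> nat) (a : forall l, 'I_(n l) -> R) (h : nat -> R) :
  measurable F -> (leb F < +oo)%E -> (forall l, 0 < h l <= 1) ->
  (forall l, disjoint_intervals (a l) (fun c => a l c + h l)) ->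
  (forall l, (leb (F `+` span (a l) (fun c => (a l c + h l)%R)) <= (gauge l)%:E)%E) ->
  is_process_value X F (process_at X F) /\
  forall x, tends (fun l => family_sum X (a l) (fun c => a l c + h l) x) (process_at X F x).
Proof.
move=> mF Foo h01 dis app; have [T Tl TF] := process_value_limit mF Foo h01 dis app.
have PF : is_process_value X F (process_at X F) by apply: xgetPex; exists T.
split=> // x; suff -> : process_at X F = T by [].
apply: process_value_unique PF TF => d d0.
have [N /(_ N (leqnn N)) Nd] := @gauge_small (d / 2) (divr_gt0 d0 (ltr0Sn R 1)).
exists (n N), (a N), (fun c => a N c + h N); split => //.
by apply: le_lt_trans (app N) _; rewrite lte_fin; lra.
Qed.
End ProcessValues.

(** * Norm convergence *)

Section StrongLimits.
Context {R : realType} (H : hilbert R).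
Implicit Types (T : bop H).

Lemma tends_prod (J : Type) (r : seq J) (u : J -> nat -> bop H) (T : J -> bop H) :
  (forall j, exists2 C : R, 0 <= C & forall n x, nrm (u j n x) <= C * nrm x) ->
  (forall j x, tends (fun n => u j n x) (T j x)) ->
  forall x, tends (fun n => (\prod_(j <- r) u j n) x) ((\prod_(j <- r) T j) x).
Proof.
move=> uC uT; elim: r => [|j r IH] x.
  rewrite big_nil (_ : (fun n => _) = fun=> x); first exact: tends_cst.
  by apply: funext => n; rewrite big_nil.
have [C C0 uC'] := uC j.
rewrite big_cons (_ : (fun n => _) = fun n => (u j n * \prod_(i <- r) u i n) x).
  exact: (tends_bop_mul C0).
by apply: funext => n; rewrite big_cons.
Qed.

Lemma tends_sum (J : Type) (r : seq J) (P : pred J) (u : J -> nat -> bop H) (T : J -> bop H) x :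
  (forall j, tends (fun n => u j n x) (T j x)) ->
  tends (fun n => (\sum_(j <- r | P j) u j n) x) ((\sum_(j <- r | P j) T j) x).
Proof.
move=> uT; elim: r => [|j r IH].
  rewrite big_nil (_ : (fun n => _) = fun=> (0 : bop H) x); first exact: tends_cst.
  by apply: funext => n; rewrite big_nil.
rewrite big_cons; case: ifP => Pj.
  rewrite (_ : (fun n => _) = fun n => u j n x + (\sum_(i <- r | P i) u i n) x).
    exact: tendsD.
  by apply: funext => n; rewrite big_cons Pj.
rewrite (_ : (fun n => _) = fun n => (\sum_(i <- r | P i) u i n) x) //.
by apply: funext => n; rewrite big_cons Pj.
Qed.

Lemma tends_sub (u v : nat -> bop H) S T x : tends (fun n => u n x) (S x) ->
  tends (fun n => v n x) (T x) -> tends (fun n => (u n - v n) x) ((S - T) x).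
Proof.
move=> uS vT; apply: (tendsD uS) => e /vT[N NP]; exists N => n /NP.
by rewrite -opprD nrmN.
Qed.

(** Lower semicontinuity of the operator norm, through which estimates for cells reach the values of
    the process. *)
Lemma opnorm_tends (u : nat -> bop H) T (C : R) : 0 <= C -> (forall n, opnorm (u n) <= C) ->
  (forall x, tends (fun n => u n x) (T x)) -> opnorm T <= C.
Proof.
move=> C0 uC uT; apply: opnorm_le => // x; apply: tends_le (uT x) _ => n.
by apply: (le_trans (nrm_opnorm _ _)); rewrite ler_wpM2r ?nrm_ge0.
Qed.
End StrongLimits.

Section NormLimits.
Context {R : realType} (A : tracial_space R).
Local Notation M := (@ts_alg R A).

Definition norm_convergent (u : nat -> ts_op A) :=
  exists2 T : ts_op A, M T &
    forall e : R, 0 < e -> exists N, forall n, (N <= n)%N -> opnorm (u n - T) <= e.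

Lemma norm_convergentB u v : norm_convergent u -> norm_convergent v ->
  norm_convergent (fun n => u n - v n).
Proof.
move=> [S MS uS] [T MT vT]; exists (S - T); first exact: algB.
move=> e e0; have e2 : 0 < e / 2 by rewrite divr_gt0.
have [N1 N1P] := uS _ e2; have [N2 N2P] := vT _ e2.
exists (maxn N1 N2) => n; rewrite geq_max => /andP[/N1P n1 /N2P n2].
have -> : u n - v n - (S - T) = (u n - S) + - (v n - T) by rewrite !opprD !opprK addrACA.
apply: (le_trans (opnormD _ _)); rewrite opnormN; lra.
Qed.

Lemma norm_convergent0 : norm_convergent (fun=> 0).
Proof.
exists 0; first exact: alg0.
by move=> e e0; exists 0%N => n _; rewrite subr0 opnorm0 ltW.
Qed.

Lemma norm_convergent_sum (J : Type) (r : seq J) (P : pred J) (u : J -> nat -> ts_op A) :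
  (forall j, P j -> norm_convergent (u j)) ->
  norm_convergent (fun n => \sum_(j <- r | P j) u j n).
Proof.
move=> uP; elim: r => [|j r IH].
  have -> : (fun n => \sum_(j <- [::] | P j) u j n) = fun=> 0.
    by apply: funext => n; rewrite big_nil.
  exact: norm_convergent0.
have [Pj|Pj] := boolP (P j); last first.
  rewrite (_ : (fun n => _) = fun n => \sum_(i <- r | P i) u i n) //.
  by apply: funext => n; rewrite big_cons (negPf Pj).
rewrite (_ : (fun n => _) = fun n => u j n - (0 - \sum_(i <- r | P i) u i n)).
  by apply: norm_convergentB; [exact: uP | exact: (norm_convergentB norm_convergent0 IH)].
by apply: funext => n; rewrite big_cons Pj sub0r opprK.
Qed.

Lemma norm_complete u : (forall n, M (u n)) ->
  (forall e : R, 0 < e -> exists N, forall n m, (N <= n)%N -> (N <= m)%N ->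
     opnorm (u n - u m) <= e) -> norm_convergent u.
Proof.
move=> Mu uC; have [N1 N1P] := uC 1 ltr01.
pose w n := u (N1 + n)%N; pose C := opnorm (u N1) + 1.
have C0 : 0 <= C by rewrite addr_ge0 // opnorm_ge0.
have diff n m x : nrm ((u n - u m) x) <= opnorm (u n - u m) * nrm x by exact: nrm_opnorm.
have wC n x : nrm (w n x) <= C * nrm x.
  have -> : w n x = (u N1) x + (u (N1 + n)%N - u N1) x by rewrite /= addrC subrK.
  apply: (le_trans (nrmD _ _)); rewrite mulrDl lerD ?nrm_opnorm //.
  by apply: (le_trans (diff _ _ _)); rewrite ler_wpM2r ?nrm_ge0 // N1P // leq_addr.
have cvg x : exists y, tends (fun n => w n x) y.
  apply: complete_tends => e e0.
  have d0 : 0 < e / (2 * (nrm x + 1)) by rewrite divr_gt0 // mulr_gt0 // ltr_wpDl ?nrm_ge0.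
  have [N NP] := uC _ d0; exists N => n m Nn Nm.
  apply: (le_lt_trans (diff (N1 + n)%N (N1 + m)%N x)).
  apply: (@le_lt_trans _ _ (e / (2 * (nrm x + 1)) * nrm x)).
    by rewrite ler_wpM2r ?nrm_ge0 // NP // (leq_trans _ (leq_addl _ _)).
  have x0 := nrm_ge0 x.
  rewrite mulrAC ltr_pdivrMr ?mulr_gt0 ?ltr_wpDl //; nra.
have [T Tw _] := bop_lim C0 wC cvg.
exists T; first by apply: (alg_lim (u := w)) => // n; exact: Mu.
move=> e e0; have [N NP] := uC _ e0; exists N => n Nn.
apply: (opnorm_tends (u := fun m => u n - w (N + m)%N)); first exact: ltW.
  by move=> m; apply: NP => //; rewrite addnCA leq_addr.
move=> x; apply: tends_sub; first exact: tends_cst.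
move=> d d0; have [N2 N2P] := Tw x d d0; exists N2 => m Nm; apply: N2P.
by rewrite (leq_trans Nm) // leq_addl.
Qed.
End NormLimits.

Section CoarseSums.
Context {R : realType} (A : tracial_space R).

(** By distributivity, grouping the tuples of cells by their labels turns a constraint on labels
    into the same polynomial in the fiber sums. *)
Lemma coarse_poly_fibers (I J : finType) (x : I -> ts_op A) (f : I -> J) k (e : rel 'I_k) :
  coarse_poly x f e = coarse_poly (fun j => \sum_(c | f c == j) x c) id e.
Proof.
pose g (t : {ffun 'I_k -> I}) : {ffun 'I_k -> J} := [ffun r => f (t r)].
have gP t : respects e f t = respects e id (g t).
  by apply/respectsP/respectsP => h a b /h; rewrite !ffunE.
rewrite /coarse_poly (partition_big g (respects e id)) /=; last by move=> t; rewrite gP.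
apply: eq_bigr => s es; rewrite bigA_distr_big_dep; apply: eq_bigl => t.
rewrite gP; apply/andP/familyP => [[_ /eqP <-] r|h]; first by apply/eqP; rewrite ffunE.
suff -> : g t = s by split.
by apply/ffunP => r; rewrite ffunE; apply/eqP; exact: h.
Qed.

Lemma tends_coarse_poly (J : finType) (u : nat -> J -> ts_op A) (T : J -> ts_op A)
    k (e : rel 'I_k) :
  (forall j, exists2 C : R, 0 <= C & forall n x, nrm (u n j x) <= C * nrm x) ->
  (forall j x, tends (fun n => u n j x) (T j x)) ->
  forall x, tends (fun n => coarse_poly (u n) id e x) (coarse_poly T id e x).
Proof.
move=> uC uT x; apply: tends_sum => t; apply: (@tends_prod _ _ _ _ (fun r n => u n (t r))) => r //.
Qed.
End CoarseSums.

Section Fibers.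
Context {R : realType}.
Local Notation leb := (@lebesgue_measure R).

(* Intervals [a_c, a_c + h[ of a common length; cells_k c names the set that the
   cell c helps to approximate. *)
Record cells (J : Type) := Cells {
  cells_n : nat; cells_a : 'I_cells_n -> R; cells_h : R; cells_k : 'I_cells_n -> J }.

Definition cells_b J (Z : @cells J) c := @cells_a J Z c + cells_h Z.
End Fibers.
Arguments cells R J : clear implicits.

Section Fibers.
Context {R : realType} (J : finType).
Local Notation leb := (@lebesgue_measure R).
Variables (Z : cells R J) (j : J).
Hypothesis dis : disjoint_intervals (@cells_a R J Z) (@cells_b R J Z).

Definition fiber_pred := [pred c : 'I_(cells_n Z) | cells_k c == j].

Definition fiber_a (i : 'I_#|fiber_pred|) : R := cells_a (enum_val i).

Definition fiber : set R :=
  \bigcup_(c in [set c : 'I_(cells_n Z) | cells_k c = j]) `[cells_a c, cells_b c[%classic.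

Lemma fiber_measurable : measurable fiber.
Proof. exact: bigcup_cells_measurable. Qed.

Lemma fiber_disjoint : disjoint_intervals fiber_a (fun i => fiber_a i + cells_h Z).
Proof.
have [lt tri] := dis; split=> [i|i i' _ _ ne]; first exact: lt.
by apply: enum_val_inj; apply: tri.
Qed.

Lemma fiber_span : span fiber_a (fun i => fiber_a i + cells_h Z) = fiber.
Proof.
apply/seteqP; split=> x [c].
  by move=> _ xc; exists (enum_val c) => //; apply/eqP; exact: (enum_valP c).
move: c => i /= /eqP ij xi; have iP : (i \in fiber_pred) by [].
by exists (enum_rank_in iP i) => //; rewrite /fiber_a enum_rankK_in.
Qed.

Lemma fiber_mass : leb fiber = (#|fiber_pred|%:R * cells_h Z)%:E.
Proof.
rewrite -fiber_span leb_span; last exact: fiber_disjoint.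
rewrite (eq_bigr (fun=> cells_h Z)) => [|i _]; last by rewrite addrC addKr.
by rewrite sumr_const card_ord mulr_natl.
Qed.
End Fibers.

Section Assembly.
Context {R : realType} (A : tracial_space R).
Local Notation law := (probability (measurableTypeR R) R).
Local Notation leb := (@lebesgue_measure R).
Local Notation M := (@ts_alg R A).
Variables (mu : law) (mu_ : R -> law) (X : R -> R -> ts_op A).
Hypothesis semi : is_free_conv_semigroup mu mu_.
Hypothesis sfi : stationary_free_increments mu_ X.

Definition fiber_sum (J : finType) (Z : cells R J) j : ts_op A :=
  \sum_(c | cells_k c == j) X (cells_a c) (@cells_b R J Z c).

Lemma fiber_sumE (J : finType) (Z : cells R J) j :
  fiber_sum Z j = family_sum X (@fiber_a R J Z j) (fun i => fiber_a i + cells_h Z).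
Proof.
transitivity (\sum_(c in fiber_pred Z j) X (cells_a c) (@cells_b R J Z c)); first exact: eq_bigl.
by rewrite big_enum_val.
Qed.

Lemma process_at_fibers (J : finType) (Z : nat -> cells R J) (G : set R) j :
  measurable G -> (leb G < +oo)%E -> (forall l, 0 < cells_h (Z l) <= 1) ->
  (forall l, disjoint_intervals (@cells_a R J (Z l)) (@cells_b R J (Z l))) ->
  (forall l, (leb (G `+` fiber (Z l) j) <= (gauge X l)%:E)%E) ->
  [/\ M (process_at X G),
      exists2 C : R, 0 <= C & forall l x, nrm (fiber_sum (Z l) j x) <= C * nrm x &
      forall x, tends (fun l => fiber_sum (Z l) j x) (process_at X G x)].
Proof.
move=> mG Goo h01 dis app.
have dis' l := @fiber_disjoint R J (Z l) j (dis l).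
have app' l : (leb (G `+` span (@fiber_a R J (Z l) j)
    (fun i => (fiber_a i + cells_h (Z l))%R)) <= (gauge X l)%:E)%E.
  by rewrite fiber_span.
have [[MG _ _] lim] := process_at_limit semi sfi mG Goo h01 dis' app'.
have [C0 CS] := family_bound semi sfi mG Goo h01 dis' app'.
split=> // [|x].
  by exists (family_constant X (fine (leb G) + 2)) => // l x; rewrite fiber_sumE.
by have := lim x; congr tends; apply: funext => l; rewrite fiber_sumE.
Qed.

Variable E : set R.
Hypotheses (mE : measurable E) (Eoo : (leb E < +oo)%E).
Let s : R := fine (leb E).
Let s0 : 0 <= s. Proof. exact: fine_ge0. Qed.

Variables (k : nat) (e : rel 'I_k).

Definition piece_poly N : ts_op A :=
  coarse_poly (fun i : 'I_N => process_at X (piece E N i)) id e.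

Definition piece_constant : R := #|{ffun 'I_k -> letter}|%:R ^+ 2 *
  (4 * word_bound (growth (increment_bound X)) (mean_rate X) (s + 2) ^+ k).

(** A coarse piece is a union of at most [L] fine ones, so the tolerance [gauge / L^2] per fine
    piece leaves [gauge / L] per coarse piece. This is small enough both for the process value and
    for the mass of a fiber. *)
Definition approximates L l (Z : cells R 'I_L) :=
  [/\ 0 < cells_h Z, cells_h Z <= L%:R^-1,
      disjoint_intervals (@cells_a R 'I_L Z) (@cells_b R 'I_L Z) &
      forall j : 'I_L, (leb (piece E L j `+` fiber Z j) <= (gauge X l / L%:R ^+ 2)%:E)%E].

Lemma cells_approximation L : (0 < L)%N ->
  exists Z : nat -> cells R 'I_L, forall l, approximates l (Z l).
Proof.
move=> L0; have L0R : 0 < L%:R :> R by rewrite ltr0n.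
suff /choice[Z ZP] : forall l, exists Z : cells R 'I_L, approximates l Z by exists Z.
move=> l; have g0 := gauge_gt0 sfi l; have g1 := gauge_le sfi l.
have [||||p [a [h [kap [h0 hle dis app]]]]] :=
  @cell_approximation R L (fun j => piece E L j) (gauge X l / L%:R ^+ 2).
- by move=> j; exact: piece_measurable.
- by move=> j; exact: piece_finite.
- by move=> i j x Fi Fj; apply: val_inj; exact: (piece_disjoint L0 Fi Fj).
- by rewrite divr_gt0 // exprn_gt0.
exists (Cells a h kap); split=> //=.
  have L1 : L%:R^-1 <= 1 :> R by rewrite invf_le1 // ler1n.
  have Li : 0 < L%:R^-1 :> R by rewrite invr_gt0.
  rewrite (le_trans hle) // -exprVn; nra.
by move=> j; apply: ltW; exact: app.
Qed.

Lemma setY_bigcup_le (I : finType) (P : pred I) (G F : set R) (g f : I -> set R) (d : R) :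
  (forall i, measurable (g i)) -> (forall i, measurable (f i)) -> 0 <= d ->
  measurable G -> measurable F ->
  (forall x, G x <-> exists2 i, P i & g i x) -> (forall x, F x <-> exists2 i, P i & f i x) ->
  (forall i, (leb (g i `+` f i) <= d%:E)%E) -> (leb (G `+` F) <= (#|I|%:R * d)%:E)%E.
Proof.
move=> mg mf d0 mG mF GE FE gf.
have mgf i : measurable (g i `+` f i) by exact: setY_measurable.
apply: (@le_trans _ _ (leb (\big[setU/set0]_(i | true) (g i `+` f i)))).
  apply: leb_le; [exact: setY_measurable | by apply: bigsetU_measurable|].
  move=> x [[/GE[i Pi gx] nF]|[/FE[i Pi fx] nG]]; apply: (bigsetU_in (j := i)).
    by left; split=> // fx; apply: nF; apply/FE; exists i.
  by right; split=> // gx; apply: nG; apply/GE; exists i.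
apply: (le_trans (finite_subadditive _ mgf)).
apply: (@le_trans _ _ (\sum_(i : I) d%:E)%E); first by apply: lee_sum.
by rewrite sumEFin sumr_const mulr_natl.
Qed.
End Assembly.

(** * Polynomials in the pieces and their approximation by cells *)

Section PiecePolynomials.
Context {R : realType} (A : tracial_space R).
Local Notation law := (probability (measurableTypeR R) R).
Local Notation leb := (@lebesgue_measure R).
Local Notation M := (@ts_alg R A).
Variables (mu : law) (mu_ : R -> law) (X : R -> R -> ts_op A).
Hypothesis semi : is_free_conv_semigroup mu mu_.
Hypothesis sfi : stationary_free_increments mu_ X.
Variable E : set R.
Hypotheses (mE : measurable E) (Eoo : (leb E < +oo)%E).
Let s : R := fine (leb E).
Let s0 : 0 <= s. Proof. exact: fine_ge0. Qed.
Variables (k : nat) (e : rel 'I_k).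
Let C0 : R := piece_constant X E k.

Definition relabel (J J' : Type) (f : J -> J') (Z : cells R J) : cells R J' :=
  Cells (@cells_a R J Z) (cells_h Z) (fun c => f (cells_k c)).

Section Coarsening.
Variables (L N m : nat).
Hypotheses (L0 : (0 < L)%N) (N0 : (0 < N)%N) (LNm : L = (N * m)%N).
Variable Z : nat -> cells R 'I_L.
Hypothesis Zapp : forall l, approximates X E l (Z l).

Let m0 : (0 < m)%N. Proof. by move: L0; rewrite LNm muln_gt0 => /andP[]. Qed.

Let coarse_lt (j : 'I_L) : (j %/ m < N)%N.
Proof. by rewrite ltn_divLR //; apply: leq_trans (ltn_ord j) _; rewrite LNm. Qed.

Definition coarse (j : 'I_L) : 'I_N := Ordinal (coarse_lt j).

Let W l := relabel coarse (Z l).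

Let L0R : 0 < L%:R :> R. Proof. by rewrite ltr0n. Qed.

Let Lle1 : L%:R^-1 <= 1 :> R. Proof. by rewrite invf_le1 // ler1n. Qed.

Lemma coarse_approximation l (i : 'I_N) :
  (leb (piece E N i `+` fiber (W l) i) <= (gauge X l / L%:R)%:E)%E.
Proof.
have [_ _ _ app] := Zapp l.
have g0 := gauge_gt0 sfi l.
have -> : gauge X l / L%:R = L%:R * (gauge X l / L%:R ^+ 2) by field; rewrite gt_eqF.
rewrite -[X in (X%:R * _)%:E]card_ord.
apply: (@setY_bigcup_le _ _ (fun j : 'I_L => coarse j == i) _ _
  (fun j => piece E L j) (fun j => fiber (Z l) j)).
- by move=> j; exact: piece_measurable.
- by move=> j; exact: fiber_measurable.
- by rewrite divr_ge0 ?exprn_ge0 ?ltW.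
- exact: piece_measurable.
- exact: fiber_measurable.
- move=> x; rewrite (piece_refine E N0 m0 (ltn_ord i)) -LNm; split.
    move=> [j /= ji xj].
    by exists j => //; apply/eqP/val_inj.
  by move=> [j /eqP/(congr1 val)/= ji xj]; exists j.
- move=> x; split.
    move=> [c /= ci xc]; exists (@cells_k R _ (Z l) c); last by exists c.
    by apply/eqP.
  by move=> [j /eqP ji [c /= cj xc]]; exists c => //=; rewrite cj.
- exact: app.
Qed.

Let h01 l : 0 < cells_h (Z l) <= 1.
Proof. by have [-> h _ _] := Zapp l; exact: le_trans h Lle1. Qed.

Lemma piece_limit (i : 'I_N) :
  [/\ M (process_at X (piece E N i)),
      exists2 C : R, 0 <= C & forall l x, nrm (fiber_sum X (W l) i x) <= C * nrm x &
      forall x, tends (fun l => fiber_sum X (W l) i x) (process_at X (piece E N i) x)].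
Proof.
apply: (process_at_fibers semi sfi).
- exact: piece_measurable.
- exact: piece_finite.
- exact: h01.
- by move=> l; have [] := Zapp l.
- move=> l; apply: le_trans (coarse_approximation l i) _.
  by rewrite lee_fin ler_piMr // ltW // (gauge_gt0 sfi).
Qed.

Let xx l (c : 'I_(cells_n (Z l))) := X (cells_a c) (cells_b c).

Lemma piece_poly_limit x :
  tends (fun l => coarse_poly (@xx l) (fun c => coarse (cells_k c)) e x) (piece_poly X E e N x).
Proof.
have h := @tends_coarse_poly R A 'I_N (fun l => fiber_sum X (W l))
  (fun i => process_at X (piece E N i)) k e _ _ x.
rewrite (_ : (fun l => _) = fun l => coarse_poly (fiber_sum X (W l)) id e x).
  by apply: h => i; have [] := piece_limit i.
by apply: funext => l; rewrite coarse_poly_fibers.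
Qed.

Lemma leb_near (F G : set R) (d c : R) : measurable F -> measurable G ->
  (leb F <= c%:E)%E -> (leb (F `+` G) <= d%:E)%E -> (leb G <= (c + d)%:E)%E.
Proof.
move=> mF mG Fc FG; apply: (@le_trans _ _ (leb (F `|` (F `+` G)))).
  apply: leb_le => //; first by apply: measurableU => //; exact: setY_measurable.
  by move=> x /= xG; have [|] := pselect (F x); tauto.
apply: (le_trans (lebU2 mF (setY_measurable mF mG))).
by rewrite EFinD; apply: leeD.
Qed.

(** A piece has mass at most [s / N], and the approximation error [gauge / L] is at most [1 / N].
    This is the [delta] of the norm estimate. *)
Lemma coarse_fiber_mass l (i : 'I_N) :
  #|[pred c : 'I_(cells_n (Z l)) | coarse (cells_k c) == i]|%:R * cells_h (Z l) <=
  (s + 1) / N%:R.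
Proof.
have [_ _ dis _] := Zapp l.
have := @fiber_mass R 'I_N (W l) i dis => mass.
have g1 := gauge_le sfi l.
have NL : L%:R^-1 <= N%:R^-1 :> R by rewrite lef_pV2 ?posrE ?ltr0n // ler_nat LNm leq_pmulr.
apply: (@le_trans _ _ (s / N%:R + gauge X l / L%:R)); last first.
  rewrite mulrDl mul1r lerD2l; apply: le_trans NL; rewrite ler_piMl ?invr_ge0 //; lra.
rewrite -lee_fin -mass.
apply: leb_near (coarse_approximation l i); first exact: piece_measurable.
  exact: fiber_measurable.
exact: piece_le.
Qed.

Lemma total_mass l : (cells_n (Z l))%:R * cells_h (Z l) <= s + 1.
Proof.
have -> : cells_n (Z l) = (\sum_(i < N)
    #|[pred c : 'I_(cells_n (Z l)) | coarse (cells_k c) == i]|)%N.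
  rewrite -[LHS]card_ord -sum1_card.
  rewrite (partition_big (fun c : 'I_(cells_n (Z l)) => coarse (cells_k c)) predT) //=.
  by apply: eq_bigr => i _; rewrite sum1dep_card cardsE.
rewrite natr_sum mulr_suml.
apply: (@le_trans _ _ (\sum_(i < N) (s + 1) / N%:R)).
  by apply: ler_sum => i _; exact: coarse_fiber_mass.
by rewrite sumr_const card_ord -[_ *+ N]mulr_natr divfK // gt_eqF // ltr0n.
Qed.

Lemma opnorm_coarse_step l :
  opnorm (coarse_poly (@xx l) (fun c => coarse (cells_k c)) e - coarse_poly (@xx l) id e) <=
  Num.sqrt (C0 * ((s + 1) / N%:R)).
Proof.
have [h0 hL dis app] := Zapp l; have h1 := h01 l.
have N0R : 0 < N%:R :> R by rewrite ltr0n.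
have -> : C0 * ((s + 1) / N%:R) = #|{ffun 'I_k -> letter}|%:R ^+ 2 *
   (4 * (word_bound (growth (increment_bound X)) (mean_rate X) (s + 2) ^+ k * ((s + 1) / N%:R))).
  by rewrite /C0 /piece_constant -/s; ring.
apply: (@opnorm_coarse_diff R A _ (@xx l) (increment_bound X) (mean_rate X) (cells_h (Z l))).
- by move=> c; apply: (incrementM sfi); case: dis.
- by move=> c; apply: (increment_sa sfi); case: dis.
- exact: (sfi_free sfi dis).
- exact: increment_bound_gt0.
- exact: h0.
- exact: (mean_rate_ge1 sfi).
- by rewrite -lerBlDr (le_trans _ s0) //; lra.
- by move=> c v; exact: (increment_le semi sfi).
- by move=> c; exact: (increment_mean_le semi sfi).
- by move=> c; exact: (increment_sq_le semi sfi).
- by rewrite card_ord (le_trans (total_mass l)) // lerD2l; lra.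
- apply: (le_trans hL); rewrite (@le_trans _ _ N%:R^-1) //.
    by rewrite lef_pV2 ?posrE // ler_nat LNm leq_pmulr // m0.
  by rewrite ler_peMl ?invr_ge0 ?ler0n // lerDr.
- rewrite ler_pdivrMr //; have N1 : (1 : R) <= N%:R by rewrite ler1n.
  apply: (@le_trans _ _ (s + 2)); first by lra.
  by rewrite ler_peMr // addr_ge0.
- exact: coarse_fiber_mass.
Qed.

(** The comparison polynomial, with one label per cell, depends on [Z] but not on [N]; two divisions
    refined by the same cells can thus be compared through it. *)
Lemma piece_poly_near : exists2 u : nat -> ts_op A,
  forall x, tends (fun l => u l x) (piece_poly X E e N x) &
  forall l, opnorm (u l - coarse_poly (@xx l) id e) <= Num.sqrt (C0 * ((s + 1) / N%:R)).
Proof.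
by exists (fun l => coarse_poly (@xx l) (fun c => coarse (cells_k c)) e);
  [exact: piece_poly_limit | exact: opnorm_coarse_step].
Qed.
End Coarsening.
End PiecePolynomials.

(** * Cauchy estimate and inversion over equality patterns *)

Section Convergence.
Context {R : realType} (A : tracial_space R).
Local Notation law := (probability (measurableTypeR R) R).
Local Notation leb := (@lebesgue_measure R).
Local Notation M := (@ts_alg R A).
Variables (mu : law) (mu_ : R -> law) (X : R -> R -> ts_op A).
Hypothesis semi : is_free_conv_semigroup mu mu_.
Hypothesis sfi : stationary_free_increments mu_ X.
Variable E : set R.
Hypotheses (mE : measurable E) (Eoo : (leb E < +oo)%E).
Variable k : nat.
Let D : R := piece_constant X E k * (fine (leb E) + 1).

Let D0 : 0 <= D.
Proof.
rewrite /D /piece_constant /word_bound; apply: mulr_ge0; last by rewrite addr_ge0 // fine_ge0.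
apply: mulr_ge0; first exact: sqr_ge0.
apply: mulr_ge0 => //; apply: exprn_ge0; apply: addr_ge0.
  by apply: mulr_ge0 => //; exact: sqr_ge0.
by apply: mulr_ge0; [apply: mulr_ge0 => //|]; exact: sqr_ge0.
Qed.

Lemma piece_polyM (e : rel 'I_k) N : M (piece_poly X E e N).
Proof.
apply: coarse_polyM => i; have N0 : (0 < N)%N by case: (N) i => // -[].
have [Z ZP] := cells_approximation sfi mE Eoo N0.
by have [] := piece_limit semi sfi mE Eoo N0 N0 (esym (muln1 N)) ZP i.
Qed.

(** One family of cells, adapted to the [N m] pieces, serves both divisions. Each differs from the
    common cell polynomial by its own error, and the finer error is the smaller one. *)
Lemma opnorm_refine (e : rel 'I_k) N m : (0 < N)%N -> (0 < m)%N ->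
  opnorm (piece_poly X E e N - piece_poly X E e (N * m)) <= 2 * Num.sqrt (D / N%:R).
Proof.
move=> N0 m0; have L0 : (0 < N * m)%N by rewrite muln_gt0 N0.
have [Z ZP] := cells_approximation sfi mE Eoo L0.
have [u ulim ule] := piece_poly_near semi sfi mE Eoo e L0 N0 erefl ZP.
have [v vlim vle] := piece_poly_near semi sfi mE Eoo e L0 L0 (esym (muln1 _)) ZP.
apply: (opnorm_tends (u := fun l => u l - v l)); last by move=> x; exact: tends_sub.
  by rewrite mulr_ge0 // sqrtr_ge0.
move=> l.
rewrite -(subrKA (coarse_poly (fun c : 'I_(cells_n (Z l)) => X (cells_a c) (cells_b c)) id e)).
apply: (le_trans (opnormD _ _)); rewrite mulr_natl mulr2n; apply: lerD.
  by rewrite /D -mulrA; exact: ule.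
rewrite -opprB opnormN; apply: (le_trans (vle l)); rewrite mulrA -/D.
rewrite ler_wsqrtr // ler_wpM2l // lef_pV2 ?posrE ?ltr0n //.
by rewrite ler_nat leq_pmulr.
Qed.

Lemma piece_poly_convergent (e : rel 'I_k) : norm_convergent (piece_poly X E e).
Proof.
apply: norm_complete => [N|d d0]; first exact: piece_polyM.
(* For [N > r] the error [sqrt (D / N)] is at most [d / 4]. Going from [N] to [N N'] and back to
   [N'] costs twice that error on each side, [d] in total. *)
pose r := D / (d / 4) ^+ 2.
have d4 : 0 < d / 4 by rewrite divr_gt0.
have far N : (Num.truncn r < N)%N -> Num.sqrt (D / N%:R) <= d / 4.
  move=> rN; have N0 : 0 < N%:R :> R by rewrite ltr0n (leq_trans _ rN).
  rewrite -[leRHS](ger0_norm (ltW d4)) -sqrtr_sqr ler_wsqrtr // ler_pdivrMr //.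
  rewrite mulrC -ler_pdivrMr ?exprn_gt0 // -/r ltW //.
  by apply: (lt_le_trans (truncnS_gt _)); rewrite ler_nat.
exists (Num.truncn r).+1 => N N' rN rN'.
have N0 : (0 < N)%N by exact: leq_trans rN.
have N0' : (0 < N')%N by exact: leq_trans rN'.
rewrite -(subrKA (piece_poly X E e (N * N'))); apply: (le_trans (opnormD _ _)).
rewrite -[X in _ + opnorm X]opprB opnormN {2}mulnC.
have := opnorm_refine e N0 N0'; have := opnorm_refine e N0' N0.
have := far N rN; have := far N' rN'; lra.
Qed.

(** The full equality table of a tuple replaces its partition, so that the inversion runs over all
    boolean tables ordered by inclusion. Tables that are not equivalence relations give empty
    sums. *)
Definition pattern N (i : {ffun 'I_k -> 'I_N}) : {ffun 'I_k * 'I_k -> bool} :=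
  [ffun p => i p.1 == i p.2].

Definition pattern_sum (K : {ffun 'I_k * 'I_k -> bool}) N : ts_op A :=
  \sum_(i : {ffun 'I_k -> 'I_N} | pattern i == K) \prod_(j < k) process_at X (piece E N (i j)).

Definition pattern_le (K K' : {ffun 'I_k * 'I_k -> bool}) := [forall p, K p ==> K' p].

Lemma piece_poly_patterns (K : {ffun 'I_k * 'I_k -> bool}) N :
  piece_poly X E (fun a b => K (a, b)) N = \sum_(K' | pattern_le K K') pattern_sum K' N.
Proof.
have eqk (i : {ffun 'I_k -> 'I_N}) :
    respects (fun a b => K (a, b)) id i = pattern_le K (pattern i).
  apply/respectsP/forallP => [h [a b]|h a b Kab].
    by apply/implyP => /h ab; rewrite ffunE ab.
  by have /implyP/(_ Kab) := h (a, b); rewrite ffunE => /eqP.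
rewrite /piece_poly /coarse_poly (partition_big (@pattern N) (pattern_le K)) /=; last first.
  by move=> i; rewrite eqk.
apply: eq_bigr => K' KK'; apply: eq_bigl => i.
by rewrite eqk andbC; case: eqP => // ->.
Qed.

(* Moebius inversion over the inclusion order of patterns. *)
Lemma pattern_sum_convergent K : norm_convergent (pattern_sum K).
Proof.
(* Induction on the number of false entries: every strictly larger table has fewer of them. *)
have [n le] := ubnP #|[pred p | ~~ K p]|; elim: n => // n IH in K le *.
have refl : pattern_le K K by apply/forallP => p; exact/implyP.
have -> : pattern_sum K = fun N => piece_poly X E (fun a b => K (a, b)) N -
    \sum_(K' | pattern_le K K' && (K' != K)) pattern_sum K' N.
  by apply: funext => N; rewrite piece_poly_patterns (bigD1 K) //= addrK.
apply: norm_convergentB; first exact: piece_poly_convergent.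
apply: norm_convergent_sum => K' /andP[/forallP KK' ne]; apply: IH.
rewrite -ltnS (leq_trans _ le) // ltnS; apply: proper_card; apply/properP; split.
  by apply/fintype.subsetP => p; rewrite !inE; apply: contra; exact/implyP.
have [p pne] : exists p, K' p != K p.
  apply/existsP; apply: contraNT ne => /existsPn h.
  by apply/eqP/ffunP => p; apply/eqP; rewrite -[_ == _]negbK; exact: h.
exists p; rewrite !inE; have /implyP := KK' p; move: pne.
  by case: (K p); case: (K' p) => // _ /(_ isT).
by case: (K p); case: (K' p) => // _ /(_ isT).
Qed.
End Convergence.

Theorem mainTheorem11 (R : realType) (A : tracial_space R)
    (mu : probability (measurableTypeR R) R)
    (mu_ : R -> probability (measurableTypeR R) R)
    (X : R -> R -> ts_op A) (E : set R) (k : nat) (pi : {set {set 'I_k}}) :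
  compactly_supported mu ->
  freely_infinitely_divisible mu ->
  variance mu (fun x => x) = 1%E ->
  is_free_conv_semigroup mu mu_ ->
  stationary_free_increments mu_ X ->
  half_open_union E -> (lebesgue_measure E < +oo)%E ->
  (0 < k)%N -> finset.partition pi (finset.setTfor 'I_k) ->
  exists2 St : ts_op A, ts_alg St &
    opnorm (stochastic_sum X E pi N - St) @[N --> \oo] --> (0 : R).
Proof.
move=> _ _ _ semi sfi /half_open_union_measurable mE Eoo _ _.
(* The tuples compatible with [pi] are exactly those whose equality table is this membership
   table. *)
pose K : {ffun 'I_k * 'I_k -> bool} := [ffun p => p.2 \in finset.pblock pi p.1].
have [St MSt conv] := pattern_sum_convergent semi sfi mE Eoo K.
exists St => //; apply/cvgrPdist_le => e e0; have [N0 NP] := conv e e0.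
exists N0 => // N /= /NP le; rewrite sub0r normrN ger0_norm ?opnorm_ge0 //.
have -> // : stochastic_sum X E pi N = pattern_sum X E K N.
apply: eq_bigl => i; apply/forallP/eqP => [h|h a].
  apply/ffunP => -[a b]; rewrite !ffunE /=; by have /forallP/(_ b)/eqP := h a.
by apply/forallP => b; have := congr1 (fun f : {ffun _ -> _} => f (a, b)) h; rewrite !ffunE /= => ->.
Qed.
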